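(* Let $\mathbb I\subset\mathbb R$ be a compact interval and let $f:\Omega\times\mathbb I\to\mathbb I$ be a random map, over a Bernoulli product space $(\Omega,\mathscr F,\mathbb P)$, of $C^1$ diffeomorphisms of $\mathbb I$ onto their images. Assume that $\|\log|f'_\omega|\,\|_\infty$ is $\mathbb P$-integrable and that there are no $p,q\in\mathbb I$ such that $\{p,q\}$ is $f_\omega$-invariant for $\mathbb P$-a.e. $\omega\in\Omega$. Then $f$ is mostly contracting. Moreover, if $\int(\|f'_\omega\|_\infty)^\beta\,d\mathbb P<\infty$ for some $\beta>0$, then the Koopman operator $P\varphi(x)=\int\varphi(f_\omega(x))\,d\mathbb P$ is quasi-compact on $C^\alpha(\mathbb I)$ for every $\alpha>0$ small enough; and if $f$ is either proximal, minimal or quasi-symmetric, then $P$ has a spectral gap.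
   Context: $(\Omega,\mathscr F,\mathbb P)=(T^{\mathbb N},\mathscr A^{\mathbb N},p^{\mathbb N})$. A (Bernoulli) random map on a compact metric space $(X,d)$ (here $X=\mathbb I$) is a measurable $f:\Omega\times X\to X$ with $f_\omega:=f(\omega,\cdot)=f_{\omega_0}$ for $\mathbb P$-a.e. $\omega$; here, for $\mathbb P$-a.e. $\omega$, $f_\omega:\mathbb I\to f_\omega(\mathbb I)\subset\mathbb I$ is a $C^1$ diffeomorphism. $f^n_\omega=f_{\omega_{n-1}}\circ\cdots\circ f_{\omega_0}$. The set $\{p,q\}$ ($p=q$ allowed) is $f_\omega$-invariant if $f_\omega(\{p,q\})=\{p,q\}$. $\mu$ is $f$-stationary if $\mathbb P\times\mu$ is invariant under $(\omega,x)\mapsto(\sigma\omega,f_\omega(x))$. $f$ is mostly contracting if $\int\log^+\mathrm{Lip}(f_\omega)\,d\mathbb P<\infty$ and $\sup_\mu\lambda(\mu)<0$ over $f$-stationary $\mu$, where $\lambda(\mu)=\lim_n\frac1n\int\log Lf^n_\omega(x)\,d\mathbb P\,d\mu$ and $Lg(z)=\lim_{r\to0^+}\mathrm{Lip}(g|_{B(z,r)})$ (here $Lg(z)=|g'(z)|$). $f$ is minimal if there is no proper non-empty closed $Y\subset X$ with $f_\omega(Y)\subset Y$ for $\mathbb P$-a.e. $\omega$; proximal if for all $x,y$ there is $\omega\in\Omega$ with $\liminf_n d(f^n_\omega(x),f^n_\omega(y))=0$; quasi-symmetric if the smallest closed subsemigroup of $(\mathrm{Homeo}(X),\circ)$ containing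 $f_\omega$ for $\mathbb P$-a.e. $\omega$ is a group (in particular $f_\omega\in\mathrm{Homeo}(X)$ a.s.). $P$ is quasi-compact on $C^\alpha(X)$ (the Banach space of $\alpha$-Hölder functions) if it is bounded there and $\|P^n-R\|_{\rm op}<1$ for some $n$ and some compact operator $R$; it has a spectral gap if moreover $P\varphi=\lambda\varphi$ with $|\lambda|=1$, $\varphi\neq0$ (complex-valued), forces $\lambda=1$ and $\varphi$ constant.
   Formalization: Proximal is read modulo null sets: for all x, y and every p-null set N of symbols, the ω with liminf d(f^n_ω(x), f^n_ω(y)) = 0 must exist in (T\N)^ℕ; with merely ''ω in Ω'', a null symbol acting as a contraction makes the spectral gap claim false. *)

(* Defs.v *)
(* MathComp / MathComp-Analysis. *)
From HB Require Import structures.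
From mathcomp Require Import all_boot all_order all_algebra.
From mathcomp Require Import all_classical all_reals all_analysis.
From mathcomp Require Import complex.

Set Implicit Arguments.
Unset Strict Implicit.
Unset Printing Implicit Defensive.
Import Order.TTheory GRing.Theory Num.Theory.
Import numFieldNormedType.Exports.

Local Open Scope classical_set_scope.
Local Open Scope ring_scope.

(* Functions on the interval I = `[a, b] are represented by functions on R of
   which only the restriction to I is ever used. *)

Section BernoulliSpace.
Context {d : measure_display} {T : measurableType d} {R : realType}.

Definition coord_sets : set (set (nat -> T)) :=
  [set C | exists i (A : set T), measurable A /\ C = [set w | A (w i)]].

(* T^N with the product sigma-algebra *)
Definition path_space := g_sigma_algebraType coord_sets.

Definition shift (w : path_space) : path_space := fun i => w i.+1.

(* P = p^N: this determines P on a pi-system generating the sigma-algebra. *)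
Definition is_product_measure (p : probability T R)
    (P : probability path_space R) : Prop :=
  forall (n : nat) (A : nat -> set T), (forall i, measurable (A i)) ->
  P [set w | forall i, (i < n)%N -> A i (w i)] = (\prod_(i < n) p (A i))%E.

End BernoulliSpace.
Arguments path_space {d} T.

Section Calculus.
Context {R : realType}.
Implicit Types (A : set R) (g h : R -> R).

(* The derivative relative to A: one-sided at the endpoints of an interval. *)
Definition diff_quotient g (x y : R) : R := (g y - g x) / (y - x).

Definition derivable_on A g (x : R) : Prop :=
  cvg (diff_quotient g x y @[y --> within A x^']).

Definition derivative_on A g (x : R) : R :=
  lim (diff_quotient g x y @[y --> within A x^']).

Definition C1_on A g : Prop :=
  (forall x, A x -> derivable_on A g x) /\
  {within A, continuous (derivative_on A g)}.

Definition C1_diffeo_onto_image A g : Prop :=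
  C1_on A g /\
  exists2 h, C1_on (g @` A) h & forall x, A x -> h (g x) = x.

Definition sup_norm_on A g : \bar R := ereal_sup [set `|g x|%:E | x in A].

(* The best Lipschitz constant of the restriction of g to A, +oo if none *)
Definition Lip A g : \bar R :=
  ereal_inf [set k%:E | k in [set k : R | 0 <= k /\ k.-lipschitz_A g]].

Definition local_Lip A g (z : R) : \bar R :=
  lim (Lip (A `&` ball z r) g @[r --> 0^'+]).

Definition homeo_of A h : Prop :=
  exists g : R -> R,
    [/\ {within A, continuous h}, {within A, continuous g},
        (forall x, A x -> A (h x) /\ A (g x)) &
        forall x, A x -> g (h x) = x /\ h (g x) = x].

(* Closed subsemigroups of Homeo(A) for the topology of uniform convergence *)
Definition closed_subsemigroup A (S : set (R -> R)) : Prop :=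
  [/\ S `<=` homeo_of A,
      (forall g h, S g -> S h -> S (g \o h)) &
      closure (S : set {uniform` A -> R}) `&` homeo_of A `<=` S].

Definition is_subgroup A (S : set (R -> R)) : Prop :=
  S id /\
  forall g, S g -> exists2 h, S h & forall x, A x -> h (g x) = x /\ g (h x) = x.

End Calculus.

Section RandomMaps.
Context {d : measure_display} {T : measurableType d} {R : realType}.
Variables (p : probability T R) (P : probability (path_space T) R).
Variables (I : set R) (f : T -> R -> R).
(* For w in T^N, the map f_w is f (w 0). *)

Definition random_map : Prop :=
  (forall t x, I x -> I (f t x)) /\
  measurable_fun ([set: T] `*` I)
    (fun z : T * measurableTypeR R => f z.1 z.2 : measurableTypeR R).

Fixpoint cocycle (n : nat) (w : path_space T) : R -> R :=
  if n is m.+1 then f (w m) \o cocycle m w else id.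

Definition skew_product (z : path_space T * measurableTypeR R) :
    path_space T * measurableTypeR R :=
  (shift z.1, f (z.1 0%N) z.2).

Definition stationary (mu : probability (measurableTypeR R) R) : Prop :=
  mu I = 1%E /\
  forall B : set (path_space T * measurableTypeR R), measurable B ->
  (P \x mu)%E (([set: path_space T] `*` I) `&` skew_product @^-1` B) =
  (P \x mu)%E B.

Definition lyapunov_exponent (mu : probability (measurableTypeR R) R) : \bar R :=
  limn (fun n => (n%:R^-1)%:E *
    \int[(P \x mu)%E]_(z in [set: path_space T] `*` I)
      lne (local_Lip I (cocycle n z.1) z.2))%E.

Definition mostly_contracting : Prop :=
  (\int[P]_w maxe (lne (Lip I (f (w 0%N)))) 0 < +oo)%E /\
  (ereal_sup [set lyapunov_exponent mu | mu in stationary] < 0)%E.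

Definition minimal : Prop :=
  forall Y : set R, closed Y -> Y !=set0 -> Y `<=` I ->
  {ae P, forall w, f (w 0%N) @` Y `<=` Y} -> Y = I.

(* The sequence w is required to exist after any p-null set of symbols has been
   discarded from T; otherwise the notion would depend on the values of f at
   symbols that are invisible to P (when T has no nonempty null set, N is empty
   and w ranges over all of T^N). *)
Definition proximal : Prop :=
  forall x y, I x -> I y -> forall N : set T, p.-negligible N ->
  exists2 w : path_space T, (forall i, ~ N (w i)) &
    limn_einf (fun n => `|cocycle n w x - cocycle n w y|%:E) = 0%E.

Definition quasi_symmetric : Prop :=
  exists G : set (R -> R),
    [/\ closed_subsemigroup I G,
        {ae P, forall w, G (f (w 0%N))},
        (forall S, closed_subsemigroup I S ->
           {ae P, forall w, S (f (w 0%N))} -> G `<=` S) &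
        is_subgroup I G].

Definition koopman (phi : R -> R[i]) (x : R) : R[i] :=
  Complex (\int[P]_w complex.Re (phi (f (w 0%N) x))) (\int[P]_w complex.Im (phi (f (w 0%N) x))).

End RandomMaps.

(* The Banach space C^alpha(I) of complex-valued alpha-Hoelder functions is
   carried by the functions of finite holder_norm, modulo equality on I. *)
Section HolderSpace.
Context {R : realType}.
Variables (I : set R) (alpha : R).
Implicit Types (phi psi : R -> R[i]) (Q : (R -> R[i]) -> (R -> R[i])).

Definition holder_norm phi : \bar R :=
  (ereal_sup [set (complex.Re `|phi x|)%:E | x in I] +
   ereal_sup [set (complex.Re `|phi z.1 - phi z.2| / `|z.1 - z.2| `^ alpha)%:E
               | z in [set z : R * R | [/\ I z.1, I z.2 & z.1 != z.2]]])%E.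

Definition holder phi : Prop := (holder_norm phi < +oo)%E.

Definition op_norm Q : \bar R :=
  ereal_sup [set holder_norm (Q phi) | phi in [set phi | (holder_norm phi <= 1)%E]].

Definition holder_linear Q : Prop :=
  (forall phi, holder phi -> holder (Q phi)) /\
  forall (c : R[i]) phi psi, holder phi -> holder psi ->
  forall x, I x -> Q (fun y => c * phi y + psi y) x = c * Q phi x + Q psi x.

Definition compact_operator Q : Prop :=
  holder_linear Q /\
  forall u : nat -> R -> R[i], (forall k, (holder_norm (u k) <= 1)%E) ->
  exists (s : nat -> nat) (psi : R -> R[i]),
    [/\ {homo s : i j / (i < j)%N}, holder psi &
        holder_norm (fun x => Q (u (s k)) x - psi x) @[k --> \oo] --> 0%E].

Definition quasi_compact Q : Prop :=
  [/\ holder_linear Q, (op_norm Q < +oo)%E &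
      exists (n : nat) (K : (R -> R[i]) -> (R -> R[i])),
        [/\ (0 < n)%N, compact_operator K &
            (op_norm (fun phi x => iter n Q phi x - K phi x)%R < 1)%E]].

Definition spectral_gap Q : Prop :=
  quasi_compact Q /\
  forall (lambda : R[i]) phi, holder phi ->
  (exists2 x, I x & phi x != 0) ->
  `|lambda| = 1 -> (forall x, I x -> Q phi x = lambda * phi x) ->
  lambda = 1 /\ exists c : R[i], forall x, I x -> phi x = c.

End HolderSpace.

(* Main.v *)
(** Write q(w, x, y) for the logarithm of |f_w x - f_w y| / |x - y|, extended by
    ln |f_w'(x)| to x = y, and E for the expectation.  The key fact is a drift
    condition: there are a continuous h and c > 0 with
      E q(w, x, x) + E h(f_w x) - h x <= - c   for all x in [a, b].
    It is proved without stationary measures.  After doubling the states so that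
    all maps increase, each point leads with positive probability to an interval
    with two-sided mixing (nondegenerate, as no pair is invariant) on which, by a
    Dubins-Freedman oscillation argument, E |f^n x - f^n y| decays exponentially.
    Concavity of ln and continuity of q turn this into a negative drift of
    ln |(f^n)'| there, and compactness spreads it to [a, b].

    Integrating the drift condition against a stationary measure bounds all
    exponents by - c.  The exponential moment gives, for small alpha and for
    |x - y| small, E |f_w x - f_w y|^alpha e^(alpha h(f_w x)) <=
    (1 - alpha c') |x - y|^alpha e^(alpha h x), hence a Lasota-Yorke inequality,
    and P^n composed with piecewise linear interpolation is the finite rank
    approximation.  If P phi = lambda phi with |lambda| = 1, then
    phi (f_w x) = lambda phi x a.s. on the set where |phi| is maximal.  Minimality
    makes this set the whole interval, where f_w has a fixed point; proximality
    makes phi constant on it.  Quasi-symmetry is excluded: onto maps would leave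
    the set of endpoints invariant. *)
Require Import Defs.
From HB Require Import structures.
From mathcomp Require Import all_boot all_order all_algebra.
From mathcomp Require Import all_classical all_reals all_analysis.
From mathcomp Require Import measurable_realfun.
From mathcomp Require Import complex.
From mathcomp Require Import ring lra.

Set Implicit Arguments.
Unset Strict Implicit.
Unset Printing Implicit Defensive.
Import Order.TTheory GRing.Theory Num.Theory.
Import numFieldNormedType.Exports.

Local Open Scope classical_set_scope.
Local Open Scope ring_scope.

(** * Expectations *)

(** The drift must hold at every point, not only on supports of stationary measures, because
    quasi-compactness needs it uniformly in x; hence the detour through reachability and
    compactness. The main obstacle is orientation. The mean of the distance of two n-th images is a
    difference of values of one function, the mean n-th position, only when all maps increase. This
    linearity turns contraction in mean into decay of the oscillation of isotone functions, and
    doubling the states is its price: a decreasing map exchanges the two copies of the interval, so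
    only sums over both copies are controlled. Reaching a set with positive probability is expressed
    throughout by positivity of iterated expectations of continuous functions, a class that the
    transition operator preserves. The null set of paths without a diffeomorphism is removed once,
    by putting the identity there; integrands of the statement that are not known to be measurable
    are compared with measurable ones through lower integrals. *)

Section Expectation.
Context {d : measure_display} {Om : measurableType d} {R : realType}.
Variable P : probability Om R.
Implicit Types (u v s : Om -> R) (c M : R).

Definition intg u := P.-integrable setT (EFin \o u).

Lemma intg_meas u : intg u -> measurable_fun setT u.
Proof. by move=> /integrableP[/measurable_EFinP]. Qed.

Lemma intgD u v : intg u -> intg v -> intg (fun w => u w + v w).
Proof.
by move=> iu iv; apply: (eq_integrable measurableT _ _ _ (integrableD measurableT iu iv)).
Qed.

Lemma intgN u : intg u -> intg (fun w => - u w).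
Proof.
by move=> iu; apply: (eq_integrable measurableT _ _ _ (integrableN iu)).
Qed.

Lemma intgB u v : intg u -> intg v -> intg (fun w => u w - v w).
Proof. by move=> iu iv; apply: intgD => //; exact: intgN. Qed.

Lemma intgZ c u : intg u -> intg (fun w => c * u w).
Proof.
by move=> iu; apply: (eq_integrable measurableT _ _ _ (integrableZl measurableT c iu)).
Qed.

Lemma intg_dom u s : measurable_fun setT u -> intg s ->
  (forall w, `|u w| <= s w) -> intg u.
Proof.
move=> mu is_ us; apply: (le_integrable measurableT _ _ is_) => /=.
  exact/measurable_EFinP.
by move=> w _; rewrite lee_fin (le_trans (us w)) ?ler_norm.
Qed.

Lemma intg_cst c : intg (fun=> c).
Proof. exact: finite_measure_integrable_cst. Qed.

Lemma intg_bnd u c : measurable_fun setT u -> (forall w, `|u w| <= c) -> intg u.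
Proof. by move=> mu uc; exact: (intg_dom mu (intg_cst c)). Qed.

Lemma E_le u v : intg u -> intg v -> (forall w, u w <= v w) ->
  \int[P]_w u w <= \int[P]_w v w.
Proof. by move=> iu iv uv; apply: le_Rintegral. Qed.

Lemma E_cst c : \int[P]_w c = c.
Proof.
by rewrite Rintegral_cst//= [X in fine X](@probability_setT _ _ _ P) mulr1.
Qed.

Lemma E_D u v : intg u -> intg v ->
  \int[P]_w (u w + v w) = \int[P]_w u w + \int[P]_w v w.
Proof. by move=> iu iv; exact: RintegralD. Qed.

Lemma E_B u v : intg u -> intg v ->
  \int[P]_w (u w - v w) = \int[P]_w u w - \int[P]_w v w.
Proof. by move=> iu iv; exact: RintegralB. Qed.

Lemma E_Z c u : intg u -> \int[P]_w (c * u w) = c * \int[P]_w u w.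
Proof. by move=> iu; exact: RintegralZl. Qed.

Lemma E_norm u : intg u -> `|\int[P]_w u w| <= \int[P]_w `|u w|.
Proof. by move=> iu; exact: le_normr_Rintegral. Qed.

Lemma intg_norm u : intg u -> intg (fun w => `|u w|).
Proof. by move=> iu; exact: integrable_norm. Qed.

Lemma E_bnd u c : intg u -> (forall w, `|u w| <= c) -> `|\int[P]_w u w| <= c.
Proof.
move=> iu uc; apply: (le_trans (E_norm iu)); rewrite -[leRHS]E_cst.
by apply: E_le => //; [exact: intg_norm|exact: intg_cst].
Qed.

Lemma E_cvg (u_ : nat -> Om -> R) u s : (forall n, measurable_fun setT (u_ n)) ->
  intg s -> (forall n w, `|u_ n w| <= s w) ->
  (forall w, u_ ^~ w @ \oo --> u w) ->
  intg u /\ \int[P]_w u_ n w @[n --> \oo] --> \int[P]_w u w.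
Proof.
move=> mu_ is_ us uu.
have mu : measurable_fun setT u.
  by apply: (measurable_fun_cvg mu_) => w _; exact: uu.
have [|||||i _ cv] := @dominated_convergence _ _ _ P setT measurableT
    (fun n => EFin \o u_ n) (EFin \o u) (EFin \o s).
- by move=> n; exact/measurable_EFinP.
- exact/measurable_EFinP.
- by apply: aeW => w _; apply: cvg_EFin; [exact: nearW|exact: uu].
- exact: is_.
- by apply: aeW => w n _; rewrite lee_fin.
split => //; rewrite /Rintegral; apply: fine_cvg; rewrite fineK//.
exact: integrable_fin_num.
Qed.

Lemma E_eq0_ae u : intg u -> (forall w, 0 <= u w) -> \int[P]_w u w = 0 ->
  {ae P, forall w, u w = 0}.
Proof.
move=> iu u0 E0.
have : (\int[P]_w `|(u w)%:E| = 0)%E.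
  under eq_integral do rewrite gee0_abs ?lee_fin//.
  rewrite -[LHS]fineK ?integrable_fin_num//.
  by rewrite -[fine _]/(\int[P]_w u w) E0.
have mu : measurable_fun setT (EFin \o u) by apply/measurable_EFinP/intg_meas.
move=> /(ae_eq_integral_abs P measurableT mu); apply: filterS => w /(_ Logic.I).
by case.
Qed.

(** If [v] had mean zero, it would vanish a.s., and so would [u]. *)
Lemma E_gt0 u v : intg u -> intg v -> (forall w, 0 <= v w) ->
  (forall w, 0 <= u w) ->
  {ae P, forall w, 0 < u w -> 0 < v w} -> 0 < \int[P]_w u w -> 0 < \int[P]_w v w.
Proof.
move=> iu iv v0 u0 uv; apply: contraTT; rewrite -!leNgt => Ev0.
have Ev : \int[P]_w v w = 0.
  by apply/eqP; rewrite eq_le Ev0 Rintegral_ge0.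
suff : ae_eq P setT (EFin \o u) (cst 0%E).
  move=> uv0; rewrite /Rintegral.
  have -> : (\int[P]_w (u w)%:E = \int[P]_w (cst 0 w))%E.
    apply: ae_eq_integral => //; apply/measurable_EFinP.
    exact: (intg_meas iu).
  by rewrite integral0.
move: uv (E_eq0_ae iv v0 Ev); apply: filterS2 => w uvw vw0 _ /=.
by congr EFin; apply/eqP; rewrite eq_le u0 andbT leNgt; apply/negP => /uvw; rewrite vw0 ltxx.
Qed.

Lemma E_ae_eq u v : measurable_fun setT u -> measurable_fun setT v ->
  {ae P, forall w, u w = v w} -> \int[P]_w u w = \int[P]_w v w.
Proof.
move=> mu mv uv; rewrite /Rintegral; congr fine; apply: ae_eq_integral => //.
- exact/measurable_EFinP.
- exact/measurable_EFinP.
- by apply: filterS uv => w -> _.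
Qed.

(** The minimum of [u] and [v] differs from [u] on a null set only and lies below [v] everywhere. *)
Lemma E_le_ae u v : intg u -> intg v -> {ae P, forall w, u w <= v w} ->
  \int[P]_w u w <= \int[P]_w v w.
Proof.
move=> iu iv uv.
have mm : measurable_fun setT (fun w => Num.min (u w) (v w)).
  by apply: measurable_minr; exact: intg_meas.
have im : intg (fun w => Num.min (u w) (v w)).
  apply: (intg_dom mm (intgD (intg_norm iu) (intg_norm iv))) => w.
  by have := normr_ge0 (u w); have := normr_ge0 (v w); rewrite /Num.min; case: ifP => *; lra.
rewrite (@E_ae_eq u (fun w => Num.min (u w) (v w))) //.
- by apply: E_le => // w; rewrite ge_min lexx orbT.
- exact: intg_meas.
- by move: uv; apply: filterS => w uvw; apply/esym/min_idPl.
Qed.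

End Expectation.

(** * Signed states and the drift condition *)

Section SignedOperator.
Context {d : measure_display} {Om : measurableType d} {R : realType}.
Variables (P : probability Om R) (a b : R) (g : Om -> R -> R) (dec : Om -> bool).
Hypothesis g_meas : forall x, measurable_fun setT (g ^~ x).
Hypothesis g_range : forall w x, a <= g w x <= b.
Hypothesis g_cont : forall w, continuous (g w).
Hypothesis dec_meas : measurable_fun setT dec.
Implicit Types (s : bool) (x y c : R) (phi psi : bool -> R -> R).

Definition sg s : R := if s then 1 else -1.

Lemma sgK s x : sg s * (sg s * x) = x.
Proof. by case: s => /=; rewrite /sg ?mul1r// !mulN1r opprK. Qed.

Lemma sgN s : sg (~~ s) = - sg s.
Proof. by case: s; rewrite /sg /= ?opprK. Qed.

(* To make all maps increasing, a point y of [a, b] is represented by the two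
   signed states (s, x) with y = sg s * x, and a decreasing map changes s. *)
Definition flip w s := s (+) dec w.
Definition hat w s x := sg (flip w s) * g w (sg s * x).
Definition dom s x := a <= sg s * x <= b.
Definition ok phi := forall s, continuous (phi s).
(** Transition operator of the signed chain. Independence of successive maps enters only as
    iteration of [K], so n-step means need no space of n draws. *)
Definition K phi s x : R := \int[P]_w phi (flip w s) (hat w s x).

Lemma hat_dom w s x : dom (flip w s) (hat w s x).
Proof. by rewrite /dom /hat sgK. Qed.

Lemma dom_bnd s x : dom s x -> - (`|a| + `|b|) <= x <= `|a| + `|b|.
Proof.
rewrite -ler_norml => /andP[ax xb].
rewrite (_ : `|x| = `|sg s * x|).
  have := ler_norm b; have := ler_norm (- a); rewrite normrN.
  have := normr_ge0 b; have := normr_ge0 a.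
  by rewrite ler_norml => *; apply/andP; split; lra.
by rewrite normrM; case: (s); rewrite /sg ?normrN normr1 mul1r.
Qed.

Lemma ok_bnd phi : ok phi -> exists M, forall s x, dom s x -> `|phi s x| <= M.
Proof.
move=> okp; pose B := `|a| + `|b|.
have B0 : - B <= B by have := normr_ge0 b; have := normr_ge0 a; rewrite /B; lra.
have H s : exists M, forall x, dom s x -> `|phi s x| <= M.
  have cn : {within `[- B, B], continuous (fun x => `|phi s x|)}.
    apply: continuous_subspaceT => x.
    by apply: continuous_comp; [exact: okp|exact: norm_continuous].
  have [c _ cM] := EVT_max B0 cn.
  by exists `|phi s c| => x /dom_bnd xB; apply: cM; rewrite in_itv.
have [M1 H1] := H true; have [M2 H2] := H false.
exists (Num.max M1 M2) => -[] x dx; rewrite le_max.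
  by rewrite H1.
by rewrite H2 ?orbT.
Qed.

Lemma meas_integrand phi s x : ok phi ->
  measurable_fun setT (fun w => phi (flip w s) (hat w s x)).
Proof.
move=> okp.
rewrite (_ : (fun w => _) = fun w => if dec w
    then (phi (~~ s) \o (fun y => sg (~~ s) * y)) (g w (sg s * x))
    else (phi s \o (fun y => sg s * y)) (g w (sg s * x))); last first.
  apply/funext => w; rewrite /flip /hat /flip; case: (dec w) => /=.
    by rewrite addbT.
  by rewrite addbF.
have H s' : measurable_fun setT
    (fun w => (phi s' \o (fun y => sg s' * y)) (g w (sg s * x))).
  apply: (@measurableT_comp _ _ _ _ _ _ (phi s' \o (fun y => sg s' * y))) => //.
  apply: continuous_measurable_fun => y; apply: continuous_comp; last exact: okp.
  exact: mulrl_continuous.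
by apply: measurable_fun_ifT.
Qed.

Lemma K_intg phi s x : ok phi -> intg P (fun w => phi (flip w s) (hat w s x)).
Proof.
move=> okp; have [M HM] := ok_bnd okp.
apply: (intg_bnd P (meas_integrand _ _ okp)) => w.
by apply: HM; exact: hat_dom.
Qed.

Lemma K_ok phi : ok phi -> ok (K phi).
Proof.
move=> okp s x; have [M HM] := ok_bnd okp.
apply/(@cvg_nbhsP _ R^o) => u ux.
have [] // := @E_cvg _ _ _ P (fun n w => phi (flip w s) (hat w s (u n)))
   (fun w => phi (flip w s) (hat w s x)) (fun=> M).
- by move=> n; exact: meas_integrand.
- exact: intg_cst.
- by move=> n w; apply: HM; exact: hat_dom.
- move=> w; apply: (continuous_cvg _ (okp _ _)).
  apply: cvgMr; apply: continuous_cvg; first exact: g_cont.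
  exact: cvgMr.
Qed.

Lemma iterK_ok n phi : ok phi -> ok (iter n K phi).
Proof. by move=> okp; elim: n => //= n IH; exact: K_ok. Qed.

Lemma K_le phi psi s x : ok phi -> ok psi ->
  (forall s x, dom s x -> phi s x <= psi s x) -> K phi s x <= K psi s x.
Proof.
by move=> o1 o2 H; apply: E_le => [||w]; try exact: K_intg; apply: H; exact: hat_dom.
Qed.

Lemma iterK_le n phi psi : ok phi -> ok psi ->
  (forall s x, dom s x -> phi s x <= psi s x) ->
  forall s x, dom s x -> iter n K phi s x <= iter n K psi s x.
Proof.
move=> o1 o2 H; elim: n => //= n IH s x dx.
by apply: K_le => //; exact: iterK_ok.
Qed.

Lemma K_cst c s x : K (fun _ _ => c) s x = c.
Proof. by rewrite /K E_cst. Qed.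

Lemma ok_cst c : ok (fun _ _ => c).
Proof. by move=> s; exact: cst_continuous. Qed.
Arguments ok_cst c : clear implicits.

Lemma K_D phi psi s x : ok phi -> ok psi ->
  K (fun s x => phi s x + psi s x) s x = K phi s x + K psi s x.
Proof. by move=> o1 o2; rewrite /K E_D//; exact: K_intg. Qed.

Lemma ok_D phi psi : ok phi -> ok psi -> ok (fun s x => phi s x + psi s x).
Proof. by move=> o1 o2 s x; apply: continuousD; [exact: o1|exact: o2]. Qed.

Lemma K_Z c phi s x : ok phi -> K (fun s x => c * phi s x) s x = c * K phi s x.
Proof. by move=> o1; rewrite /K E_Z//; exact: K_intg. Qed.

Lemma ok_Z c phi : ok phi -> ok (fun s x => c * phi s x).
Proof. by move=> o1 s x; apply: continuousM; [exact: cst_continuous|exact: o1]. Qed.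

Hypothesis g_mono : forall w x y, a <= x -> x < y -> y <= b ->
  if dec w then g w y < g w x else g w x < g w y.

Lemma hat_lt w s x y : dom s x -> dom s y -> x < y -> hat w s x < hat w s y.
Proof.
move=> /andP[ax xb] /andP[ay yb] xy; rewrite /hat /flip.
have := @g_mono w (sg s * x) (sg s * y); have := @g_mono w (sg s * y) (sg s * x).
by move: ax xb ay yb; case: s; case: (dec w); rewrite /sg /= ?mul1r ?mulN1r => *; lra.
Qed.

Lemma hat_le w s x y : dom s x -> dom s y -> x <= y -> hat w s x <= hat w s y.
Proof.
move=> dx dy; rewrite le_eqVlt => /predU1P[->//|/(hat_lt w dx dy)].
exact: ltW.
Qed.

Lemma sg_opp s x : sg (~~ s) * (- x) = sg s * x.
Proof. by rewrite sgN mulNr mulrN opprK. Qed.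

Lemma flipN w s : flip w (~~ s) = ~~ flip w s.
Proof. by rewrite /flip addNb. Qed.

Lemma hatN w s x : hat w (~~ s) (- x) = - hat w s x.
Proof. by rewrite /hat sg_opp flipN sgN mulNr. Qed.

Lemma domN s x : dom (~~ s) (- x) = dom s x.
Proof. by rewrite /dom sg_opp. Qed.

(** This exchanges the two signed states of each point. It commutes with the chain and reverses the
    order, so it converts every fact about lower bounds into one about upper bounds. *)
Definition refl phi : bool -> R -> R := fun s x => phi (~~ s) (- x).

Lemma ok_refl phi : ok phi -> ok (refl phi).
Proof.
move=> okp s x; apply: continuous_comp; last exact: okp.
exact: opp_continuous.
Qed.

Lemma iterK_refl n phi : iter n K (refl phi) = refl (iter n K phi).
Proof.
elim: n => //= n ->; apply/funext => s; apply/funext => x.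
by rewrite /K /refl; congr Rintegral; apply/funext => w; rewrite flipN hatN.
Qed.

Definition invariant (S : bool -> R -> Prop) := forall s x, dom s x -> S s x ->
  {ae P, forall w, S (flip w s) (hat w s x)}.

Lemma iterK_le_inv S n phi psi : invariant S -> ok phi -> ok psi ->
  (forall s x, dom s x -> S s x -> phi s x <= psi s x) ->
  forall s x, dom s x -> S s x -> iter n K phi s x <= iter n K psi s x.
Proof.
move=> iS o1 o2 H; elim: n => //= n IH s x dx Sx.
have k1 := iterK_ok (n := n) o1; have k2 := iterK_ok (n := n) o2.
apply: E_le_ae; [exact: K_intg|exact: K_intg|].
by have := iS s x dx Sx; apply: filterS => w Sw; apply: IH => //; exact: hat_dom.
Qed.

Lemma iterK_cst n c : iter n K (fun _ _ => c) = (fun _ _ => c).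
Proof. by elim: n => //= n ->; apply/funext => s; apply/funext => x; rewrite K_cst. Qed.

Lemma iterK_Z n c phi : ok phi ->
  iter n K (fun s x => c * phi s x) = fun s x => c * iter n K phi s x.
Proof.
move=> okp; elim: n => //= n ->; apply/funext => s; apply/funext => x.
by rewrite K_Z//; exact: iterK_ok.
Qed.

Lemma iterK_D n phi psi : ok phi -> ok psi ->
  iter n K (fun s x => phi s x + psi s x) =
  fun s x => iter n K phi s x + iter n K psi s x.
Proof.
move=> o1 o2; elim: n => //= n ->; apply/funext => s; apply/funext => x.
by rewrite K_D//; exact: iterK_ok.
Qed.

Lemma iterK_ge0 n phi : ok phi -> (forall s x, dom s x -> 0 <= phi s x) ->
  forall s x, dom s x -> 0 <= iter n K phi s x.
Proof.
move=> okp p0 s x dx; have := iterK_le n (ok_cst 0) okp p0 dx.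
by rewrite iterK_cst.
Qed.

(** For nonnegative [psi], positivity of [iter n K psi] at a state says that n steps lead with
    positive probability to where [psi] is positive. Domination up to a constant on an invariant set
    is enough to transfer this. *)
Lemma iterK_pos_inv S n C phi psi s x : invariant S -> ok phi -> ok psi ->
  (forall s x, dom s x -> S s x -> phi s x <= C * psi s x) -> 0 <= C ->
  dom s x -> S s x -> 0 < iter n K phi s x -> 0 < iter n K psi s x.
Proof.
move=> iS o1 o2 H C0 dx Sx p0.
have := iterK_le_inv n iS o1 (ok_Z (c := C) o2) H dx Sx; rewrite iterK_Z// => le1.
have := lt_le_trans p0 le1; rewrite le_eqVlt in C0.
by case/predU1P: C0 => [<-|C0]; rewrite ?mul0r ?ltxx// pmulr_rgt0.
Qed.

Lemma invariantT : invariant (fun _ _ => True).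
Proof. by move=> s x _ _; apply: aeW. Qed.

(** * Lowest reachable points and lower barriers *)

Definition antitone phi :=
  forall s x y, dom s x -> dom s y -> x <= y -> phi s y <= phi s x.

Lemma iterK_antitone n phi : ok phi -> antitone phi -> antitone (iter n K phi).
Proof.
move=> okp ap; elim: n => //= n IH s x y dx dy xy.
apply: E_le => [||w]; try by apply: K_intg; exact: iterK_ok.
by apply: IH; [exact: hat_dom|exact: hat_dom|exact: hat_le].
Qed.

(** A continuous substitute for the indicator of the points below [c] in component [s]. It is
    antitone, so low points are the easier to reach the lower the start. *)
Definition chi c s : bool -> R -> R :=
  fun s' x => if s' == s then Num.max (c - x) 0 else 0.

Lemma ok_chi c s : ok (chi c s).
Proof.
move=> s'; rewrite /chi; case: eqP => _ x; last exact: cst_continuous.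
apply: (@continuous_max _ _ (fun x => c - x) (cst 0)).
  by apply: continuousB; [exact: cst_continuous|].
exact: cst_continuous.
Qed.
Arguments ok_chi c s : clear implicits.

Lemma chi_ge0 c s s' x : 0 <= chi c s s' x.
Proof. by rewrite /chi; case: eqP => // _; rewrite le_max lexx orbT. Qed.

Lemma chi_le c c' s s' x : c <= c' -> chi c s s' x <= chi c' s s' x.
Proof.
move=> cc; rewrite /chi; case: eqP => // _.
by rewrite ge_max !le_max lexx orbT andbT lerD2r cc.
Qed.

Lemma chi_antitone c s : antitone (chi c s).
Proof.
move=> s' x y _ _ xy; rewrite /chi; case: eqP => // _.
by rewrite ge_max !le_max lexx orbT andbT lerD2l lerN2 xy.
Qed.

Implicit Types (u al be : bool -> R).

(* [rho u s]: the lowest point of component s that the states (u s0, s0) reach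
   with positive probability. *)
Definition reach u s c := exists m s0, 0 < iter m K (chi c s) s0 (u s0).
Definition rho u s := inf [set c | reach u s c].
Definition domw u := forall s, dom s (u s).
Definition Sub al := forall s, {ae P, forall w, al (flip w s) <= hat w s (al s)}.

Lemma reach_self u s c : u s < c -> reach u s c.
Proof. by move=> uc; exists 0%N, s; rewrite /= /chi eqxx lt_max subr_gt0 uc. Qed.

Lemma Sub_inv al : domw al -> Sub al -> invariant (fun s x => al s <= x).
Proof.
move=> da Sa s x dx ax; have := Sa s; apply: filterS => w /le_trans; apply.
exact: hat_le.
Qed.

Lemma reach_gt al u s c : domw al -> domw u -> Sub al -> (forall s, al s <= u s) ->
  reach u s c -> al s < c.
Proof.
move=> da du Sa au [m [s0]]; apply: contraTT; rewrite -!leNgt => cal.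
have := iterK_le_inv m (Sub_inv da Sa) (ok_chi c s) (ok_cst 0) _ (du s0) (au s0).
rewrite iterK_cst; apply => s' x _ ax; rewrite /chi; case: eqP => // E.
by rewrite ge_max lexx andbT subr_le0 (le_trans cal)// -E.
Qed.

Definition lo s := if s then a else - b.

Lemma dom_lo s x : a <= b -> dom s x -> lo s <= x.
Proof. by move=> ab; rewrite /dom /sg /lo; case: s; rewrite ?mul1r ?mulN1r => /andP[]; lra. Qed.

Hypothesis ab : a < b.

Lemma lo_dom : domw lo.
Proof. by case; rewrite /dom /sg /lo ?mul1r ?mulN1r; apply/andP; split; have := ab; lra. Qed.

Lemma lo_Sub : Sub lo.
Proof. by move=> s; apply: aeW => w; apply: dom_lo; [exact: ltW|exact: hat_dom]. Qed.

Lemma reach_lo u s c : domw u -> reach u s c -> lo s < c.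
Proof. by move=> du; apply: (reach_gt lo_dom du lo_Sub) => s'; apply: dom_lo => //; exact: ltW. Qed.

Lemma rho_le_reach u s c : domw u -> reach u s c -> rho u s <= c.
Proof.
move=> du rc; apply: ge_inf => //; exists (lo s) => x /= /reach_lo-/(_ du).
exact: ltW.
Qed.

(** [Sub al] says that a.s. no state on or above [al] is sent below it. With [rho_le] and [rho_Sub],
    this makes [rho u] the greatest such barrier below [u]. *)
Lemma rho_ge al u s : domw al -> domw u -> Sub al -> (forall s, al s <= u s) ->
  al s <= rho u s.
Proof.
move=> da du Sa au; apply: lb_le_inf.
  by exists (u s + 1); apply: reach_self; rewrite ltrDl.
by move=> c /= /(reach_gt da du Sa au) /ltW.
Qed.

Lemma rho_le u s : domw u -> rho u s <= u s.
Proof.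
move=> du; apply/ler_addgt0Pr => e e0; apply: rho_le_reach => //.
by apply: reach_self; rewrite ltrDl.
Qed.

Lemma rho_dom u : domw u -> domw (rho u).
Proof.
move=> du s; have l1 := rho_le s du.
have l2 := rho_ge s lo_dom du lo_Sub (fun s => dom_lo (ltW ab) (du s)).
have := du s; move: l1 l2; rewrite /dom /sg /lo.
by case: s; rewrite ?mul1r ?mulN1r => l1 l2 /andP[l3 l4]; apply/andP; split; lra.
Qed.

Lemma reach_le u s c c' : domw u -> c <= c' -> reach u s c -> reach u s c'.
Proof.
move=> du cc [m [s0 r]]; exists m, s0; apply: (lt_le_trans r).
by apply: iterK_le (du s0); try exact: ok_chi; move=> s' x _; exact: chi_le.
Qed.

Lemma rho_reach u s c : domw u -> rho u s < c -> reach u s c.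
Proof.
move=> du; apply: contraPP => nr; apply/negP; rewrite -leNgt.
apply: lb_le_inf; first by exists (u s + 1); apply: reach_self; rewrite ltrDl.
move=> c' /= rc'; rewrite leNgt; apply/negP => /ltW cc; apply: nr.
exact: reach_le rc'.
Qed.

Lemma rho_mono u v s : domw u -> domw v -> (forall s, u s <= v s) ->
  rho u s <= rho v s.
Proof.
move=> du dv uv; apply: lb_le_inf.
  by exists (v s + 1); apply: reach_self; rewrite ltrDl.
move=> c /= [m [s0 r]]; apply: rho_le_reach => //; exists m, s0.
apply: (lt_le_trans r); apply: iterK_antitone => //; first exact: ok_chi.
exact: chi_antitone.
Qed.

(** Suppose one step from the barrier falls below it. By continuity and monotonicity, one step from
    every state slightly above or below the barrier point then reaches a level [c] strictly under
    the barrier. Such states are reached from [u], hence so is [c], against the infimum in [rho]. *)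
Lemma rho_Sub u : domw u -> Sub (rho u).
Proof.
move=> du s; have da := rho_dom du; set al := rho u.
suff H s' : {ae P, forall w, chi (al s') s' (flip w s) (hat w s (al s)) = 0}.
  move: (H true) (H false); apply: filterS2 => w; rewrite /chi.
  by case: (flip w s) => /= [/max_idPr + _|_ /max_idPr]; rewrite subr_le0.
have o1 := ok_chi (al s') s'.
apply: E_eq0_ae; [exact: K_intg|by move=> w; exact: chi_ge0|].
rewrite -/(K _ _ _).
apply/eqP; rewrite eq_le; apply/andP; split; last first.
  by apply: Rintegral_ge0 => w _; exact: chi_ge0.
rewrite leNgt; apply/negP; set k0 := K _ _ _ => k0_gt0.
(* Lowering the threshold by [k0 / 2] lowers [chi] by at most [k0 / 2], so half of the mean [k0]
   survives. *)
pose c := al s' - k0 / 2.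
have o2 := ok_chi c s'.
have Kc : k0 / 2 <= K (chi c s') s (al s).
  have : k0 <= K (fun s x => chi c s' s x + k0 / 2) s (al s).
    apply: K_le => //; first by apply: ok_D => //; exact: ok_cst.
    move=> s1 x _; rewrite /chi /c; case: eqP => _; last by lra.
    by rewrite ge_max; apply/andP; split; rewrite -lerBlDr le_max; apply/orP; [left|right]; lra.
  by rewrite K_D ?K_cst//; [lra|exact: ok_cst].
have /cvgrPdist_lt/(_ (k0 / 4))[|e /= e0 He] := K_ok o2 (s := s) (x := al s).
  by rewrite divr_gt0.
have Hlow x : dom s x -> x < al s + e -> k0 / 4 <= K (chi c s') s x.
  move=> dx xe; have [xa|ax] := leP x (al s).
    have : K (chi c s') s (al s) <= K (chi c s') s x.
      by apply: (@iterK_antitone 1 _ o2 _ s _ _ dx (da s) xa); exact: chi_antitone.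
    lra.
  have : `|al s - x| < e by rewrite distrC gtr0_norm ?subr_gt0//; lra.
  by move=> /He; rewrite ltr_norml => /andP[]; lra.
have [M HM] := ok_bnd (ok_chi (al s + e) s).
have M0 : 0 <= M by exact: le_trans (normr_ge0 _) (HM s _ (da s)).
have [m [s0 r]] : reach u s (al s + e).
  by apply: rho_reach => //; rewrite /al ltrDl.
suff /(rho_le_reach du) : reach u s' c by rewrite -/al /c; lra.
exists m.+1, s0; rewrite iterSr.
apply: (iterK_pos_inv (C := M / (k0 / 4)) invariantT _ _ _ _ (du s0) I r).
- exact: ok_chi.
- exact: K_ok.
- move=> s1 x dx _; have K0 : 0 <= K (chi c s') s1 x.
    by apply: Rintegral_ge0 => w _; exact: chi_ge0.
  have C0 : 0 <= M / (k0 / 4) by rewrite divr_ge0// divr_ge0// ltW.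
  have := HM s1 x dx; rewrite ger0_norm ?chi_ge0// => HMx.
  have [E|nE] := eqVneq s1 s; last first.
    by rewrite /chi (negbTE nE) mulr_ge0.
  subst s1; have [xe|ex] := ltP x (al s + e).
    apply: (le_trans HMx); rewrite -mulrA ler_peMr// mulrC ler_pdivlMr ?divr_gt0// mul1r.
    exact: Hlow.
  by rewrite /chi eqxx (max_idPr _) ?subr_le0// mulr_ge0.
- by rewrite divr_ge0// divr_ge0// ltW.
Qed.

(** * Upper barriers by reflection, and traps between two barriers *)

Definition opw u : bool -> R := fun s => - u (~~ s).
Definition Sup be := forall s, {ae P, forall w, hat w s (be s) <= be (flip w s)}.
Definition rho' u s := - rho (opw u) (~~ s).

Lemma opwK u : opw (opw u) = u.
Proof. by apply/funext => s; rewrite /opw negbK opprK. Qed.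

Lemma domw_op u : domw u -> domw (opw u).
Proof. by move=> du s; rewrite /opw -domN opprK; exact: du. Qed.

Lemma Sub_op be : Sub (opw be) -> Sup be.
Proof.
move=> H s; have := H (~~ s); apply: filterS => w.
by rewrite flipN /opw !negbK hatN lerN2.
Qed.

Lemma Sup_op be : Sup be -> Sub (opw be).
Proof.
move=> H s; have := H (~~ s); apply: filterS => w.
have := hatN w (~~ s) (be (~~ s)); rewrite negbK flipN /opw => ->.
by rewrite lerN2.
Qed.

Lemma rho'_ge u s : domw u -> u s <= rho' u s.
Proof.
move=> /domw_op du; have := rho_le (~~ s) du.
by rewrite /rho' /opw negbK lerNr.
Qed.

Lemma rho'_dom u : domw u -> domw (rho' u).
Proof. by move=> /domw_op/rho_dom/domw_op. Qed.

Lemma rho'_Sup u : domw u -> Sup (rho' u).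
Proof.
move=> /domw_op/rho_Sub H; apply: Sub_op.
by rewrite (_ : opw _ = rho (opw u))//; exact: opwK.
Qed.

Lemma rho'_mono u v s : domw u -> domw v -> (forall s, u s <= v s) ->
  rho' u s <= rho' v s.
Proof.
move=> du dv uv; rewrite /rho' lerN2; apply: rho_mono; try exact: domw_op.
by move=> s'; rewrite /opw lerN2.
Qed.

Lemma rho'_le be u s : domw be -> domw u -> Sup be -> (forall s, u s <= be s) ->
  rho' u s <= be s.
Proof.
move=> db du Sb ub; rewrite /rho' -[be s]opprK lerN2.
have -> : - be s = opw be (~~ s) by rewrite /opw negbK.
apply: rho_ge; [exact: domw_op|exact: domw_op|exact: Sup_op|].
by move=> s'; rewrite /opw lerN2.
Qed.

(** The band between [ga] and [be] is a.s. invariant. The last two fields are the two-sided mixing: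
    from its upper ends the chain comes arbitrarily close to each lower end, and from its lower ends
    to each upper end. *)
Record trap (ga be : bool -> R) : Prop := Trap {
  trap_dl : domw ga; trap_du : domw be;
  trap_Sub : Sub ga; trap_Sup : Sup be;
  trap_rho : forall s, rho be s = ga s;
  trap_rho' : forall s, rho' ga s = be s }.

Lemma trap_le ga be s : trap ga be -> ga s <= be s.
Proof. by case=> _ dl _ _ <- _; exact: rho_le. Qed.

Lemma trap_op ga be : trap ga be -> trap (opw be) (opw ga).
Proof.
case=> d1 d2 s1 s2 r1 r2; split.
- exact: domw_op.
- exact: domw_op.
- exact: Sup_op.
- by apply: Sub_op; rewrite opwK.
- by move=> s; have := r2 (~~ s); rewrite /rho' negbK /opw => <-; rewrite opprK.
- by move=> s; rewrite /rho' opwK r1.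
Qed.

(** Descending, ascending and descending again already stabilises. The barrier [al] lies below
    [rho be], so ascending from [rho be] gives at least [rho' al], which is [be]; it gives no more,
    because [be] is itself an upper barrier. *)
Lemma trap_exists u : domw u -> let al := rho u in let be := rho' al in
  trap (rho be) be.
Proof.
move=> du al be.
have da : domw al by exact: rho_dom.
have db : domw be by exact: rho'_dom.
have Sa : Sub al by exact: rho_Sub.
have Sb : Sup be by exact: rho'_Sup.
have ab' s : al s <= be s by exact: rho'_ge.
have dg : domw (rho be) by exact: rho_dom.
have ag s : al s <= rho be s by exact: rho_ge.
split=> //; first exact: rho_Sub.
move=> s; apply/eqP; rewrite eq_le; apply/andP; split.
  by apply: rho'_le => // s'; exact: rho_le.
exact: rho'_mono.
Qed.

Hypothesis noinv : ~ exists x y, [/\ a <= x <= b, a <= y <= b &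
  {ae P, forall w, (g w x = x /\ g w y = y) \/ (g w x = y /\ g w y = x)}].

(** A degenerate component yields an invariant pair: two degenerate components give two points that
    are kept or exchanged, and a single one gives a common fixed point. *)
Lemma trap_lt ga be : trap ga be -> forall s, ga s < be s.
Proof.
move=> T; have [d1 d2 s1 s2 _ _] := T; have le s' := trap_le s' T.
move=> s; rewrite lt_neqAle le andbT; apply/negP => /eqP E; apply: noinv.
have Eh s' : ga s' = be s' ->
    {ae P, forall w, ga (flip w s') = be (flip w s') ->
                     hat w s' (ga s') = ga (flip w s')}.
  move=> E'; move: (s1 s') (s2 s'); apply: filterS2 => w; rewrite -E' => h1 h2 h3.
  by apply/eqP; rewrite eq_le h1 andbT h3.
have [/eqP E'|nE] := boolP (ga (~~ s) == be (~~ s)).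
  exists (sg true * ga true), (sg false * ga false); split; [exact: d1|exact: d1|].
  have H s' : ga s' = be s' by case: s E E' => E1 E2; case: s'.
  move: (Eh true (H true)) (Eh false (H false)); apply: filterS2 => w /(_ (H _)) h1 /(_ (H _)) h2.
  move: h1 h2; rewrite /hat /flip; rewrite /sg; case: (dec w) => /=;
    rewrite !mul1r !mulN1r => h1 h2; [right|left].
    by split=> //; rewrite -h1 opprK.
  by split=> //; rewrite -{2}h2 opprK.
have lt' : ga (~~ s) < be (~~ s) by rewrite lt_neqAle nE le.
exists (sg s * ga s), (sg s * ga s); split; [exact: d1|exact: d1|].
move: (Eh s E) (s1 (~~ s)) (s2 (~~ s)); apply: filterS3 => w h3 h4 h5.
(* A decreasing map would squeeze the nondegenerate interval of the other component into the single
   point of component [s], against strict monotonicity. *)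
have dw : dec w = false.
  apply/negP => dw; have := hat_lt w (d1 _) (d2 _) lt'.
  have := h4; have := h5; rewrite /flip dw addbT negbK; lra.
by left; move: h3; rewrite /hat /flip dw addbF => /(_ E) h; have -> : g w (sg s * ga s) = sg s * ga s by rewrite -{2}h sgK.
Qed.

(** * Decay of oscillation on a trap *)

Definition isotone phi :=
  forall s x y, dom s x -> dom s y -> x <= y -> phi s x <= phi s y.

Lemma iterK_isotone n phi : ok phi -> isotone phi -> isotone (iter n K phi).
Proof.
move=> okp ap; elim: n => //= n IH s x y dx dy xy.
apply: E_le => [||w]; try by apply: K_intg; exact: iterK_ok.
by apply: IH; [exact: hat_dom|exact: hat_dom|exact: hat_le].
Qed.

(** A decreasing map exchanges the components, so the value at one end is not monotone under [K];
    the sum over both components is. *)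
Definition S2 phi u := phi true (u true) + phi false (u false).

Lemma S2_flip w (k : bool -> R) : k (flip w true) + k (flip w false) = k true + k false.
Proof. by rewrite /flip; case: (dec w) => //=; rewrite addrC. Qed.

Lemma S2_K_Sup phi be : domw be -> Sup be -> ok phi -> isotone phi ->
  S2 (K phi) be <= S2 phi be.
Proof.
move=> db Sb okp ip; rewrite /S2 -[leRHS](E_cst P) -E_D; try exact: K_intg.
apply: E_le_ae; [by apply: intgD; exact: K_intg|exact: intg_cst|].
move: (Sb true) (Sb false); apply: filterS2 => w h1 h2.
rewrite -(S2_flip w (fun s => phi s (be s))).
by apply: lerD; apply: ip => //; exact: hat_dom.
Qed.

Lemma S2_K_Sub phi ga : domw ga -> Sub ga -> ok phi -> isotone phi ->
  S2 phi ga <= S2 (K phi) ga.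
Proof.
move=> db Sb okp ip; rewrite /S2 -[leLHS](E_cst P) -E_D; try exact: K_intg.
apply: E_le_ae; [exact: intg_cst|by apply: intgD; exact: K_intg|].
move: (Sb true) (Sb false); apply: filterS2 => w h1 h2.
rewrite -(S2_flip w (fun s => phi s (ga s))).
by apply: lerD; apply: ip => //; exact: hat_dom.
Qed.

Lemma antitoneN phi : antitone phi -> isotone (fun s x => (-1) * phi s x).
Proof. by move=> H s x y dx dy xy; rewrite !mulN1r lerN2; exact: H. Qed.

(** Once low points are reached from [be], they stay reachable at all later times with no smaller
    mean. This lets one number of steps serve both components. *)
Lemma S2_chi_mono c s be m k : domw be -> Sup be -> (m <= k)%N ->
  S2 (iter m K (chi c s)) be <= S2 (iter k K (chi c s)) be.
Proof.
move=> db Sb; elim: k => [|k IH]; first by rewrite leqn0 => /eqP ->.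
rewrite leq_eqVlt => /predU1P[->//|/IH le1]; apply: (le_trans le1).
have ok1 : ok (iter k K (chi c s)) by apply: iterK_ok; exact: ok_chi.
have := S2_K_Sup db Sb (ok_Z (c := -1) ok1)
  (antitoneN (iterK_antitone k (ok_chi c s) (@chi_antitone c s))).
by rewrite /S2 !K_Z// !mulN1r /=; lra.
Qed.

(* [flip w] permutes the two components, so functions constant on each of them
   have a conserved total. *)
Lemma S2_iter_cst m (k : bool -> R) u :
  S2 (iter m K (fun s _ => k s)) u = k true + k false.
Proof.
have okk : ok (fun s _ => k s) by move=> s; exact: cst_continuous.
suff H x y : iter m K (fun s _ => k s) true x + iter m K (fun s _ => k s) false y
    = k true + k false by exact: H.
elim: m x y => //= m IH x y.
rewrite -E_D; try by apply: K_intg; exact: iterK_ok.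
rewrite -[RHS](E_cst P); congr Rintegral; apply/funext => w.
by rewrite /flip; case: (dec w) => /=; [rewrite addrC|]; exact: IH.
Qed.

(** Under an upper barrier an isotone [phi] never exceeds its value at the barrier, and each visit
    below [c] loses at least the gap between the values at [be] and [c]. The mean loss is therefore
    a fixed fraction of that gap, the same for all [phi]. *)
Lemma S2_upper be (c : bool -> R) m M delta phi : domw be -> domw c -> Sup be ->
  (forall s, c s <= be s) -> 0 < M ->
  (forall s' s x, dom s x -> chi (c s') s' s x <= M) ->
  (forall s, delta * M <= S2 (iter m K (chi (c s) s)) be) ->
  ok phi -> isotone phi ->
  S2 (iter m K phi) be <= S2 phi be - delta * (S2 phi be - S2 phi c).
Proof.
move=> db dc Sb cb M0 chiM dM okp ip.
pose D s := (phi s (be s) - phi s (c s)) / M.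
have D0 s : 0 <= D s by rewrite divr_ge0 ?(ltW M0)// subr_ge0; exact: ip.
(* [Psi] dominates [phi] below [be]: its correction is active only below [c s], and by the choice of
   [D] it never exceeds [phi s (be s) - phi s (c s)]. *)
pose Psi s x := phi s (be s) +
  ((- D true) * chi (c true) true s x + (- D false) * chi (c false) false s x).
have okc1 : ok (fun s x => (- D true) * chi (c true) true s x) by apply: ok_Z; exact: ok_chi.
have okc2 : ok (fun s x => (- D false) * chi (c false) false s x) by apply: ok_Z; exact: ok_chi.
have ok2 := ok_D okc1 okc2.
have okk : ok (fun s _ => phi s (be s)) by move=> s; exact: cst_continuous.
have okPsi : ok Psi by exact: (ok_D okk ok2).
have inv : invariant (fun s x => x <= be s).
  move=> s x dx xb; have := Sb s; apply: filterS => w; apply: le_trans.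
  exact: hat_le.
have le1 : forall s x, dom s x -> x <= be s -> iter m K phi s x <= iter m K Psi s x.
  apply: iterK_le_inv => // s x dx xb.
  have -> : Psi s x = phi s (be s) - D s * chi (c s) s s x.
    by rewrite /Psi /chi; case: s {dx xb}; rewrite /= ?eqxx /=; ring.
  have := chiM s s x dx; have := @chi_ge0 (c s) s s x => c0 cM.
  have [xc|cx] := leP x (c s).
    apply: (@le_trans _ _ (phi s (c s))); first exact: ip.
    rewrite lerBrDr -lerBrDl /D mulrAC -mulrA ler_piMr ?subr_ge0 ?ip//.
    by rewrite ler_pdivrMr// mul1r.
  rewrite /chi eqxx (max_idPr _) ?subr_le0 ?(ltW cx)// mulr0 subr0.
  exact: ip.
apply: (@le_trans _ _ (S2 (iter m K Psi) be)); first by apply: lerD; apply: le1.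
have -> : S2 (iter m K Psi) be = S2 phi be
    - (D true * S2 (iter m K (chi (c true) true)) be
     + D false * S2 (iter m K (chi (c false) false)) be).
  have := S2_iter_cst m (fun s => phi s (be s)) be.
  rewrite /Psi /S2 !(iterK_D m okk ok2) !(iterK_D m okc1 okc2).
  rewrite !(iterK_Z m _ (ok_chi _ _)) => h; rewrite -h; ring.
rewrite lerD2l lerN2.
have H s : delta * (phi s (be s) - phi s (c s)) <= D s * S2 (iter m K (chi (c s) s)) be.
  apply: (@le_trans _ _ (D s * (delta * M))); last by rewrite ler_wpM2l.
  by rewrite /D mulrCA mulfVK ?gt_eqF.
by have := H true; have := H false; rewrite /S2; lra.
Qed.

Definition mid ga be : bool -> R := fun s => (ga s + be s) / 2.

Lemma mid_dom ga be : domw ga -> domw be -> domw (mid ga be).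
Proof.
move=> d1 d2 s; have /andP[h1 h2] := d1 s; have /andP[h3 h4] := d2 s.
by rewrite /dom /mid mulrA mulrDr; apply/andP; split; lra.
Qed.

Lemma mid_op ga be : opw (mid ga be) = mid (opw be) (opw ga).
Proof. by apply/funext => s; rewrite /mid /opw -mulNr opprD addrC. Qed.

(** In a trap [rho be] is [ga], strictly below the midpoint, so the midpoint is undercut from [be]
    with positive probability in both components. *)
Lemma trap_upper ga be : trap ga be -> exists m0, forall m, (m0 <= m)%N ->
  exists2 delta, 0 < delta & forall phi, ok phi -> isotone phi ->
  S2 (iter m K phi) be <= S2 phi be - delta * (S2 phi be - S2 phi (mid ga be)).
Proof.
move=> T; have [da db Sa Sb r1 r2] := T; set c := mid ga be.
have lt s := trap_lt T s.
have dc : domw c by exact: mid_dom.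
have H s : exists m, 0 < S2 (iter m K (chi (c s) s)) be.
  have [|m [s0 r]] := @rho_reach be s (c s) db; first by rewrite r1 /c /mid; have := lt s; lra.
  exists m; have h s1 := iterK_ge0 m (ok_chi (c s) s) (fun s' x _ => @chi_ge0 _ _ s' x) (db s1).
  by have := h true; have := h false; rewrite /S2; case: s0 r => *; lra.
have [m1 H1] := H true; have [m2 H2] := H false.
exists (maxn m1 m2) => m; rewrite geq_max => /andP[le1 le2].
have [M1 hM1] := ok_bnd (ok_chi (c true) true).
have [M2 hM2] := ok_bnd (ok_chi (c false) false).
pose M := 1 + `|M1| + `|M2|.
have M0 : 0 < M by rewrite /M; have := normr_ge0 M1; have := normr_ge0 M2; lra.
have p1 := lt_le_trans H1 (S2_chi_mono (c true) true db Sb le1).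
have p2 := lt_le_trans H2 (S2_chi_mono (c false) false db Sb le2).
pose q1 := S2 (iter m K (chi (c true) true)) be.
pose q2 := S2 (iter m K (chi (c false) false)) be.
exists (Num.min q1 q2 / M) => [|phi okp ip].
  by rewrite divr_gt0// lt_min p1 p2.
apply: (S2_upper (M := M)) => //.
- by move=> s; have := lt s; rewrite /c /mid; lra.
- move=> s' s x dx; rewrite -[leLHS]ger0_norm ?chi_ge0//.
  have n1 := normr_ge0 M1; have n2 := normr_ge0 M2.
  have l1 := ler_norm M1; have l2 := ler_norm M2.
  by case: s'; [have := hM1 s x dx|have := hM2 s x dx]; rewrite /M; lra.
- by move=> s; rewrite mulfVK ?gt_eqF//; case: s; rewrite ge_min lexx ?orbT.
Qed.

Lemma ok_refl' phi : ok phi -> ok (fun s x => (-1) * refl phi s x).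
Proof. by move=> h; apply: ok_Z; exact: ok_refl. Qed.

(** The upper end loses a fraction of the gap down to the midpoint. By reflection, the lower end
    gains a fraction of the gap up to it. The two gaps add up to the oscillation. *)
Lemma trap_osc ga be : trap ga be -> exists m delta, [/\ (0 < m)%N, 0 < delta,
  delta <= 1/2 & forall phi, ok phi -> isotone phi ->
  S2 (iter m K phi) be - S2 (iter m K phi) ga <=
  (1 - delta) * (S2 phi be - S2 phi ga)].
Proof.
move=> T; have [m1 H1] := trap_upper T; have [m2 H2] := trap_upper (trap_op T).
have [m [le1 le2 m0]] : exists m, [/\ m1 <= m, m2 <= m & 0 < m]%N.
  by exists (m1 + m2).+1; split => //; apply: leqW; [exact: leq_addr|exact: leq_addl].
have [d1 d10 {}H1] := H1 m le1; have [d2 d20 {}H2] := H2 m le2.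
(* The cap [1/2] keeps the later contraction rate positive. *)
exists m, (Num.min (1/2) (Num.min d1 d2)); split => //.
- by rewrite !lt_min d10 d20 andbT; lra.
- by rewrite ge_min lexx.
move=> phi okp ip; have h1 := H1 phi okp ip.
have ip' : isotone (fun s x => (-1) * refl phi s x).
  move=> s x y dx dy xy; rewrite !mulN1r lerN2; apply: ip; rewrite ?domN//.
  by rewrite lerN2.
have := H2 _ (ok_refl' okp) ip'; rewrite -mid_op.
have S2op psi u : S2 (fun s x => (-1) * refl psi s x) (opw u) = - S2 psi u.
  by rewrite /S2 /refl /opw /= !opprK; ring.
rewrite iterK_Z; last exact: ok_refl.
rewrite iterK_refl !S2op => h2.
have [da db _ _ _ _] := T; have dc := mid_dom da db.
have k1 : 0 <= S2 phi be - S2 phi (mid ga be).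
  rewrite subr_ge0; apply: lerD; apply: ip => //; rewrite /mid;
  by [have := trap_le true T; lra|have := trap_le false T; lra].
have k2 : 0 <= S2 phi (mid ga be) - S2 phi ga.
  rewrite subr_ge0; apply: lerD; apply: ip => //; rewrite /mid;
  by [have := trap_le true T; lra|have := trap_le false T; lra].
set dl := Num.min _ _.
have l1 : dl <= d1 by rewrite /dl !ge_min lexx /= orbT.
have l2 : dl <= d2 by rewrite /dl !ge_min lexx /= !orbT.
have := ler_wpM2r k1 l1; have := ler_wpM2r k2 l2; lra.
Qed.

Lemma Bernoulli_le (t : R) m : 0 <= t <= 1 -> 1 - t *+ m <= (1 - t) ^+ m.
Proof.
move=> /andP[t0 t1]; elim: m => [|m IH]; first by rewrite mulr0n subr0 expr0.
rewrite exprS mulrSr; have t1' : 0 <= 1 - t by lra.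
have := ler_wpM2l t1' IH; have : 0 <= t * (t *+ m) by rewrite mulr_ge0// mulrn_wge0.
lra.
Qed.

(** Since the signed maps increase, [iter n K pos s y - iter n K pos s x] is the mean length of the
    n-th image of the interval from [x] to [y]. *)
Definition pos : bool -> R -> R := fun _ x => x.

Lemma ok_pos : ok pos.
Proof. by move=> s x. Qed.

Lemma trap_contract ga be : trap ga be -> exists C kappa, [/\ 0 < kappa, kappa < 1 &
  forall n x y, ga true <= x -> x <= y -> y <= be true ->
  iter n K pos true y - iter n K pos true x <= C * kappa ^+ n].
Proof.
move=> T; have [m [dl [m0 d0 d1 H]]] := trap_osc T; have [da db Sa Sb _ _] := T.
have ipos : isotone pos by [].
pose O n := S2 (iter n K pos) be - S2 (iter n K pos) ga.
have Ole n : O n.+1 <= O n.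
  have o := iterK_ok (n := n) ok_pos; have i := iterK_isotone n ok_pos ipos.
  by have := S2_K_Sup db Sb o i; have := S2_K_Sub da Sa o i; rewrite /O /=; lra.
have Ole' n k : (n <= k)%N -> O k <= O n.
  elim: k => [|k IH]; first by rewrite leqn0 => /eqP ->.
  by rewrite leq_eqVlt => /predU1P[->//|/IH]; apply: le_trans.
have Ok k : O (k * m)%N <= (1 - dl) ^+ k * O 0%N.
  elim: k => [|k IH]; first by rewrite mul0n expr0 mul1r.
  have o := iterK_ok (n := (k * m)%N) ok_pos.
  have i := iterK_isotone (k * m) ok_pos ipos.
  have := H _ o i; rewrite -!iterD -mulSn => h; apply: (le_trans h).
  rewrite exprS -mulrA ler_wpM2l//; lra.
have O0 : 0 <= O 0%N.
  by have := trap_le true T; have := trap_le false T; rewrite /O /S2 /= /pos; lra.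
have m0' : (0 : R) < m%:R by rewrite ltr0n.
(* By the Bernoulli inequality [kp ^+ m] is at least [1 - dl], so [kp] serves as a rate per step
   without an m-th root. *)
pose kp := 1 - dl / m%:R.
have t0 : 0 < dl / m%:R by rewrite divr_gt0.
have t1 : dl / m%:R <= 1/2.
  by rewrite ler_pdivrMr// (le_trans d1)// ler_peMr ?ler1n//; lra.
have k0 : 0 < kp by rewrite /kp; lra.
have k1 : kp < 1 by rewrite /kp; lra.
(* Dividing by [kp ^+ m] pays for the fewer than [m] steps left over when [n] is divided by [m]. *)
exists (O 0%N / kp ^+ m), kp; split => // n x y gx xy yb.
have dx : dom true x.
  by have := da true; have := db true; rewrite /dom /sg !mul1r => /andP[? ?] /andP[? ?]; apply/andP; split; lra.
have dy : dom true y.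
  by have := da true; have := db true; rewrite /dom /sg !mul1r => /andP[? ?] /andP[? ?]; apply/andP; split; lra.
have i := iterK_isotone n ok_pos ipos.
apply: (@le_trans _ _ (O n)).
  have := i true _ _ (da true) dx gx; have := i true _ _ dy (db true) yb.
  by have := i false _ _ (da false) (db false) (trap_le false T); rewrite /O /S2; lra.
apply: (le_trans (Ole' _ _ (leq_trunc_div n m))); apply: (le_trans (Ok _)).
rewrite mulrC -mulrA ler_wpM2l//.
have kb : 1 - dl <= kp ^+ m.
  have tm : (dl / m%:R) *+ m = dl by rewrite -[LHS]mulr_natr mulfVK ?gt_eqF.
  have := @Bernoulli_le (dl / m%:R) m; rewrite tm; apply.
  by apply/andP; split; lra.
apply: (@le_trans _ _ (kp ^+ (m * (n %/ m)))).
  by rewrite exprM lerXn2r ?nnegrE ?exprn_ge0// ?(ltW k0)//; lra.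
rewrite ler_pdivlMl ?exprn_gt0// -exprD ler_wiXn2l ?(ltW k0) ?(ltW k1)//.
by rewrite {1}(divn_eq n m) addnC; apply: leq_add; [exact/ltnW/ltn_pmod|rewrite mulnC].
Qed.

(** * Contracting intervals reached from a given point *)

Lemma ok_M phi psi : ok phi -> ok psi -> ok (fun s x => phi s x * psi s x).
Proof. by move=> o1 o2 s x; apply: continuousM; [exact: o1|exact: o2]. Qed.

Definition above ga : bool -> R -> R := fun s x => Num.max (x - ga s) 0.

Lemma ok_above ga : ok (above ga).
Proof.
move=> s x; apply: (@continuous_max _ _ (fun x => x - ga s) (cst 0)).
  by apply: continuousB; [|exact: cst_continuous].
exact: cst_continuous.
Qed.

Lemma above_ge0 ga s x : 0 <= above ga s x.
Proof. by rewrite /above le_max lexx orbT. Qed.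

(* The maps are injective, so an orbit starting above ga stays strictly above. *)
Lemma iterK_above ga phi m s x : domw ga -> Sub ga -> ok phi ->
  (forall s x, 0 <= phi s x) -> dom s x -> ga s < x -> 0 < iter m K phi s x ->
  0 < iter m K (fun s x => phi s x * above ga s x) s x.
Proof.
move=> da Sa o1 p0; have o2 := ok_M o1 (ok_above (ga := ga)).
elim: m s x => [|m IH] s x dx gx /= p1.
  by rewrite mulr_gt0// /above lt_max subr_gt0 gx.
have k1 := iterK_ok (n := m) o1; have k2 := iterK_ok (n := m) o2.
apply: E_gt0 (K_intg _ _ k1) (K_intg _ _ k2) _ _ _ p1.
- move=> w; apply: iterK_ge0 => //; last exact: hat_dom.
  by move=> s1 x1 _; rewrite mulr_ge0// above_ge0.
- by move=> w; apply: iterK_ge0 => //; exact: hat_dom.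
- move: (Sa s); apply: filterS => w h; apply: IH; first exact: hat_dom.
  by apply: (le_lt_trans h); exact: hat_lt.
Qed.

(** [Psi] stays positive on a neighbourhood of [al s]. From [u] the chain reaches points below
    [al s + e] and never falls below [al], so it enters that neighbourhood. *)
Lemma reach_pos al u s Psi : domw al -> domw u -> Sub al -> ok Psi ->
  (forall s x, dom s x -> 0 <= Psi s x) -> (forall s, al s <= u s) ->
  rho u s = al s -> 0 < Psi s (al s) -> exists m s0, 0 < iter m K Psi s0 (u s0).
Proof.
move=> da du Sa okP P0 au ru Pal; pose k0 := Psi s (al s).
have /cvgrPdist_lt/(_ (k0 / 2))[|e /= e0 He] := okP s (al s).
  by rewrite divr_gt0.
have [|m [s0 r]] := @rho_reach u s (al s + e) du; first by rewrite ru ltrDl.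
exists m, s0; have C0 : 0 <= e / (k0 / 2) by rewrite divr_ge0 ?divr_ge0// ltW.
apply: (iterK_pos_inv (Sub_inv da Sa) (ok_chi _ _) okP _ C0 (du s0) (au s0) r).
move=> s1 x dx ax; have [E|ne] := eqVneq s1 s; last first.
  by rewrite /chi (negbTE ne) mulr_ge0// P0.
subst s1; rewrite /chi eqxx; have [ex|xe] := leP (al s + e) x.
  by rewrite (max_idPr _) ?subr_le0// mulr_ge0// P0.
have : `|al s - x| < e by rewrite distrC ger0_norm ?subr_ge0//; lra.
move=> /He; rewrite -/k0 ltr_norml => /andP[_ h].
have h' : k0 / 2 <= Psi s x by lra.
rewrite (max_idPl _) ?subr_ge0 ?(ltW xe)//.
apply: (@le_trans _ _ e); first lra.
by rewrite -mulrA ler_peMr ?(ltW e0)// mulrC ler_pdivlMr ?divr_gt0// mul1r.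
Qed.

Lemma reach_pos' be u s Psi : domw be -> domw u -> Sup be -> ok Psi ->
  (forall s x, dom s x -> 0 <= Psi s x) -> (forall s, u s <= be s) ->
  rho' u s = be s -> 0 < Psi s (be s) -> exists m s0, 0 < iter m K Psi s0 (u s0).
Proof.
move=> db du Sb okP P0 ub ru Pbe.
have [||||m [s0]] := @reach_pos (opw be) (opw u) (~~ s) (refl Psi)
  (domw_op db) (domw_op du) (Sup_op Sb) (ok_refl okP).
- by move=> s1 x dx; apply: P0; rewrite domN.
- by move=> s1; rewrite /opw lerN2.
- by rewrite -[rho _ _]opprK -/(rho' u s) ru /opw negbK.
- by rewrite /refl /opw !negbK opprK.
rewrite iterK_refl /refl /opw opprK => r.
by exists m, (~~ s0).
Qed.

Definition lift (psi : R -> R) : bool -> R -> R := fun s x => psi (sg s * x).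

Lemma ok_lift (psi : R -> R) : continuous psi -> ok (lift psi).
Proof.
move=> cp s x; apply: continuous_comp; last exact: cp.
exact: mulrl_continuous.
Qed.

(** A function of the unsigned point is fixed by [refl], so the choice of the sign is immaterial. *)
Lemma iterK_lift n (psi : R -> R) s x : iter n K (lift psi) s x = iter n K (lift psi) true (sg s * x).
Proof.
have rl : refl (lift psi) = lift psi.
  by apply/funext => s1; apply/funext => x1; rewrite /refl /lift sg_opp.
case: s; first by rewrite /sg mul1r.
rewrite -[in LHS]rl iterK_refl /refl /= /sg mulN1r.
by [].
Qed.

(** The trap is built from the two signed states over [x0]. Positivity is then pulled back along the
    construction in reverse: from the upper ends [be] to the inside of the trap, from [al] to near
    [be], and from [x0] to near [al]. *)
Lemma good_interval x0 : a <= x0 <= b ->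
  exists p q C kappa (psi : R -> R) M,
  [/\ [/\ a <= p, p < q, q <= b, 0 < kappa & kappa < 1],
      (forall n x y, p <= x -> x <= y -> y <= q ->
         iter n K pos true y - iter n K pos true x <= C * kappa ^+ n),
      continuous psi /\ (forall x, 0 <= psi x <= 1),
      (forall x, psi x != 0 -> p <= x <= q) &
      0 < iter M K (lift psi) true x0].
Proof.
move=> x0I; pose u0 s := sg s * x0.
have du : domw u0 by move=> s; rewrite /dom /u0 sgK.
pose al := rho u0; pose be := rho' al; pose ga := rho be.
have da : domw al by exact: rho_dom.
have T : trap ga be by exact: trap_exists.
have [dg db Sg Sb r1 r2] := T; have Sa : Sub al by exact: rho_Sub.
have [C [kp [k0 k1 HC]]] := trap_contract T.
pose c := mid ga be true; have lt s := trap_lt T s.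
have [|m1 [s1 p1]] := @rho_reach be true c db.
  by rewrite r1 /c /mid; have := lt true; lra.
have {p1} := iterK_above dg Sg (ok_chi c true) (@chi_ge0 c true) (db s1) (lt s1) p1.
(* The factor [above ga] confines the support to the part of the trap between its lower end and its
   midpoint, in the component [true]. *)
set psi1 := (fun s x => _) => p1.
have ok1 : ok psi1 by apply: ok_M; [exact: ok_chi|exact: ok_above].
have psi1_ge0 s x : 0 <= psi1 s x by rewrite mulr_ge0 ?chi_ge0// above_ge0.
have [|||m2 [s2 p2]] := reach_pos' db da Sb (iterK_ok (n := m1) ok1) _ _ _ p1.
- by apply: iterK_ge0 => // s x _.
- by move=> s; exact: rho'_ge.
- by [].
have [|||m3 [s3 p3]] := reach_pos da du Sa
  (iterK_ok (n := m2) (iterK_ok (n := m1) ok1)) _ _ _ p2.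
- by apply: iterK_ge0; [exact: iterK_ok|apply: iterK_ge0].
- by move=> s; exact: rho_le.
- by [].
rewrite -!iterD in p3.
pose h x := psi1 true x; pose psi x := Num.min 1 (h x).
have ch : continuous h by exact: ok1.
have cpsi : continuous psi.
  move=> x; apply: (@continuous_min _ _ (cst 1) h); last exact: ch.
  exact: cst_continuous.
have [B HB] := ok_bnd ok1.
exists (ga true), (be true), C, kp, psi, (m3 + m2 + m1)%N; split => //.
- have := dg true; have := db true; have := lt true; rewrite /dom /sg !mul1r.
  by move=> ? /andP[_ ?] /andP[? _].
- by split=> // x; rewrite /psi le_min ler01 psi1_ge0 ge_min lexx.
- move=> x; apply: contraR; rewrite negb_and -!ltNge => H.
  suff -> : psi x = 0 by [].
  rewrite /psi (_ : h x = 0) ?(min_idPr _)//.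
  rewrite /h /psi1 /chi /above eqxx; case/orP: H => H.
    by rewrite (max_idPr (_ : x - ga true <= 0)) ?mulr0// subr_le0 ltW.
  rewrite (max_idPr (_ : c - x <= 0)) ?mul0r// subr_le0.
  by have := lt true; rewrite /c /mid; lra.
suff : 0 < iter (m3 + m2 + m1) K (lift psi) s3 (u0 s3) by rewrite iterK_lift /u0 sgK.
apply: (iterK_pos_inv (C := 1 + `|B|) invariantT ok1 (ok_lift cpsi) _ _ (du s3) Logic.I p3) => //.
  move=> [] x dx _; last first.
    by rewrite /psi1 /chi /= mul0r mulr_ge0// le_min ler01 psi1_ge0.
  have := HB true x dx; rewrite ger0_norm// => hB.
  rewrite /lift /sg mul1r /psi; have [l1|l1] := leP (h x) 1.
    by rewrite ler_peMl ?psi1_ge0// lerDl.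
  by rewrite mulr1 (le_trans hB)// (le_trans (ler_norm B))// lerDr.
Qed.

(** * Mean logarithmic derivatives and the drift *)

Variables (q : Om -> R -> R -> R) (sup_q : Om -> R).
Hypothesis q_eq : forall w x y, a <= x <= b -> a <= y <= b -> x != y ->
  `|g w x - g w y| = expR (q w x y) * `|x - y|.
Hypothesis q_diag : forall w (e : R), 0 < e -> exists2 r : R, 0 < r & forall x y,
  a <= x <= b -> a <= y <= b -> `|x - y| < r -> `|q w x y - q w x x| < e.
Hypothesis q_cont : forall w (e : R), 0 < e -> exists2 r : R, 0 < r & forall x y,
  a <= x <= b -> a <= y <= b -> `|x - y| < r -> `|q w x x - q w y y| < e.
Hypothesis q_meas : forall x y, a <= x <= b -> a <= y <= b ->
  measurable_fun setT (fun w => q w x y).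
Hypothesis q_bnd : forall w x y, a <= x <= b -> a <= y <= b -> `|q w x y| <= sup_q w.
Hypothesis sup_q_intg : intg P sup_q.

Lemma q_intg x y : a <= x <= b -> a <= y <= b -> intg P (fun w => q w x y).
Proof.
move=> xI yI; apply: (intg_dom (q_meas xI yI) sup_q_intg) => w.
exact: q_bnd.
Qed.

Definition clamp x := Num.max a (Num.min b x).

Lemma clamp_itv x : a <= clamp x <= b.
Proof. by rewrite /clamp le_max lexx ge_max (ltW ab) ge_min lexx. Qed.

Lemma clamp_id x : a <= x <= b -> clamp x = x.
Proof. by move=> /andP[ax xb]; rewrite /clamp (min_idPr xb) (max_idPr ax). Qed.

Lemma clamp_cont : continuous clamp.
Proof.
move=> x; apply: (@continuous_max _ _ (cst a) (fun x => Num.min b x)).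
  exact: cst_continuous.
apply: (@continuous_min _ _ (cst b) id); first exact: cst_continuous.
exact: cvg_id.
Qed.

(** The mean logarithmic derivative at [x]. Clamping makes it continuous on the whole line, as [ok]
    requires. *)
Definition vel x : R := \int[P]_w q w (clamp x) (clamp x).

Lemma vel_cont : continuous vel.
Proof.
move=> x; apply/(@cvg_nbhsP _ R^o) => u ux.
have [] // := @E_cvg _ _ _ P (fun n w => q w (clamp (u n)) (clamp (u n)))
   (fun w => q w (clamp x) (clamp x)) sup_q.
- by move=> n; apply: q_meas; exact: clamp_itv.
- by move=> n w; apply: q_bnd; exact: clamp_itv.
- move=> w; apply/cvgrPdist_lt => e e0.
  have [r r0 Hr] := q_cont w e0.
  have cu : clamp (u n) @[n --> \oo] --> clamp x.
    by apply: (continuous_cvg _ (@clamp_cont x)).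
  move/cvgrPdist_lt : cu => /(_ r r0); apply: filterS => n.
  by apply: Hr; exact: clamp_itv.
Qed.

(** The radius in [q_diag] depends on [w]. A sequence of counterexamples with distances tending to 0
    is refuted by dominated convergence, which gives one radius for the means. *)
Lemma q_near e : 0 < e -> exists2 r, 0 < r & forall x y, a <= x <= b ->
  a <= y <= b -> `|x - y| < r -> `|\int[P]_w q w x y - \int[P]_w q w x x| <= e.
Proof.
move=> e0; apply: contrapT => /forall2NP H.
have {}H n : exists z : R * R, [/\ a <= z.1 <= b, a <= z.2 <= b,
    `|z.1 - z.2| < n.+1%:R^-1 &
    e < `|\int[P]_w q w z.1 z.2 - \int[P]_w q w z.1 z.1|].
  have [|] := H n.+1%:R^-1; first by rewrite invr_gt0 ltr0n.
  move=> /existsNP[x /existsNP[y /not_implyP[xI /not_implyP[yI /not_implyP[xy]]]]].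
  by move=> /negP; rewrite -ltNge => h; exists (x, y).
have [z Hz] := choice H.
have [] // := @E_cvg _ _ _ P
   (fun n w => q w (z n).1 (z n).2 - q w (z n).1 (z n).1) (fun=> 0)
   (fun w => sup_q w + sup_q w).
- by move=> n; have [? ? _ _] := Hz n; apply: measurable_funB; exact: q_meas.
- exact: intgD.
- move=> n w; have [? ? _ _] := Hz n.
  by rewrite (le_trans (ler_normB _ _))// lerD// q_bnd.
- move=> w; apply/cvgrPdist_lt => e1 e10; have [r r0 Hr] := q_diag w e10.
  have := @near_infty_natSinv_lt R (PosNum r0); apply: filterS => n /= nr.
  have [? ? zr _] := Hz n; rewrite sub0r normrN; apply: Hr => //.
  exact: lt_trans zr nr.
move=> _; rewrite E_cst => /cvgrPdist_lt/(_ e e0) [n _ /(_ n (leqnn n))] /=.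
have [x1 x2 _] := Hz n; rewrite sub0r normrN E_B; try exact: q_intg.
by move=> /lt_trans/[apply]; rewrite ltxx.
Qed.

(** For points farther apart than [r] the term linear in the distance absorbs the crude bound
    [2 * S]. Linearity matters because mean distances along orbits are summable on a contracting
    interval. *)
Lemma vel_le e : 0 < e -> exists2 C, 0 <= C & forall x y, a <= x <= b ->
  a <= y <= b -> vel x <= \int[P]_w q w x y + (e + C * `|x - y|).
Proof.
move=> e0; have [r r0 Hr] := q_near e0.
pose S := \int[P]_w sup_q w.
have HS x y : a <= x <= b -> a <= y <= b -> `|\int[P]_w q w x y| <= S.
  move=> xI yI; apply: (le_trans (E_norm (q_intg xI yI))).
  by apply: E_le => //; [apply: intg_norm; exact: q_intg|move=> w; exact: q_bnd].
have aI : a <= a <= b by rewrite lexx ltW.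
have S0 : 0 <= S by exact: le_trans (normr_ge0 _) (HS a a aI aI).
exists (2 * S / r) => [|x y xI yI]; first by rewrite divr_ge0 ?mulr_ge0// ltW.
rewrite /vel (clamp_id xI); have [xy|xy] := ltP `|x - y| r.
  have := Hr x y xI yI xy; rewrite ler_norml => /andP[h _].
  have : 0 <= 2 * S / r * `|x - y| by rewrite mulr_ge0// divr_ge0 ?mulr_ge0// ltW.
  lra.
have : 2 * S <= 2 * S / r * `|x - y|.
  by rewrite -mulrA ler_peMr ?mulr_ge0// mulrC ler_pdivlMr// mul1r.
have := HS x y xI yI; have := HS x x xI xI; rewrite !ler_norml.
by move=> /andP[_ ?] /andP[? _]; lra.
Qed.

(** The mean Birkhoff sum of [phi] over n steps. The recursion splits off the first step, [acc_last]
    the last one. *)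
Fixpoint acc phi n : bool -> R -> R :=
  if n is m.+1 then fun s x => phi s x + K (acc phi m) s x else fun _ _ => 0.

Lemma ok_acc phi n : ok phi -> ok (acc phi n).
Proof.
move=> o; elim: n => [|n IH] /=; first exact: (ok_cst 0).
by apply: ok_D => //; exact: K_ok.
Qed.

Lemma acc_last phi n s x : ok phi ->
  acc phi n.+1 s x = acc phi n s x + iter n K phi s x.
Proof.
move=> o; elim: n s x => [|n IH] s x.
  by rewrite /= K_cst add0r addr0.
have -> : acc phi n.+2 s x = phi s x + K (acc phi n.+1) s x by [].
have E : acc phi n.+1 = fun s x => acc phi n s x + iter n K phi s x.
  by apply/funext => s1; apply/funext => x1; exact: IH.
rewrite [X in K X]E K_D; [|exact: ok_acc|exact: iterK_ok].
by rewrite addrA.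
Qed.

Lemma acc_D phi m n s x : ok phi ->
  acc phi (m + n) s x = acc phi m s x + iter m K (acc phi n) s x.
Proof.
move=> o; elim: n s x => [|n IH] s x; first by rewrite addn0 iterK_cst addr0.
rewrite addnS acc_last// IH (iterD m n).
have -> : acc phi n.+1 = fun s x => acc phi n s x + iter n K phi s x.
  by apply/funext => s1; apply/funext => x1; exact: acc_last.
by rewrite iterK_D ?addrA//; [exact: ok_acc|exact: iterK_ok].
Qed.

Lemma acc_lift (psi : R -> R) n s x : acc (lift psi) n s x = acc (lift psi) n true (sg s * x).
Proof.
elim: n s x => [//|n IH] s x /=; congr (_ + _); first by rewrite /lift /sg mul1r.
rewrite /K; congr Rintegral; apply/funext => w.
by rewrite [LHS]IH [RHS]IH /hat !sgK [sg true * _]mul1r.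
Qed.

Lemma ok_vel : ok (lift vel).
Proof. exact: ok_lift vel_cont. Qed.

(** By the chain rule, the mean of the logarithm of the derivative of the n-th iterate. *)
Definition velN := acc (lift vel).

(* [ln z <= z / theta + ln theta - 1] replaces Jensen for the logarithm of the
   length of the n-th image. *)
Lemma velN_le e : 0 < e -> exists2 C, 0 <= C &
  forall n theta s x y (c : bool), 0 < theta -> dom s x -> dom s y -> x < y ->
  velN n s (if c then x else y) <=
   (iter n K pos s y - iter n K pos s x) / theta +
   C * (acc pos n s y - acc pos n s x) + (ln theta - 1 - ln (y - x) + e *+ n).
Proof.
move=> e0; have [C C0 HC] := vel_le e0; exists C => //.
move=> n theta s x y c t0; elim: n s x y => [|n IH] s x y dx dy xy.
  rewrite /= /pos subrr mulr0 addr0 mulr0n addr0.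
  have h : 0 < (y - x) / theta by rewrite divr_gt0// subr_gt0.
  have := @le_ln1Dx _ ((y - x) / theta - 1).
  rewrite [1 + _]addrC subrK lnM ?posrE ?invr_gt0 ?subr_gt0// lnV ?posrE//.
  rewrite ltrBrDl subrr => /(_ h); rewrite /velN /=; lra.
(* The derivative is taken at the end [z], and the interval is measured from it to the other end
   [z']. *)
pose z := if c then x else y; pose z' := if c then y else x.
have dz : dom s z by rewrite /z; case: (c).
have dz' : dom s z' by rewrite /z'; case: (c).
have zz : `|sg s * z - sg s * z'| = y - x.
  rewrite -mulrBr normrM (_ : `|sg s| = 1) ?mul1r; last first.
    by case: (s); rewrite /sg ?normrN normr1.
  rewrite /z /z'; case: (c); last by rewrite gtr0_norm ?subr_gt0.
  by rewrite distrC gtr0_norm ?subr_gt0.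
have nz : sg s * z != sg s * z'.
  by rewrite -subr_eq0 -normr_eq0 zz subr_eq0 gt_eqF.
pose Q w := q w (sg s * z) (sg s * z').
have hatQ w : ln (hat w s y - hat w s x) = Q w + ln (y - x).
  have hxy := hat_lt w dx dy xy.
  have -> : hat w s y - hat w s x = `|g w (sg s * z) - g w (sg s * z')|.
    rewrite -[LHS]gtr0_norm ?subr_gt0// /hat -mulrBr normrM.
    rewrite (_ : `|sg _| = 1) ?mul1r; last by rewrite /sg; case: ifP; rewrite ?normrN normr1.
    by rewrite /z /z'; case: (c)=> //; rewrite distrC.
  rewrite q_eq// zz lnM ?posrE ?expR_gt0 ?subr_gt0// expRK.
  by [].
pose G s x := iter n K pos s x / theta + C * acc pos n s x.
have okp := iterK_ok (n := n) ok_pos.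
have oka := ok_acc (n := n) ok_pos.
have okG : ok G.
  apply: ok_D; last exact: ok_Z.
  rewrite (_ : (fun s x => _) = (fun s x => theta^-1 * iter n K pos s x)).
    exact: ok_Z.
  by apply/funext => s1; apply/funext => x1; rewrite mulrC.
have KG y1 : K G s y1 = iter n.+1 K pos s y1 / theta + C * K (acc pos n) s y1.
  rewrite (_ : G = fun s x => theta^-1 * iter n K pos s x + C * acc pos n s x).
    rewrite K_D; [|exact: ok_Z|exact: ok_Z].
    by rewrite !K_Z//= [in RHS]mulrC.
  by apply/funext => s1; apply/funext => x1; rewrite /G [_ / _]mulrC.
pose A := ln theta - 1 - ln (y - x) + e *+ n.
have iQ : intg P Q by exact: q_intg.
have okV := ok_acc (n := n) ok_vel.
have le1 : K (velN n) s z <= K G s y - K G s x + (A - \int[P]_w Q w).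
  have i1 := K_intg s y okG; have i2 := K_intg s x okG.
  rewrite /K -(E_B i1 i2) -[A](E_cst P) -(E_B (intg_cst P A) iQ).
  have i3 := intgB i1 i2; have i4 := intgB (intg_cst P A) iQ.
  rewrite -(E_D i3 i4); apply: E_le; [exact: K_intg|exact: intgD|] => w.
  have := IH (flip w s) (hat w s x) (hat w s y) (hat_dom w s x) (hat_dom w s y)
    (hat_lt w dx dy xy).
  rewrite hatQ /A /G; rewrite (_ : (if c then _ else _) = hat w s z).
    by move=> h; apply: (le_trans h); lra.
  by rewrite /z; case: (c).
have le2 := HC _ _ dz dz'; rewrite zz in le2.
have -> : velN n.+1 s (if c then x else y) = vel (sg s * z) + K (velN n) s z by [].
rewrite !KG in le1.
have -> : acc pos n.+1 s y = y + K (acc pos n) s y by [].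
have -> : acc pos n.+1 s x = x + K (acc pos n) s x by [].
move: le1 le2; rewrite /A -/(Q _) mulrSr -/Q; lra.
Qed.

(** With [theta] equal to [kappa ^+ n] in [velN_le], the length term is at most [C] and the summed
    lengths are bounded by a geometric series. Then [ln theta] contributes [- 2 * e] per step, and
    the error [e] per step uses up only half of it. *)
Lemma velN_contracting p q' C kappa : a <= p -> p < q' -> q' <= b ->
  0 < kappa -> kappa < 1 ->
  (forall n x y, p <= x -> x <= y -> y <= q' ->
     iter n K pos true y - iter n K pos true x <= C * kappa ^+ n) ->
  exists c B, 0 < c /\ forall n z, p <= z <= q' -> velN n true z <= B - c *+ n.
Proof.
move=> ap pq qb k0 k1 HC; pose e := - ln kappa / 2.
have e0 : 0 < e by rewrite divr_gt0// oppr_gt0 ln_lt0// k0 k1.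
have [M M0 HM] := velN_le e0.
pose B := C + M * (C / (1 - kappa)) - 1 - ln ((q' - p) / 2).
exists e, B; split=> // n z /andP[pz zq].
have C0 : 0 <= C.
  by have := HC 0%N p q' (lexx _) (ltW pq) (lexx _); rewrite expr0 mulr1 /= /pos; lra.
have accle x y : p <= x -> x <= y -> y <= q' ->
    acc pos n true y - acc pos n true x <= C / (1 - kappa).
  move=> px xy yq.
  suff : acc pos n true y - acc pos n true x <= C * ((1 - kappa ^+ n) / (1 - kappa)).
    move/le_trans; apply; rewrite ler_wpM2l// ler_pdivrMr ?subr_gt0// mulVf ?gt_eqF ?subr_gt0//.
    by rewrite gerBl exprn_ge0// ltW.
  elim: n => [|n IH]; first by rewrite /= expr0 !subrr mul0r mulr0.
  rewrite !(acc_last n _ _ ok_pos).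
  have h := HC n x y px xy yq.
  have -> : C * ((1 - kappa ^+ n.+1) / (1 - kappa)) =
      C * ((1 - kappa ^+ n) / (1 - kappa)) + C * kappa ^+ n.
    by rewrite -mulrDr; congr (_ * _); rewrite exprS; field; rewrite subr_eq0 gt_eqF.
  lra.
have domt x : p <= x -> x <= q' -> dom true x.
  by move=> px xq; rewrite /dom /sg mul1r; apply/andP; split; lra.
have main x y (t : bool) : p <= x -> y <= q' -> x < y -> (q' - p) / 2 <= y - x ->
    velN n true (if t then x else y) <= B - e *+ n.
  move=> px yq xy mxy.
  have dx : dom true x by apply: domt => //; lra.
  have dy : dom true y by apply: domt => //; lra.
  have := HM n (kappa ^+ n) true x y t (exprn_gt0 _ k0) dx dy xy.
  have h1 := HC n x y px (ltW xy) yq.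
  have h2 := ler_wpM2l M0 (accle x y px (ltW xy) yq).
  have h3 : ln ((q' - p) / 2) <= ln (y - x).
    by rewrite ler_ln// posrE ?subr_gt0// divr_gt0// subr_gt0.
  have h4 : (iter n K pos true y - iter n K pos true x) / kappa ^+ n <= C.
    by rewrite ler_pdivrMr// exprn_gt0.
  have h5 : ln (kappa ^+ n) = - (e *+ n + e *+ n).
    by rewrite lnXn// /e -mulrnDl -splitr mulNrn opprK.
  rewrite h5 /B; lra.
(* The partner of [z] is the farther end of the interval, so the initial length is bounded below
   independently of [z]. *)
have [zm|mz] := leP z ((p + q') / 2).
  by apply: (main z q' true) => //; lra.
by apply: (main p z false) => //; lra.
Qed.

Lemma velN_bnd : exists2 S, 0 <= S & forall n s x, `|velN n s x| <= S *+ n.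
Proof.
pose S := \int[P]_w sup_q w.
have HS x : `|vel x| <= S.
  rewrite /vel; have cI := clamp_itv x.
  apply: (le_trans (E_norm (q_intg cI cI))).
  by apply: E_le => //; [apply: intg_norm; exact: q_intg|move=> w; exact: q_bnd].
exists S => [|n]; first exact: le_trans (normr_ge0 _) (HS a).
elim: n => [|n IH] s x; first by rewrite /velN /= normr0.
rewrite /velN /= mulrS (le_trans (ler_normD _ _))// lerD//; first exact: HS.
apply: E_bnd => [|w]; last exact: IH.
by apply: K_intg; apply: ok_acc; exact: ok_vel.
Qed.

Lemma ok_iterN n : continuous (velN n true).
Proof. by move=> x; apply: ok_acc; exact: ok_vel. Qed.

(** After [M] steps a fraction greater than [dl] of the mass, weighted by [psi], sits on a
    contracting interval. There the remaining sum decreases linearly in n, whereas the other costs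
    are bounded independently of n and of [B]. *)
Lemma velN_improve x0 : a <= x0 <= b ->
  \forall x \near x0 & n \near \oo, a <= x <= b ->
    forall B, 0 <= B -> (forall y, a <= y <= b -> velN n true y <= B) ->
    velN n true x < B.
Proof.
move=> x0I.
have [p [q' [C [kp [psi [M [[ap pq qb k0 k1] HC [cpsi psi01] supp r]]]]]]] :=
  good_interval x0I.
have [c [A [c0 HA]]] := velN_contracting ap pq qb k0 k1 HC.
have [S S0 HS] := velN_bnd.
have okpsi := ok_lift cpsi.
pose dl := iter M K (lift psi) true x0 / 2.
have dl0 : 0 < dl by rewrite divr_gt0.
have nx : \forall x \near x0, dl < iter M K (lift psi) true x.
  have /cvgrPdist_lt/(_ dl dl0) := iterK_ok (n := M) okpsi (s := true) (x := x0).
  by apply: filterS => x; rewrite ltr_norml /dl => /andP[_]; lra.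
(* One [S *+ M] pays for the first [M] steps, the other for the passage from the bound [B] on n
   steps to a bound on [n - M] steps. *)
have nn : \forall n \near \oo, (M <= n)%N /\ S *+ M *+ 2 < dl * (c *+ (n - M) - A)
    /\ A < c *+ (n - M).
  pose T := ((S *+ M *+ 2) / dl + `|A|) / c.
  near=> n; have nM : (M <= n)%N by near: n; exists M.
  have Tn : T < (n - M)%:R.
    have : T + M%:R < n%:R by near: n; exact: nbhs_infty_gtr.
    by rewrite natrB//; lra.
  split=> //.
  have h1 : (S *+ M *+ 2) / dl + `|A| < c *+ (n - M).
    by rewrite -[c *+ _]mulr_natl -ltr_pdivrMr.
  have h2 := ler_norm A.
  have h3 : 0 <= (S *+ M *+ 2) / dl by rewrite divr_ge0 ?mulrn_wge0// ltW.
  split; last by lra.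
  by rewrite mulrC -ltr_pdivrMr//; lra.
near=> x n => xI B B0 HB.
have [Mn [n1 n2]] : (M <= n)%N /\ S *+ M *+ 2 < dl * (c *+ (n - M) - A)
    /\ A < c *+ (n - M) by near: n; exact: nn.
have xd : dl < iter M K (lift psi) true x by near: x; exact: nx.
pose n' := (n - M)%N.
have nE : n = (M + n')%N by rewrite subnKC.
have okV := ok_vel.
pose U := B + S *+ M.
have dom1 s y : dom s y -> a <= sg s * y <= b by [].
have HU y : a <= y <= b -> velN n' true y <= U.
  move=> yI; have := HB y yI; rewrite nE addnC /velN acc_D//.
  have : `|iter n' K (acc (lift vel) M) true y| <= S *+ M.
    have h1 : iter n' K (acc (lift vel) M) true y <= S *+ M.
      rewrite -[leRHS]/((fun _ _ => S *+ M) true y) -(iterK_cst n').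
      apply: iterK_le; [exact: ok_acc|exact: ok_cst| |by rewrite /dom /sg mul1r].
      by move=> s1 x1 _; have := HS M s1 x1; rewrite ler_norml => /andP[].
    have h2 : - (S *+ M) <= iter n' K (acc (lift vel) M) true y.
      rewrite -[leLHS]/((fun _ _ => - (S *+ M)) true y) -(iterK_cst n').
      apply: iterK_le; [exact: ok_cst|exact: ok_acc| |by rewrite /dom /sg mul1r].
      by move=> s1 x1 _; have := HS M s1 x1; rewrite ler_norml => /andP[].
    by rewrite ler_norml h1 h2.
  by rewrite ler_norml /U => /andP[]; lra.
pose L := U + c *+ n' - A.
have L0 : 0 < L.
  rewrite /L /U; have : 0 <= S *+ M by exact: mulrn_wge0.
  by have := n2; rewrite -/n'; lra.
have le1 : iter M K (velN n') true x <= U - L * iter M K (lift psi) true x.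
  have -> : U - L * iter M K (lift psi) true x =
     iter M K (fun s y => U + (- L) * lift psi s y) true x.
    rewrite (iterK_D M (ok_cst U) (ok_Z (c := - L) okpsi)) iterK_cst.
    by rewrite iterK_Z// mulNr.
  apply: iterK_le.
  - exact: ok_acc.
  - by apply: ok_D; [exact: ok_cst|exact: ok_Z].
  - move=> s1 x1 d1; rewrite /velN acc_lift /lift.
    set y := sg s1 * x1; have yI : a <= y <= b by [].
    have := HU y yI; rewrite /velN => hU.
    have [->|ne] := eqVneq (psi y) 0; first by rewrite mulr0 addr0.
    have /andP[t0 t1] := psi01 y.
    have := HA n' y (supp _ ne); rewrite /velN => hA.
    have t1' : 0 <= 1 - psi y by lra.
    have := ler_wpM2l t0 hA; have := ler_wpM2l t1' hU; rewrite /L; lra.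
  - by rewrite /dom /sg mul1r.
have := HS M true x; rewrite ler_norml => /andP[_ hSx].
have := ltr_pM2l L0 dl (iter M K (lift psi) true x); rewrite xd => le2.
have hU0 : 0 <= dl * U by rewrite mulr_ge0 ?(ltW dl0)// /U addr_ge0 ?mulrn_wge0.
have le3 : L * dl = dl * U + dl * (c *+ n' - A) by rewrite /L; ring.
rewrite nE /velN acc_D//; move: le1 n1; rewrite -/n' /velN mulr2n /U in hU0 le3 *.
move: hSx; rewrite /velN; lra.
Unshelve. all: by end_near. Qed.

(** By compactness one [N] works in [velN_improve] for all points. If the maximum of [velN N] were
    nonnegative, it could be taken as [B] and would be smaller than itself. *)
Lemma velN_neg : exists N c, [/\ (0 < N)%N, 0 < c &
  forall x, a <= x <= b -> velN N true x <= - c].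
Proof.
have cI : compact [set` `[a, b]] by exact: segment_compact.
have := (compact_near_coveringP _).1 cI nat \oo
  (fun n x => a <= x <= b ->
    forall B, 0 <= B -> (forall y, a <= y <= b -> velN n true y <= B) ->
    velN n true x < B) _.
move=> /(_ _)[x /=|N _ HN].
  by rewrite in_itv /= => /velN_improve.
have {HN} HN := HN N.+1 (leqnSn N).
have [z zI Hz] := EVT_max (ltW ab) (continuous_subspaceT (@ok_iterN N.+1)).
have zI' : a <= z <= b by rewrite in_itv in zI.
exists N.+1, (- velN N.+1 true z); split => //; last first.
  by move=> x xI; rewrite opprK; apply: Hz; rewrite in_itv.
rewrite oppr_gt0 ltNge; apply/negP => z0.
suff : velN N.+1 true z < velN N.+1 true z by rewrite ltxx.
by apply: (HN z zI zI' _ z0) => y yI; apply: Hz; rewrite in_itv.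
Qed.

(** Here [h] is the average of [velN k] over k below [N]. The sum telescopes, so the drift
    expression equals [velN N / N], which is at most [- c / N]. *)
Theorem drift : exists (h : R -> R) c, [/\ continuous h, 0 < c &
  forall x, a <= x <= b ->
  \int[P]_w q w x x + \int[P]_w h (g w x) - h x <= - c].
Proof.
have [N [c [N0 c0 HN]]] := velN_neg.
have N0' : (0 : R) < N%:R by rewrite ltr0n.
pose H s x := N%:R^-1 * \sum_(k < N) velN k s x.
have okV k : ok (velN k) by apply: ok_acc; exact: ok_vel.
have sumE n : ok (fun s x => \sum_(k < n) velN k s x) /\
    forall s x, K (fun s x => \sum_(k < n) velN k s x) s x =
    \sum_(k < n) velN k s x + velN n s x - (vel (sg s * x)) *+ n.
  elim: n => [|n [ok1 IH]].
    rewrite (_ : (fun s x => _) = (fun _ _ => 0)); last first.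
      by apply/funext => s; apply/funext => x; rewrite big_ord0.
    split; first exact: (ok_cst 0).
    by move=> s x; rewrite K_cst big_ord0 /velN /= mulr0n; ring.
  rewrite (_ : (fun s x => _) = (fun s x => \sum_(k < n) velN k s x + velN n s x)); last first.
    by apply/funext => s; apply/funext => x; rewrite big_ord_recr.
  split; first exact: ok_D.
  move=> s x; rewrite K_D// IH big_ord_recr /=.
  have -> : velN n.+1 s x = vel (sg s * x) + K (velN n) s x by [].
  rewrite mulrS; ring.
have [oS KS] := sumE N.
exists (H true), (c / N%:R); split; first exact: (ok_Z oS).
  by rewrite divr_gt0.
move=> x xI.
have HK : \int[P]_w H true (g w x) = K H true x.
  rewrite /K; congr Rintegral; apply/funext => w.
  rewrite /H /hat; congr (_ * _); apply: eq_bigr => k _.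
  by rewrite [RHS]acc_lift sgK /sg mul1r.
rewrite HK (K_Z N%:R^-1 _ _ oS) KS /H.
have -> : \int[P]_w q w x x = vel (sg true * x) by rewrite /sg mul1r /vel clamp_id.
have := HN x xI; rewrite -mulr_natr => h.
have : N%:R^-1 * velN N true x <= N%:R^-1 * (- c) by rewrite ler_wpM2l// invr_ge0 ltW.
have e : N%:R^-1 * (vel (sg true * x) * N%:R) = vel (sg true * x).
  by rewrite mulrCA mulVf ?mulr1// gt_eqF.
by rewrite mulrN; move: e; rewrite !mulrDr mulrN; lra.
Qed.

End SignedOperator.

(** * Difference quotients of C1 diffeomorphisms *)

Section C1Diffeo.
Context {R : realType}.
Variables (a b : R).
Hypothesis ab : a < b.
Local Notation I := [set` `[a, b]].

Lemma unif_cont (u : R -> R) (e : R) : continuous u -> 0 < e ->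
  exists2 r : R, 0 < r & forall x y, a <= x <= b -> `|x - y| < r -> `|u x - u y| < e.
Proof.
move=> cu e0.
have cI : compact [set` `[a, b]] by exact: segment_compact.
have := (compact_near_coveringP _).1 cI R (0^'+)
  (fun r x => forall y, `|x - y| < r -> `|u x - u y| < e) _.
move=> /(_ _)[x _|].
  have /cvgrPdist_lt/(_ (e / 2))[|d /= d0 Hd] := cu x; first by rewrite divr_gt0.
  near=> x' r => y xy.
  have h1 : `|x - x'| < d / 2.
    by near: x'; apply: nbhsx_ballx; rewrite divr_gt0.
  have h2 : r < d / 2 by near: r; apply: nbhs_right_lt; rewrite divr_gt0.
  have h3 : `|x - y| < d.
    have -> : x - y = (x - x') + (x' - y) by rewrite addrA subrK.
    by rewrite (le_lt_trans (ler_normD _ _))// [ltRHS]splitr ltrD// (lt_trans xy).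
  have h4 : `|x - x'| < d by rewrite (lt_trans h1)// ltr_pdivrMr// ltr_pMr// ltr1n.
  have -> : u x' - u y = (u x - u y) - (u x - u x').
    by rewrite opprB [RHS]addrC addrA subrK.
  have := Hd _ h3; have := Hd _ h4; rewrite /= => k1 k2.
  by rewrite (le_lt_trans (ler_normB _ _))// [ltRHS]splitr ltrD.
move=> r0 /= r0_gt0 H; exists (r0 / 2); first by rewrite divr_gt0.
move=> x y xI; apply: (H (r0 / 2)) => //=.
- by rewrite sub0r normrN gtr0_norm ?divr_gt0//; rewrite ltr_pdivrMr//; lra.
- by rewrite divr_gt0.
Unshelve. all: by end_near. Qed.

Lemma cont_bnd (u : R -> R) : continuous u ->
  exists M, forall x, a <= x <= b -> `|u x| <= M.
Proof.
move=> cu; have [t _ Ht] := EVT_max (ltW ab) (@continuous_subspaceT _ _ _ (fun x => `|u x|)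
  (fun x => continuous_comp (cu x) (@norm_continuous _ _ _))).
by exists `|u t| => x xI; apply: Ht; rewrite in_itv.
Qed.

(** A nondegenerate interval has no isolated point; this makes limits of relative difference
    quotients unique. *)
Lemma within_dnbhs_proper x : a <= x <= b -> ProperFilter (within I x^').
Proof.
move=> /andP[ax xb]; split; last exact: within_filter.
move=> H.
have {H} : nbhs x [set y | y != x -> I y -> False] := H.
move=> /nbhs_ballP[e /= e0 He'].
have He y : `|x - y| < e -> y != x -> a <= y <= b -> False.
  by move=> h1 h2 h3; apply: (He' y h1 h2); rewrite /= in_itv.
have [xm|mx] := ltP x b.
  pose y := x + Num.min (e / 2) ((b - x) / 2).
  have m0 : 0 < Num.min (e / 2) ((b - x) / 2) by rewrite lt_min !divr_gt0// subr_gt0.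
  have m1 : Num.min (e / 2) ((b - x) / 2) <= e / 2 by rewrite ge_min lexx.
  have m2 : Num.min (e / 2) ((b - x) / 2) <= (b - x) / 2 by rewrite ge_min lexx orbT.
  apply: (He y); rewrite /y /=.
  - by rewrite opprD addNKr normrN gtr0_norm//; lra.
  - by rewrite -subr_eq0 addrC addKr gt_eqF.
  - by apply/andP; split; lra.
pose y := x - Num.min (e / 2) ((b - a) / 2).
have m0 : 0 < Num.min (e / 2) ((b - a) / 2) by rewrite lt_min !divr_gt0// subr_gt0.
have m1 : Num.min (e / 2) ((b - a) / 2) <= e / 2 by rewrite ge_min lexx.
have m2 : Num.min (e / 2) ((b - a) / 2) <= (b - a) / 2 by rewrite ge_min lexx orbT.
apply: (He y); rewrite /y /=.
- by rewrite opprB addrC subrK gtr0_norm//; lra.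
- by rewrite -subr_eq0 addrC addKr oppr_eq0 gt_eqF.
- by apply/andP; split; lra.
Qed.

Lemma derivable_on_cvg (A : set R) g x : derivable_on A g x ->
  g y @[y --> within A (nbhs x)] --> g x.
Proof.
move=> dg; pose l := derivative_on A g x.
have cl : diff_quotient g x y @[y --> within A x^'] --> l by exact: dg.
have cz : (y - x : R) @[y --> within A x^'] --> (0 : R).
  have : (y - x : R) @[y --> nbhs x] --> x - x.
    by apply: cvgB; [exact: cvg_id|exact: cvg_cst].
  rewrite subrr => h B /h HB.
  have H1 : nbhs x [set y | B (y - x)] := HB.
  have : nbhs x [set y | y != x -> A y -> B (y - x)] by apply: filterS H1 => y By.
  exact.
have H : (diff_quotient g x y * (y - x)) @[y --> within A x^'] --> (0 : R).
  by rewrite -(mulr0 l); exact: (cvgM cl cz).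
apply/cvgrPdist_lt => e e0.
have h : nbhs x [set y | y != x -> A y -> `|0 - diff_quotient g x y * (y - x)| < e].
  exact: ((cvgrPdist_lt _ _).1 H e e0).
suff : nbhs x [set y | A y -> `|g x - g y| < e] by [].
apply: filterS h => y + Ay; have [->|yx] := eqVneq y x; first by rewrite subrr normr0.
by move/(_ yx Ay); rewrite /diff_quotient mulfVK ?subr_eq0// sub0r normrN distrC.
Qed.

(** Precomposition with [clamp] trades continuity relative to the interval for continuity on the
    line. *)
Lemma within_clamp (D : R -> R) :
  (forall x, a <= x <= b -> D y @[y --> within I (nbhs x)] --> D x) ->
  continuous (D \o clamp a b).
Proof.
move=> H x B HB; have cI := clamp_itv ab x.
have h : nbhs (clamp a b x) [set y | I y -> B (D y)] := H _ cI B HB.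
have h2 : nbhs x [set y | I (clamp a b y) -> B (D (clamp a b y))].
  exact: (@clamp_cont R a b x _ h).
by apply: filterS h2 => y; apply; rewrite /= in_itv /= clamp_itv.
Qed.

Lemma diffeo_within_cvg g x : C1_diffeo_onto_image I g -> a <= x <= b ->
  g y @[y --> within I (nbhs x)] --> g x.
Proof. by move=> [[dg _] _] xI; apply: derivable_on_cvg; apply: dg; rewrite /= in_itv. Qed.

Lemma diffeo_clamp_cont g : C1_diffeo_onto_image I g -> continuous (g \o clamp a b).
Proof. by move=> gd; apply: within_clamp => x xI; exact: diffeo_within_cvg. Qed.

Lemma diffeo_within_cont g : C1_diffeo_onto_image I g -> {within I, continuous g}.
Proof.
move=> gd; apply/subspace_continuousP => x; rewrite /= in_itv => xI.
exact: diffeo_within_cvg.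
Qed.

Lemma diffeo_inj g x y : C1_diffeo_onto_image I g -> a <= x <= b -> a <= y <= b ->
  g x = g y -> x = y.
Proof.
move=> [_ [h _ hK]] xI yI gxy.
have xI' : I x by rewrite /= in_itv.
have yI' : I y by rewrite /= in_itv.
by rewrite -(hK x xI') gxy hK.
Qed.

(** The difference quotients of [g] and of its inverse at corresponding points have product 1, and
    so have their limits. *)
Lemma diffeo_derivative_neq0 g x : C1_diffeo_onto_image I g -> a <= x <= b ->
  derivative_on I g x != 0.
Proof.
move=> gd xI; have [[dg _] [h [dh _] hK]] := gd.
have xI' : I x by rewrite /= in_itv.
have PF := within_dnbhs_proper xI.
have c1 : diff_quotient g x y @[y --> within I x^'] --> derivative_on I g x by exact: dg.
have c2 : diff_quotient h (g x) y @[y --> within (g @` I) (g x)^'] -->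
    derivative_on (g @` I) h (g x).
  by apply: dh; exists x.
have cg : g y @[y --> within I x^'] --> within (g @` I) (g x)^'.
  move=> B HB.
  have hB : nbhs (g x) [set z | z != g x -> (g @` I) z -> B z] := HB.
  have h1 : nbhs x [set y | I y -> g y != g x -> (g @` I) (g y) -> B (g y)] :=
    diffeo_within_cvg gd xI hB.
  suff : nbhs x [set y | y != x -> I y -> B (g y)] by [].
  apply: filterS h1 => y Hy yx yI.
  have yI' : a <= y <= b by move: (yI); rewrite /= in_itv.
  apply: Hy yI _ (ex_intro2 _ _ y yI erefl).
  by apply: contra_neq yx; exact: (diffeo_inj gd).
have c3 : diff_quotient h (g x) (g y) @[y --> within I x^'] -->
    derivative_on (g @` I) h (g x).
  exact: (cvg_comp _ _ cg c2).
have c4 : (diff_quotient h (g x) (g y) * diff_quotient g x y)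
    @[y --> within I x^'] --> derivative_on (g @` I) h (g x) * derivative_on I g x.
  exact: (cvgM c3 c1).
have c5 : (diff_quotient h (g x) (g y) * diff_quotient g x y)
    @[y --> within I x^'] --> (1 : R).
  apply: (cvg_trans _ (@cvg_cst _ (1 : R) _ (within I x^') _)).
  apply: near_eq_cvg.
  suff H : nbhs x [set y | y != x -> I y ->
     1 = diff_quotient h (g x) (g y) * diff_quotient g x y] by exact: H.
  have H0 : nbhs x [set: R] by exact: filterT.
  apply: filterS H0 => y _ yx yI; rewrite /diff_quotient !hK//.
  have yx' : g y - g x != 0.
    have yI' : a <= y <= b by move: (yI); rewrite /= in_itv.
    by rewrite subr_eq0; apply: contra_neq yx; exact: (diffeo_inj gd).
  by rewrite mulrA mulfVK// mulfV// subr_eq0.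
have e1 : derivative_on (g @` I) h (g x) * derivative_on I g x = 1.
  exact: (cvg_unique (@norm_hausdorff _ _) c4 c5).
by apply/eqP => d0; move: (@oner_neq0 R); rewrite -e1 d0 mulr0 eqxx.
Qed.

Lemma diffeo_MVT g x y : C1_diffeo_onto_image I g -> a <= x -> x < y -> y <= b ->
  exists2 c, x < c < y & g y - g x = derivative_on I g c * (y - x).
Proof.
move=> gd ax xy yb; have [[dg _] _] := gd.
have [||c] := @MVT R g (derivative_on I g) x y xy.
- move=> c /=; rewrite in_itv /= => /andP[xc cy].
  have cI : I c by rewrite /= in_itv /= (ltW (le_lt_trans ax xc)) (ltW (lt_le_trans cy yb)).
  have c1 : diff_quotient g c z @[z --> within I c^'] --> derivative_on I g c by exact: dg.
  (* At an interior point the restriction to the interval is void near [c], so the relative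
     derivative is the ordinary one. *)
  have c2 : (fun h => h^-1 *: ((g \o shift c) (h *: (1 : R)) - g c)) h @[h --> (0:R)^']
     --> derivative_on I g c.
    move=> B HB.
    have H1 : nbhs c [set z | z != c -> I z -> B (diff_quotient g c z)] := c1 B HB.
    have H2 : nbhs c [set z | x < z < y].
      by have := near_in_itvoo (x := c); apply; rewrite in_itv /= xc cy.
    have H3 : nbhs (0 : R) [set h | (h + c != c -> I (h + c) ->
        B (diff_quotient g c (h + c))) /\ x < h + c < y].
      have cs : (fun h : R => h + c) @ nbhs (0 : R) --> (0 + c : R).
        by apply: cvgD; [exact: cvg_id|exact: cvg_cst].
      by rewrite add0r in cs; exact: (cs _ (filterI H1 H2)).
    suff : nbhs (0 : R) [set h | h != 0 ->
      B (h^-1 *: ((g \o shift c) (h *: (1 : R)) - g c))] by [].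
    apply: filterS H3 => h /= [+ /andP[h1 h2]] h0; rewrite /diff_quotient.
    rewrite addrK [_ *: (1:R)]mulr1 [_ *: _]mulrC; apply.
      by rewrite -subr_eq0 addrK.
    by rewrite in_itv /= (ltW (le_lt_trans ax h1)) (ltW (lt_le_trans h2 yb)).
  apply: DeriveDef; first by apply/cvg_ex; exists (derivative_on I g c).
  exact/cvg_lim.
- apply: continuous_subspaceW (diffeo_within_cont gd) => z /=.
  by rewrite !in_itv /= => /andP[xz zy]; rewrite (le_trans ax xz) (le_trans zy yb).
by rewrite in_itv /= => cxy E; exists c.
Qed.

Definition logdq g (x y : R) : R :=
  if x == y then ln `|derivative_on I g x| else ln (`|g x - g y| / `|x - y|).

Lemma logdq_MVT g x y : C1_diffeo_onto_image I g -> a <= x -> x < y -> y <= b ->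
  exists c, [/\ a <= c <= b, `|x - c| <= `|x - y|, `|y - c| <= `|x - y| &
    logdq g x y = logdq g c c].
Proof.
move=> gd ax xy yb; have [c /andP[xc cy] E] := diffeo_MVT gd ax xy yb.
exists c; split.
- by apply/andP; split; lra.
- by rewrite !ltr0_norm ?subr_lt0//; lra.
- by rewrite gtr0_norm ?subr_gt0// ltr0_norm ?subr_lt0//; lra.
rewrite /logdq eqxx lt_eqF// [`|g x - g y|]distrC E normrM [`|x - y|]distrC mulfK//.
by rewrite normr_eq0 subr_eq0 gt_eqF.
Qed.

Lemma logdqC g x y : logdq g x y = logdq g y x.
Proof.
rewrite /logdq eq_sym; case: eqVneq => [->//|_].
by rewrite [`|g x - g y|]distrC [`|x - y|]distrC.
Qed.

(** Every value off the diagonal is also a value on it, at a point no farther from [x] than [y] is.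
    Bounds and moduli of continuity thus reduce to the diagonal. *)
Lemma logdq_mean g x y : C1_diffeo_onto_image I g -> a <= x <= b -> a <= y <= b ->
  exists c, [/\ a <= c <= b, `|x - c| <= `|x - y| & logdq g x y = logdq g c c].
Proof.
move=> gd /andP[ax xb] /andP[ay yb].
have [xy|yx|<-] := ltgtP x y.
- by have [c [cI h1 _ h2]] := logdq_MVT gd ax xy yb; exists c.
- have [c [cI _ h1 h2]] := logdq_MVT gd ay yx xb; exists c; split => //.
    by rewrite [`|x - y|]distrC.
  by rewrite logdqC.
- by exists x; rewrite ax xb lexx.
Qed.

Lemma logdq_eq g x y : C1_diffeo_onto_image I g -> a <= x <= b -> a <= y <= b ->
  x != y -> `|g x - g y| = expR (logdq g x y) * `|x - y|.
Proof.
move=> gd xI yI xy; rewrite /logdq (negbTE xy) lnK.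
  by rewrite mulfVK// normr_eq0 subr_eq0.
rewrite posrE divr_gt0// normr_gt0 subr_eq0//.
by apply: contra_neq xy; exact: diffeo_inj.
Qed.

Lemma logdq_diag_cont g : C1_diffeo_onto_image I g ->
  continuous (fun x => logdq g (clamp a b x) (clamp a b x)).
Proof.
move=> gd; have [[_ cD] _] := gd.
have cDc : continuous (derivative_on I g \o clamp a b).
  apply: within_clamp => x xI; move/subspace_continuousP : cD; apply.
  by rewrite /= in_itv.
rewrite (_ : (fun x => _) = (fun z => ln `|z|) \o (derivative_on I g \o clamp a b)).
  move=> x; apply: continuous_comp; first exact: cDc.
  apply: (@continuous_comp _ _ _ (fun z : R => `|z|) (@ln R)); first exact: norm_continuous.
  apply: continuous_ln; rewrite normr_gt0.
  by apply: diffeo_derivative_neq0 => //; exact: clamp_itv.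
by apply/funext => z; rewrite /logdq eqxx.
Qed.

Lemma logdq_cont g e : C1_diffeo_onto_image I g -> 0 < e ->
  exists2 r : R, 0 < r & forall x y, a <= x <= b -> a <= y <= b -> `|x - y| < r ->
    `|logdq g x x - logdq g y y| < e.
Proof.
move=> gd e0; have [r r0 H] := unif_cont (logdq_diag_cont gd) e0.
exists r => // x y xI yI xy; have := H x y xI xy.
by rewrite (clamp_id xI) (clamp_id yI).
Qed.

Lemma logdq_diag g e : C1_diffeo_onto_image I g -> 0 < e ->
  exists2 r : R, 0 < r & forall x y, a <= x <= b -> a <= y <= b -> `|x - y| < r ->
    `|logdq g x y - logdq g x x| < e.
Proof.
move=> gd e0; have [r r0 H] := logdq_cont gd e0; exists r => // x y xI yI xy.
have [c [cI h ->]] := logdq_mean gd xI yI; rewrite distrC; apply: H => //.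
exact: le_lt_trans xy.
Qed.

(** Reading the orientation off the two endpoint values makes it a measurable function of the random
    map. *)
Lemma diffeo_monotone g x y : C1_diffeo_onto_image I g -> a <= x -> x < y -> y <= b ->
  if g b < g a then g y < g x else g x < g y.
Proof.
move=> gd ax xy yb.
have aI : a \in `[a, b] by rewrite in_itv /= lexx ltW.
have bI : b \in `[a, b] by rewrite in_itv /= lexx ltW.
have xI : x \in `[a, b] by rewrite in_itv /= ax (ltW (lt_le_trans xy yb)).
have yI : y \in `[a, b] by rewrite in_itv /= yb (ltW (le_lt_trans ax xy)).
have inj : {in `[a, b] &, injective g}.
  by move=> u v; rewrite !in_itv /= => uI vI; exact: diffeo_inj.
have cg := diffeo_within_cont gd.
case: ifPn => [gba|]; last rewrite -leNgt => gab.
  have := @itv_continuous_inj_ge _ g `[a, b] _ cg inj.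
  move=> /(_ (ex_intro _ a (ex_intro _ b (And4 aI bI ab (ltW gba))))) H.
  by rewrite ltNge H// -ltNge.
have := @itv_continuous_inj_le _ g `[a, b] _ cg inj.
move=> /(_ (ex_intro _ a (ex_intro _ b (And4 aI bI ab gab)))) H.
by rewrite ltNge H// -ltNge.
Qed.

End C1Diffeo.

(** * Lipschitz constants *)

Section LipschitzConstants.
Context {R : realType}.
Variables (a b : R).
Hypothesis ab : a < b.
Local Notation I := [set` `[a, b]].

Lemma Lip_le (A : set R) g (k : R) : 0 <= k ->
  (forall x y, A x -> A y -> `|g x - g y| <= k * `|x - y|) -> (Lip A g <= k%:E)%E.
Proof.
move=> k0 H; apply: ereal_inf_lbound; exists k => //; split=> //.
by move=> [x y] [/= Ax Ay]; exact: H.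
Qed.

Lemma Lip_ge (A : set R) g (k x y : R) : A x -> A y -> x != y ->
  k * `|x - y| <= `|g x - g y| -> (k%:E <= Lip A g)%E.
Proof.
move=> Ax Ay xy H; apply: le_ereal_inf_tmp => _ [c [c0 Hc] <-]; rewrite lee_fin.
have := Hc (x, y) (conj Ax Ay) => /= h.
have xy0 : 0 < `|x - y| by rewrite normr_gt0 subr_eq0.
by rewrite -(ler_pM2r xy0) (le_trans H).
Qed.

Lemma Lip_ge0 (A : set R) g : (0 <= Lip A g)%E.
Proof. by apply: le_ereal_inf_tmp => _ [c [c0 _] <-]; rewrite lee_fin. Qed.

(** On a small ball all quotients lie between [expR (Q z z - e)] and [expR (Q z z + e)], and the
    ball contains a second point of the interval. [Q] is arbitrary so that n-fold compositions are
    covered. *)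
Lemma local_LipE g (Q : R -> R -> R) z : a <= z <= b ->
  (forall x y, a <= x <= b -> a <= y <= b -> x != y ->
     `|g x - g y| = expR (Q x y) * `|x - y|) ->
  (forall e : R, 0 < e -> exists2 r : R, 0 < r & forall x y, a <= x <= b -> a <= y <= b ->
     `|z - x| < r -> `|z - y| < r -> `|Q x y - Q z z| < e) ->
  local_Lip I g z = (expR (Q z z))%:E.
Proof.
move=> zI gQ cQ; apply: cvg_lim => //.
have two (r : R) : 0 < r -> exists2 y, a <= y <= b & `|z - y| < r /\ y != z.
  move=> r0; have PF := within_dnbhs_proper ab zI.
  have : within I z^' [set y | a <= y <= b /\ (`|z - y| < r /\ y != z)].
    suff : nbhs z [set y | y != z -> I y -> a <= y <= b /\ (`|z - y| < r /\ y != z)] by [].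
    have h : nbhs z [set y | `|z - y| < r] by exact: nbhsx_ballx.
    by apply: filterS h => y zy yz; rewrite /= in_itv => yI; split.
  by move=> /filter_ex[y [? ?]]; exists y.
have bnd (e : R) : 0 < e -> \forall r \near 0^'+,
    ((expR (Q z z - e))%:E <= Lip (I `&` ball z r) g <= (expR (Q z z + e))%:E)%E.
  move=> e0; have [r0 r0_gt0 Hr] := cQ e e0.
  near=> r.
  have rr : 0 < r by near: r; exact: nbhs_right_gt.
  have rr0 : r < r0 by near: r; exact: nbhs_right_lt.
  apply/andP; split.
    have [y yI [zy yz]] := two r rr.
    apply: (@Lip_ge _ _ _ z y).
    - by split; [rewrite /= in_itv|exact: ballxx].
    - by split; [rewrite /= in_itv|].
    - by rewrite eq_sym.
    - rewrite gQ// 1?eq_sym// ler_wpM2r// ler_expR.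
      have := Hr z y zI yI; rewrite subrr normr0 => /(_ r0_gt0 (lt_trans zy rr0)).
      by rewrite ltr_norml => /andP[]; lra.
  apply: Lip_le; first exact: expR_ge0.
  move=> x y [/=]; rewrite in_itv /= => xI zx [/=]; rewrite in_itv /= => yI zy.
  have [->|xy] := eqVneq x y; first by rewrite !subrr normr0 mulr0.
  rewrite gQ// ler_wpM2r// ler_expR.
  have := Hr x y xI yI (lt_trans zx rr0) (lt_trans zy rr0).
  by rewrite ltr_norml => /andP[]; lra.
apply/fine_cvgP; split.
  have := bnd 1 ltr01; apply: filterS => r /andP[h1 h2].
  rewrite ge0_fin_numE ?Lip_ge0//.
  exact: (le_lt_trans h2 (ltry _)).
apply/cvgrPdist_lt => e e0.
have /cvgrPdist_lt/(_ e e0)[d /= d0 Hd] := @continuous_expR R (Q z z).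
have := bnd (d / 2); rewrite divr_gt0// => /(_ isT); apply: filterS => r /andP[h1 h2] /=.
have h3 : Lip (I `&` ball z r) g \is a fin_num.
  by rewrite ge0_fin_numE ?Lip_ge0//; exact: (le_lt_trans h2 (ltry _)).
move: h1 h2; rewrite -(fineK h3) !lee_fin => h1 h2.
have d1 : `|expR (Q z z) - expR (Q z z - d / 2)| < e.
  by apply: Hd; rewrite /= opprB addrC subrK gtr0_norm ?divr_gt0//; lra.
have d2 : `|expR (Q z z) - expR (Q z z + d / 2)| < e.
  by apply: Hd; rewrite /= opprD addNKr normrN gtr0_norm ?divr_gt0//; lra.
by move: d1 d2; rewrite !ltr_norml => /andP[? ?] /andP[? ?]; apply/andP; split; lra.
Unshelve. all: by end_near. Qed.

End LipschitzConstants.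

(** * Exponentials and piecewise linear interpolation *)

Lemma expR_ge1 (R : realType) (z : R) : (1 <= expR z) = (0 <= z).
Proof. by rewrite -expR0 ler_expR. Qed.

(** Multiply [1 - z <= expR (- z)] by [expR z]. The product form of the error splits off one factor
    of a small parameter in [z]. *)
Lemma exp_quad (R : realType) (z : R) : expR z <= 1 + z + z * (expR z - 1).
Proof.
have h : 1 - z <= expR (- z) by have := expR_ge1Dx (- z).
have := ler_wpM2r (expR_ge0 z) h; rewrite -expRD addNr expR0; lra.
Qed.

(** For either sign of [y] the left side grows with [al] and with the size of [y], so its value at
    [al0] bounds it for all smaller [al]. *)
Lemma exp_quad_bnd (R : realType) (al al0 y s t : R) : 0 < al -> al <= al0 -> - s <= y -> y <= t ->
  0 <= s -> 0 <= t ->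
  y * (expR (al * y) - 1) <= s * (1 - expR (- al0 * s)) + t * (expR (al0 * t) - 1).
Proof.
move=> a0 aa sy yt s0 t0.
have al00 : 0 < al0 by exact: lt_le_trans aa.
have p1 : 0 <= s * (1 - expR (- al0 * s)).
  by rewrite mulr_ge0// subr_ge0 expR_le1 mulNr oppr_le0 mulr_ge0// ltW.
have p2 : 0 <= t * (expR (al0 * t) - 1).
  by rewrite mulr_ge0// subr_ge0 expR_ge1 mulr_ge0// ltW.
have [y0|y0] := leP 0 y.
  have : y * (expR (al * y) - 1) <= t * (expR (al0 * t) - 1).
    apply: ler_pM => //; first by rewrite subr_ge0 expR_ge1 mulr_ge0// ltW.
    by rewrite lerD2r ler_expR ler_pM// ltW.
  by move=> h; apply: (le_trans h); rewrite lerDr.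
have : (- y) * (1 - expR (al * y)) <= s * (1 - expR (- al0 * s)).
  apply: ler_pM; [lra| |lra|].
    by rewrite subr_ge0 expR_le1 mulr_ge0_le0// ltW.
  rewrite lerD2l lerN2 ler_expR mulNr lerNl -mulrN.
  by apply: ler_pM => //; lra.
by move=> h; rewrite -mulrNN opprB (le_trans h)// lerDl.
Qed.

Section Interpolation.
Context {R : realType}.
Variables (a b alpha : R) (l : nat).
Hypotheses (ab : a < b) (al0 : 0 < alpha) (al1 : alpha <= 1).
Implicit Types (c : nat -> R) (u : R -> R).

Definition mesh : R := (b - a) / l.+1%:R.
Definition node (i : nat) : R := a + i%:R * mesh.
(** The [minn] assigns [b], where the quotient is [l.+1], to the last cell. *)
Definition cell (x : R) : nat := minn (Num.truncn ((x - a) / mesh)) l.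
(** Node values form a sequence rather than a function on the interval, so that limits of node
    values can be interpolated too. *)
Definition interp c x : R :=
  c (cell x) + (x - node (cell x)) / mesh * (c (cell x).+1 - c (cell x)).

Lemma mesh_gt0 : 0 < mesh.
Proof. by rewrite divr_gt0 ?subr_gt0// ltr0n. Qed.

Lemma nodeS i : node i.+1 = node i + mesh.
Proof. by rewrite /node mulrS; ring. Qed.

Lemma node_last : node l.+1 = b.
Proof. by rewrite /node /mesh mulrC mulfVK ?gt_eqF ?ltr0n// addrC subrK. Qed.

Lemma node_le i j : (i <= j)%N -> node i <= node j.
Proof. by move=> ij; rewrite lerD2l ler_wpM2r ?(ltW mesh_gt0)// ler_nat. Qed.

Lemma node_itv i : (i <= l.+1)%N -> a <= node i <= b.
Proof.
move=> il; rewrite -[in X in _ && X]node_last node_le// andbT.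
by rewrite lerDl mulr_ge0// ltW// mesh_gt0.
Qed.

Lemma cell_le x : (cell x <= l)%N. Proof. exact: geq_minr. Qed.

Lemma cellP x : a <= x <= b -> node (cell x) <= x <= node (cell x).+1.
Proof.
move=> /andP[ax xb]; have m0 := mesh_gt0.
have t0 : 0 <= (x - a) / mesh by rewrite divr_ge0 ?subr_ge0// ltW.
have /andP[h1 h2] := Num.Theory.truncn_itv t0.
rewrite /cell; set k := Num.truncn _ in h1 h2 *.
have h3 : node k <= x by rewrite /node -lerBrDl -ler_pdivlMr.
have h4 : x < node k.+1 by rewrite /node -ltrBlDl -ltr_pdivrMr.
have [kl|lk] := leqP k l; first by rewrite h3 ltW.
rewrite node_last xb andbT (le_trans _ h3)// node_le// ltnW//.
Qed.

Lemma pow_scale t : 0 <= t -> t <= 1 -> t <= t `^ alpha.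
Proof.
move=> t0 t1; rewrite -[leLHS]powRr1//.
have := t0; rewrite le_eqVlt => /predU1P[<-|t0'].
  by rewrite !powR0 ?oner_eq0// gt_eqF.
by apply: ger_powR; rewrite ?t0' ?t1.
Qed.

(* On a cell the chord slope is turned into the Hoelder bound by
   [s / mesh <= (s / mesh) `^ alpha]. *)
Lemma chord_le (s C D : R) : 0 <= s -> s <= mesh -> 0 <= C ->
  `|D| <= C * mesh `^ alpha -> `|s / mesh * D| <= C * s `^ alpha.
Proof.
move=> s0 sm C0 hD; have m0 := mesh_gt0.
have t0 : 0 <= s / mesh by rewrite divr_ge0// ltW.
have t1 : s / mesh <= 1 by rewrite ler_pdivrMr// mul1r.
rewrite normrM (ger0_norm t0).
have h := pow_scale t0 t1.
have -> : s `^ alpha = (s / mesh) `^ alpha * mesh `^ alpha.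
  by rewrite -powRM ?(ltW m0)// mulfVK// gt_eqF.
by rewrite mulrCA ler_pM.
Qed.

(** The factor 3 counts a chord in the cell of [x], the nodes in between, and a chord in the cell of
    [y]. *)
Lemma interp_hold c C : 0 <= C ->
  (forall i j, (i <= l.+1)%N -> (j <= l.+1)%N ->
     `|c i - c j| <= C * `|node i - node j| `^ alpha) ->
  forall x y, a <= x <= b -> a <= y <= b ->
    `|interp c x - interp c y| <= 3 * C * `|x - y| `^ alpha.
Proof.
move=> C0 Hc; have m0 := mesh_gt0.
have step i : (i <= l)%N -> `|c i.+1 - c i| <= C * mesh `^ alpha.
  move=> il; have := Hc i.+1 i il (leqW il).
  by rewrite nodeS [node i + mesh]addrC addrK (gtr0_norm m0).
have wl (x y : R) : a <= x <= b -> a <= y <= b -> x <= y ->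
    `|interp c x - interp c y| <= 3 * C * `|x - y| `^ alpha.
  move=> xI yI xy.
  have /andP[x1 x2] := cellP xI; have /andP[y1 y2] := cellP yI.
  have xl := cell_le x; have yl := cell_le y.
  set i := cell x in x1 x2 xl; set j := cell y in y1 y2 yl.
  have P0 : 0 <= C * `|x - y| `^ alpha by rewrite mulr_ge0// powR_ge0.
  have mono (s : R) : 0 <= s -> s <= `|x - y| -> C * s `^ alpha <= C * `|x - y| `^ alpha.
    by move=> s0 sxy; rewrite ler_wpM2l// ge0_ler_powR ?nnegrE// ltW.
  have xyE : `|x - y| = y - x by rewrite distrC ger0_norm// subr_ge0.
  have [ij|ji|ij] := ltngtP i j.
  - have nij : node i.+1 <= node j by exact: node_le.
    have e1 : interp c x - c i.+1 = - ((node i.+1 - x) / mesh * (c i.+1 - c i)).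
      rewrite /interp -/i nodeS.
      have -> : (x - node i) / mesh = 1 - (node i + mesh - x) / mesh.
        by field; rewrite gt_eqF.
      by ring.
    have e2 : interp c y - c j = (y - node j) / mesh * (c j.+1 - c j).
      by rewrite /interp -/j; ring.
    have b1 : `|interp c x - c i.+1| <= C * `|x - y| `^ alpha.
      rewrite e1 normrN; apply: (le_trans (chord_le _ _ C0 (step i xl))).
      + by rewrite subr_ge0.
      + by rewrite nodeS; lra.
      + by apply: mono; rewrite ?xyE; lra.
    have b2 : `|interp c y - c j| <= C * `|x - y| `^ alpha.
      rewrite e2; apply: (le_trans (chord_le _ _ C0 (step j yl))).
      + by rewrite subr_ge0.
      + by move: y2; rewrite nodeS; lra.
      + by apply: mono; rewrite ?xyE; lra.
    have b3 : `|c i.+1 - c j| <= C * `|x - y| `^ alpha.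
      apply: (le_trans (Hc i.+1 j _ (leqW yl))) => //; apply: mono => //.
      by rewrite distrC ger0_norm ?subr_ge0// xyE; lra.
    have -> : interp c x - interp c y =
       (interp c x - c i.+1) + (c i.+1 - c j) - (interp c y - c j) by ring.
    rewrite (le_trans (ler_normB _ _))// (le_trans (lerD (ler_normD _ _) (lexx _)))//.
    by lra.
  - have : node j.+1 <= node i by exact: node_le.
    move: y2 x1; rewrite nodeS => h1 h2 h3.
    have exy : x = y by apply/eqP; rewrite eq_le xy; lra.
    by rewrite exy subrr normr0 -mulrA mulr_ge0// mulr_ge0// powR_ge0.
  - have e1 : interp c x - interp c y = - ((y - x) / mesh * (c i.+1 - c i)).
      by rewrite /interp -/i -/j -ij; field; rewrite gt_eqF.
    rewrite e1 normrN; apply: (le_trans (chord_le _ _ C0 (step i xl))).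
    + by rewrite subr_ge0.
    + by move: y2; rewrite -ij nodeS; lra.
    + by rewrite xyE in P0 *; lra.
move=> x y xI yI; have [xy|yx] := leP x y; first exact: wl.
by rewrite distrC [`|x - y|]distrC; apply: wl => //; exact: ltW.
Qed.

Lemma interp_conv c x : a <= x <= b -> exists2 t, 0 <= t <= 1 &
  interp c x = (1 - t) * c (cell x) + t * c (cell x).+1.
Proof.
move=> xI; have /andP[x1 x2] := cellP xI; have m0 := mesh_gt0.
exists ((x - node (cell x)) / mesh); last by rewrite /interp; ring.
rewrite divr_ge0 ?subr_ge0 ?(ltW m0)//= ler_pdivrMr// mul1r.
by move: x2; rewrite nodeS; lra.
Qed.

Lemma conv_le (t A x y : R) : 0 <= t <= 1 -> `|x| <= A -> `|y| <= A ->
  `|(1 - t) * x + t * y| <= A.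
Proof.
move=> /andP[t0 t1] xA yA; have t1' : 0 <= 1 - t by lra.
rewrite (le_trans (ler_normD _ _))// !normrM (ger0_norm t0) (ger0_norm t1').
by have := ler_wpM2l t0 yA; have := ler_wpM2l t1' xA; lra.
Qed.

Lemma interp_bnd c A : (forall i, (i <= l.+1)%N -> `|c i| <= A) ->
  forall x, a <= x <= b -> `|interp c x| <= A.
Proof.
move=> H x xI; have [t tI ->] := interp_conv c xI.
by apply: (conv_le tI); apply: H; [exact: leqW (cell_le x)|exact: cell_le].
Qed.

Lemma interp_err u A : 0 <= A ->
  (forall x y, a <= x <= b -> a <= y <= b -> `|u x - u y| <= A * `|x - y| `^ alpha) ->
  forall x, a <= x <= b -> `|u x - interp (u \o node) x| <= A * mesh `^ alpha.
Proof.
move=> A0 H x xI; have [t tI E] := interp_conv (u \o node) xI.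
have /andP[x1 x2] := cellP xI; have m0 := mesh_gt0; have cl := cell_le x.
have -> : u x - interp (u \o node) x = (1 - t) * (u x - u (node (cell x)))
    + t * (u x - u (node (cell x).+1)) by rewrite E /=; ring.
have near_ y : a <= y <= b -> `|x - y| <= mesh -> `|u x - u y| <= A * mesh `^ alpha.
  move=> yI xy; apply: (le_trans (H x y xI yI)).
  by rewrite ler_wpM2l// ge0_ler_powR ?nnegrE ?(ltW al0) ?(ltW m0).
apply: (conv_le tI); apply: near_.
- by apply: node_itv; exact: leqW.
- by rewrite ger0_norm ?subr_ge0//; move: x2; rewrite nodeS; lra.
- exact: node_itv.
- by rewrite distrC ger0_norm ?subr_ge0//; move: x1; rewrite nodeS; lra.
Qed.

Lemma mesh_le_node i j : i != j -> mesh <= `|node i - node j|.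
Proof.
wlog ij : i j / (i < j)%N => [H|_].
  by case: (ltngtP i j) => // ij _; [|rewrite distrC]; apply: H => //; rewrite ltn_eqF.
rewrite distrC ger0_norm ?subr_ge0 ?node_le ?(ltnW ij)//.
have := node_le ij; rewrite nodeS; lra.
Qed.

(** Distinct nodes are at least [mesh] apart, so on a fixed mesh convergence of node values is
    convergence in the Hoelder norm. *)
Lemma interp_small c e : 0 <= e -> (forall i, (i <= l.+1)%N -> `|c i| <= e) ->
  forall x y, a <= x <= b -> a <= y <= b ->
    `|interp c x - interp c y| <= 6 * e / mesh `^ alpha * `|x - y| `^ alpha.
Proof.
move=> e0 ce x y xI yI; have m0 := mesh_gt0.
have ma : 0 < mesh `^ alpha by exact: powR_gt0.
rewrite (_ : 6 * e / _ = 3 * (2 * e / mesh `^ alpha)); last by field; rewrite gt_eqF.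
apply: interp_hold => //; first by rewrite divr_ge0 ?mulr_ge0// ltW.
move=> i j il jl; have [<-|ij] := eqVneq i j.
  by rewrite subrr normr0 mulr_ge0 ?powR_ge0// divr_ge0 ?mulr_ge0// ltW.
apply: (@le_trans _ _ (2 * e)).
  by have := ler_normB (c i) (c j); have := ce i il; have := ce j jl; lra.
rewrite mulrAC ler_pdivlMr// ler_wpM2l ?mulr_ge0//.
by apply: (ge0_ler_powR (ltW al0)); rewrite ?nnegrE ?mesh_le_node// ltW.
Qed.

Lemma interp_lin k c c' x :
  interp (fun i => k * c i + c' i) x = k * interp c x + interp c' x.
Proof. by rewrite /interp; ring. Qed.

End Interpolation.

(** * Simultaneous limits of finitely many bounded sequences *)

Section BolzanoWeierstrass.
Context {R : realType}.

Lemma cvg_subseq (u : nat -> R) (l : R) (s : nat -> nat) :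
  {homo s : i j / (i < j)%N} -> u @ \oo --> l -> u \o s @ \oo --> l.
Proof.
move=> hs ul; apply: (cvg_comp _ _ _ ul); apply/cvgnyPge => A.
have ge n : (n <= s n)%N by elim: n => // n IH; exact: leq_ltn_trans IH (hs _ _ _).
by exists A => // n /= An; exact: leq_trans An (ge n).
Qed.

Lemma bolzano_weierstrass_fin (m : nat) (v : nat -> nat -> R) :
  (forall k i, (i < m)%N -> `|v k i| <= 1) ->
  exists (s : nat -> nat) (c : nat -> R), {homo s : i j / (i < j)%N} /\
    forall i, (i < m)%N -> v (s k) i @[k --> \oo] --> c i.
Proof.
elim: m => [|m IH] H; first by exists id, (fun=> 0); split.
have [s [c [hs sc]]] := IH (fun k i im => H k i (leqW im)).
have [s' hs' cs'] : exists2 g : nat -> nat, increasing_seq g & cvgn ((fun k => v (s k) m) \o g).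
  apply: bolzano_weierstrass; exists 1; split => // x x1 k _ /=.
  by rewrite (le_trans (H _ _ _))// ltW.
have hs'' : {homo s' : i j / (i < j)%N}.
  by move=> i j; rewrite !ltnNge; apply: contra; have := hs' j i; rewrite !leEnat => ->.
exists (s \o s'), (fun i => if i == m then limn ((fun k => v (s k) m) \o s') else c i).
split=> [i j ij|i im]; first by apply: hs; exact: hs''.
case: eqP => [->|/eqP nm]; first exact: cs'.
by apply: (@cvg_subseq (fun k => v (s k) i)) => //; apply: sc; rewrite ltn_neqAle nm.
Qed.

Lemma cvg_sum_dist (m : nat) (v : nat -> nat -> R) (c : nat -> R) :
  (forall i, (i < m)%N -> v k i @[k --> \oo] --> c i) ->
  \sum_(i < m) `|v k i - c i| @[k --> \oo] --> (0 : R).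
Proof.
elim: m => [_|m IH H].
  by under eq_fun do rewrite big_ord0; exact: cvg_cst.
have h1 := IH (fun i im => H i (leqW im)).
have h2 : `|v k m - c m| @[k --> \oo] --> (0 : R).
  rewrite -(normr0 R) -(subrr (c m)).
  by apply: cvg_norm; apply: cvgB; [exact: H|exact: cvg_cst].
rewrite (_ : (fun k => _) = (fun k => \sum_(i < m) `|v k i - c i| + `|v k m - c m|)).
  by rewrite -[X in _ --> X](addr0 0); exact: cvgD.
by apply/funext => k; rewrite big_ord_recr.
Qed.

End BolzanoWeierstrass.

(** * The first coordinate of a product measure *)

Section CoordinateZero.
Context {d : measure_display} {T : measurableType d} {R : realType}.
Variables (p : probability T R) (P : probability (path_space T) R).
Hypothesis pP : is_product_measure p P.

Definition path_cons (z : T * path_space T) : path_space T :=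
  fun i => if i is j.+1 then z.2 j else z.1.

Lemma measurable_path_coord (A : set T) i : measurable A ->
  measurable ([set w | A (w i)] : set (path_space T)).
Proof. by move=> mA; apply: sub_sigma_algebra; exists i, A. Qed.

Lemma measurable_path_cons : measurable_fun setT path_cons.
Proof.
apply: (@measurability _ _ _ (path_space T) setT path_cons (@coord_sets d T)).
  by [].
move=> _ [_ [i [A [mA ->]]] <-]; rewrite setTI; case: i => [|i].
  rewrite (_ : _ @^-1` _ = A `*` setT); first exact: measurableX.
  by apply/seteqP; split => [z|z [? _]].
rewrite (_ : _ @^-1` _ = setT `*` [set w | A (w i)]).
  by apply: measurableX => //; exact: measurable_path_coord.
by apply/seteqP; split => [z|z [_ ?]].
Qed.

Let cylinders : set (set (path_space T)) :=
  [set C | exists n (A : nat -> set T), (forall i, measurable (A i)) /\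
    C = [set w | forall i, (i < n)%N -> A i (w i)]].

Let measurable_cylinder n (A : nat -> set T) : (forall i, measurable (A i)) ->
  measurable ([set w | forall i, (i < n)%N -> A i (w i)] : set (path_space T)).
Proof.
move=> mA; rewrite (_ : mkset _ = \bigcap_(i < n) [set w | A i (w i)]).
  by apply: bigcap_measurableType => i _; exact: measurable_path_coord.
by apply/seteqP; split => w /= h i; [move=> ?; exact: h|exact: h].
Qed.

Let cylinders_generate : measurable = <<s cylinders >>.
Proof.
apply/seteqP; split.
  apply: smallest_sub; first exact: smallest_sigma_algebra.
  move=> _ [i [A [mA ->]]]; apply: sub_sigma_algebra.
  exists i.+1, (fun j => if j == i then A else setT); split.
    by move=> j; case: ifP.
  apply/seteqP; split => w /=; first by move=> h j _; case: eqP => // ->.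
  by move=> /(_ i (ltnSn i)); rewrite eqxx.
apply: smallest_sub; first exact: sigma_algebra_measurable.
by move=> _ [n [A [mA ->]]]; exact: measurable_cylinder.
Qed.

Let cylindersI : setI_closed cylinders.
Proof.
move=> _ _ [n [A [mA ->]]] [m [B [mB ->]]].
pose r (n i : nat) (A : nat -> set T) := if (i < n)%N then A i else setT.
exists (maxn n m), (fun i => r n i A `&` r m i B); split.
  by move=> i; apply: measurableI; rewrite /r; case: ifP.
apply/seteqP; split => w /=.
  by move=> [h1 h2] i _; split; rewrite /r; case: ifP => // il; [exact: h1|exact: h2].
move=> h; split => i il.
  by have [] := h i; rewrite ?leq_max ?il// /r il.
by have [] := h i; rewrite ?leq_max ?il ?orbT// /r il.
Qed.

Lemma path_cons_preserving (B : set (path_space T)) : measurable B ->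
  (p \x P)%E (path_cons @^-1` B) = P B.
Proof.
move=> mB; apply/esym.
pose Q := measure_function_pushforward__canonical__measure_function_Measure
  (p \x P)%E measurable_path_cons.
apply: (@measure_unique _ _ _ cylinders (fun=> setT) cylinders_generate cylindersI
  _ _ P Q) => //.
- move=> _; exists 0%N, (fun=> setT); split => //.
  by apply/seteqP; split.
- exact: bigcup_const.
- move=> _ [n [A [mA ->]]]; apply: (etrans (pP n mA)).
  change (\prod_(i < n) p (A i) = (p \x P)
    (path_cons @^-1` [set w | forall i, (i < n)%N -> A i (w i)]))%E.
  case: n => [|n].
    rewrite big_ord0 (_ : _ @^-1` _ = setT); first by rewrite probability_setT.
    by apply/seteqP; split.
  rewrite big_ord_recl (_ : _ @^-1` _ =
      A 0%N `*` [set w | forall i, (i < n)%N -> A i.+1 (w i)]).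
    apply/esym; apply: (etrans (product_measure1E p P (mA 0%N)
      (measurable_cylinder n (fun i => mA i.+1)))).
    by congr (_ * _)%E; exact: (pP n (fun i => mA i.+1)).
  apply/seteqP; split => z /=; first by move=> h; split => [|i il]; [exact: (h 0%N)|exact: (h i.+1)].
  by move=> [h1 h2] [|i] il //=; exact: h2.
- by move=> _; rewrite [ltLHS](@probability_setT _ _ _ P) ltry.
Qed.

(** [B] need not be measurable, and the null set [Z] covering its cylinder need not be a cylinder.
    For [t] in [B] the section of [Z] at [t] is the whole path space, while almost every section is
    null. *)
Lemma negligible_coord0 (B : set T) :
  P.-negligible [set w | B (w 0%N)] -> p.-negligible B.
Proof.
move=> [Z [mZ PZ BZ]]; pose Y := path_cons @^-1` Z.
have mY : measurable Y by rewrite -[Y]setTI; exact: measurable_path_cons.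
have : (\int[p]_t `|(P \o xsection Y) t| = 0)%E.
  rewrite (eq_integral (P \o xsection Y)); last first.
    by move=> t _; rewrite gee0_abs.
  by have := path_cons_preserving mZ; rewrite PZ.
have mx : measurable_fun setT (P \o xsection Y) by exact: measurable_fun_xsection.
move=> /(ae_eq_integral_abs p measurableT mx) h.
suff [A [mA A0 BA]] : {ae p, forall t, ~ B t}.
  by exists A; split => // t Bt; apply: BA => /= /(_ Bt).
apply: filterS h => t /(_ Logic.I) /= xt Bt.
have : xsection Y t = setT.
  by apply/seteqP; split => // w _; rewrite /xsection /= inE; exact: BZ.
by move=> E; move: xt; rewrite E probability_setT => /eqP; rewrite onee_eq0.
Qed.

End CoordinateZero.

(** The squared distance from [(u, v)] to [(s, t)] is at most [m - 2 * m + m]. *)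
Lemma cauchy_schwarz_eq (R : realFieldType) (m s t u v : R) :
  s ^+ 2 + t ^+ 2 = m -> u ^+ 2 + v ^+ 2 <= m -> s * u + t * v = m -> u = s /\ v = t.
Proof.
move=> st uv h; have h1 : (u - s) ^+ 2 + (v - t) ^+ 2 <= 0 by nra.
have := sqr_ge0 (u - s); have := sqr_ge0 (v - t) => h2 h3.
have /eqP : (u - s) ^+ 2 = 0 by lra.
have /eqP : (v - t) ^+ 2 = 0 by lra.
by rewrite !sqrf_eq0 !subr_eq0 => /eqP -> /eqP ->.
Qed.

(** * Measurable suprema, and integrals of nonmeasurable functions *)

Lemma measurable_sup_seq {d} {T : measurableType d} {R : realType}
    (X : nat -> T -> R) : (forall n, measurable_fun setT (X n)) ->
  (forall w, exists B, forall n, X n w <= B) ->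
  exists S : T -> R, [/\ measurable_fun setT S, (forall n w, X n w <= S w) &
    forall w B, (forall n, X n w <= B) -> S w <= B].
Proof.
move=> mX bX; exists (fun w => sups (X ^~ w) 0); split.
- apply: measurable_fun_sups => // w _; have [B HB] := bX w.
  by exists B => _ [n _ <-].
- move=> n w; have [B HB] := bX w; apply: ub_le_sup.
    by exists B => _ [k _ <-].
  by exists n.
- move=> w B HB; apply: ge_sup; first by exists (X 0%N w); exists 0%N.
  by move=> _ [k _ <-].
Qed.

(* The integral of a possibly non-measurable function is a lower integral. *)
Lemma le_lower_integral {d} {T : measurableType d} {R : realType}
    (mu : {measure set T -> \bar R}) (u v : T -> \bar R) :
  (forall w, 0 <= u w)%E -> (forall w, u w <= v w)%E ->
  (\int[mu]_w u w <= \int[mu]_w v w)%E.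
Proof.
move=> u0 uv; have v0 w : (0 <= v w)%E by exact: le_trans (uv w).
rewrite !ge0_integralTE//; apply: ereal_sup_le => _ [h hu <-].
by exists h => // w; exact: le_trans (uv w).
Qed.

(** Raising [v] to infinity on [N] leaves its integral unchanged and makes the comparison hold
    everywhere. *)
Lemma lower_integral_ae {d} {T : measurableType d} {R : realType}
    (mu : {measure set T -> \bar R}) (N : set T) (u v : T -> \bar R) :
  measurable N -> mu N = 0%E -> measurable_fun setT v ->
  (forall w, 0 <= u w)%E -> (forall w, 0 <= v w)%E ->
  (forall w, ~ N w -> (u w <= v w)%E) -> (\int[mu]_w u w <= \int[mu]_w v w)%E.
Proof.
move=> mN N0 mv u0 v0 uv.
pose v' w := if `[< N w >] then +oo%E else v w.
have mv' : measurable_fun setT v'.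
  apply: measurable_fun_ifT => //.
  apply: (measurable_fun_bool true); rewrite setTI.
  by rewrite (_ : _ @^-1` _ = N)//; apply/seteqP; split => w /= /asboolP.
apply: (@le_trans _ _ (\int[mu]_w v' w)%E).
  apply: le_lower_integral => // w; rewrite /v'; case: asboolP => [_|/uv//].
  exact: leey.
rewrite le_eqVlt; apply/orP; left; apply/eqP; apply: ae_eq_integral => //.
exists N; split => // w /= h; apply: contrapT => nN; apply: h => _.
by rewrite /v'; case: asboolP.
Qed.

(** For nonnegative functions, setting the measurable one to infinity or to 0 on [N] encloses the
    other without changing the integral. Positive and negative parts give the general case. *)
Lemma integral_ae_eq_nonmeasurable {d} {T : measurableType d} {R : realType}
    (mu : {measure set T -> \bar R}) (N : set T) (u v : T -> \bar R) :
  measurable N -> mu N = 0%E -> measurable_fun setT v ->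
  (forall w, ~ N w -> u w = v w) -> (\int[mu]_w u w = \int[mu]_w v w)%E.
Proof.
move=> mN N0 mv uv.
have H (s t : T -> \bar R) : measurable_fun setT t -> (forall w, 0 <= s w)%E ->
    (forall w, 0 <= t w)%E -> (forall w, ~ N w -> s w = t w) ->
    (\int[mu]_w s w = \int[mu]_w t w)%E.
  move=> mt s0 t0 st; apply/eqP; rewrite eq_le; apply/andP; split.
    by apply: (lower_integral_ae mN N0) => // w /st ->.
  pose t' w := if `[< N w >] then 0%E else t w.
  have mt' : measurable_fun setT t'.
    apply: measurable_fun_ifT => //.
    apply: (measurable_fun_bool true); rewrite setTI.
    by rewrite (_ : _ @^-1` _ = N)//; apply/seteqP; split => w /= /asboolP.
  apply: (@le_trans _ _ (\int[mu]_w t' w)%E).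
    apply: (lower_integral_ae mN N0) => //.
      by move=> w; rewrite /t'; case: ifP.
    by move=> w nN; rewrite /t'; case: asboolP.
  apply: le_lower_integral => w; first by rewrite /t'; case: ifP.
  by rewrite /t'; case: asboolP => [_|/st <-].
rewrite integralE [RHS]integralE; congr (_ - _)%E; apply: H.
- exact: measurable_funepos.
- by [].
- by [].
- by move=> w /uv; rewrite !funeposE => ->.
- exact: measurable_funeneg.
- by [].
- by [].
- by move=> w /uv; rewrite !funenegE => ->.
Qed.

(** * The random map outside a null set *)

Section Setting.
Context {R : realType} {d : measure_display} {T : measurableType d}.
Variables (P : probability (path_space T) R) (a b : R) (f : T -> R -> R).
Variable N : set (path_space T).
Local Notation I := ([set` `[a, b]] : set R).
Hypothesis ab : a < b.
Hypothesis f_random : random_map I f.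
Hypothesis mN : measurable N.
Hypothesis PN : P N = 0%E.
Hypothesis f_diffeo : forall w, ~ N w -> C1_diffeo_onto_image I (f (w 0%N)).

(** On the exceptional set the map is the identity, a diffeomorphism with logarithmic derivative 0.
    [N] is a set of paths, so [gd w] may depend on more than [w 0]. *)
Definition gd (w : path_space T) : R -> R := if `[< N w >] then id else f (w 0%N).
Definition G (w : path_space T) (x : R) : R := gd w (clamp a b x).
Definition q (w : path_space T) : R -> R -> R := logdq a b (gd w).

Lemma diff_quotient_id x : a <= x <= b ->
  diff_quotient (@id R) x y @[y --> within I x^'] --> (1 : R).
Proof.
move=> xI; have PF := within_dnbhs_proper ab xI.
apply: (cvg_trans _ (@cvg_cst _ (1 : R) _ (within I x^') _)).
apply: near_eq_cvg.
suff : nbhs x [set y | y != x -> I y -> 1 = diff_quotient (@id R) x y] by exact.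
have H0 : nbhs x [set: R] by exact: filterT.
by apply: filterS H0 => y _ yx yI; rewrite /diff_quotient mulfV// subr_eq0.
Qed.

Lemma derivative_id x : a <= x <= b -> derivative_on I (@id R) x = 1.
Proof.
move=> xI; have PF := within_dnbhs_proper ab xI.
by apply/cvg_lim => //; exact: diff_quotient_id.
Qed.

Lemma id_diffeo : C1_diffeo_onto_image I (@id R).
Proof.
have C1 : C1_on I (@id R).
  split.
    move=> x; rewrite /= in_itv => xI; apply/cvg_ex; exists 1; exact: diff_quotient_id.
  apply/subspace_continuousP => x xI0; have xI : a <= x <= b by move: xI0; rewrite /= in_itv.
  rewrite [X in _ --> X](_ : _ = (1 : R)); last exact: (derivative_id xI).
  apply: (cvg_trans _ (@cvg_cst _ (1 : R) _ (within I (nbhs x)) _)).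
  apply: near_eq_cvg.
  suff : nbhs x [set y | I y -> 1 = derivative_on I id y] by exact.
  have H0 : nbhs x [set: R] by exact: filterT.
  by apply: filterS H0 => y _; rewrite /= in_itv => yI; exact/esym/derivative_id.
by split=> //; exists id; rewrite ?image_id.
Qed.

Lemma gd_diffeo w : C1_diffeo_onto_image I (gd w).
Proof.
rewrite /gd; case: asboolP => [_|nN]; first exact: id_diffeo.
exact: f_diffeo.
Qed.

Lemma gd_itv w x : a <= x <= b -> a <= gd w x <= b.
Proof.
rewrite /gd; case: asboolP => // _ xI.
have [H _] := f_random; have := H (w 0%N) x.
by rewrite /= !in_itv /=; exact.
Qed.

Lemma G_range w x : a <= G w x <= b.
Proof. by apply: gd_itv; exact: clamp_itv. Qed.

Lemma G_id w x : a <= x <= b -> G w x = gd w x.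
Proof. by move=> xI; rewrite /G clamp_id. Qed.

Lemma G_f w x : ~ N w -> a <= x <= b -> G w x = f (w 0%N) x.
Proof. by move=> nN xI; rewrite G_id// /gd; case: asboolP. Qed.

Lemma G_cont w : continuous (G w).
Proof. exact: (diffeo_clamp_cont ab (gd_diffeo w)). Qed.

Lemma measurable_coord (i : nat) : measurable_fun setT (fun w : path_space T => w i : T).
Proof.
move=> _ A mA; rewrite setTI; apply: sub_sigma_algebra.
by exists i, A.
Qed.

Lemma measurable_clamp : measurable_fun setT (clamp a b : R -> R).
Proof. by apply: continuous_measurable_fun; exact: clamp_cont. Qed.

Lemma measurable_f2 : measurable_fun setT
  (fun z : path_space T * measurableTypeR R => f (z.1 0%N) (clamp a b z.2)).
Proof.
have mc : measurable_fun setT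
    (fun z : path_space T * measurableTypeR R => clamp a b z.2 : measurableTypeR R).
  by apply: (@measurableT_comp _ _ _ _ _ _ (clamp a b)) => //; exact: measurable_clamp.
have mi : measurable ([set` `[a, b]] : set (measurableTypeR R)) by exact: measurable_itv.
have [fI mf] := f_random.
apply: (@measurable_comp _ _ _ _ _ _ (setT `*` I)
   (fun z : T * measurableTypeR R => f z.1 z.2 : measurableTypeR R) setT
   (fun z : path_space T * measurableTypeR R => (z.1 0%N, clamp a b z.2))) => //.
- exact: measurableX.
- by move=> _ [z _ <-]; split => //=; rewrite in_itv /= clamp_itv.
- apply: measurable_fun_pair => //.
  by apply: (@measurableT_comp _ _ _ _ _ _ (fun w : path_space T => w 0%N)) => //;
    exact: measurable_coord.
Qed.

Lemma measurable_G2 : measurable_fun setT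
  (fun z : path_space T * measurableTypeR R => G z.1 z.2).
Proof.
rewrite (_ : (fun z => _) = (fun z : path_space T * measurableTypeR R =>
   if `[< N z.1 >] then clamp a b z.2 else f (z.1 0%N) (clamp a b z.2))); last first.
  by apply/funext => z; rewrite /G /gd; case: ifP.
apply: measurable_fun_ifT; last exact: measurable_f2.
- apply: (measurable_fun_bool true); rewrite setTI.
  rewrite (_ : _ @^-1` _ = N `*` setT); first exact: measurableX.
  by apply/seteqP; split => [[w x] /= /asboolP|[w x] [/= Nw _]] //; exact/asboolP.
- by apply: (@measurableT_comp _ _ _ _ _ _ (clamp a b)) => //; exact: measurable_clamp.
Qed.

Lemma measurable_G x : measurable_fun setT (G ^~ x).
Proof.
apply: (@measurableT_comp _ _ _ _ _ _
  (fun z : path_space T * measurableTypeR R => G z.1 z.2) _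
  (fun w => (w, x : measurableTypeR R))).
  exact: measurable_G2.
by apply: measurable_fun_pair.
Qed.

Lemma intg_contG (h : R -> R) x : continuous h -> intg P (fun w => h (G w x)).
Proof.
move=> ch; have [M HM] := cont_bnd ab ch.
apply: (intg_bnd P (c := M)); last by move=> w; apply: HM; exact: G_range.
apply: (@measurableT_comp _ _ _ _ _ _ (h : measurableTypeR R -> R)).
  exact: continuous_measurable_fun.
exact: measurable_G.
Qed.

Lemma f_itv (t : T) x : a <= x <= b -> a <= f t x <= b.
Proof.
by move=> xI; have [fI _] := f_random; have := fI t x; rewrite /= !in_itv; exact.
Qed.

(** * Measurability and integrability of logarithmic difference quotients *)

Lemma q_G w x y : a <= x <= b -> a <= y <= b -> x != y ->
  `|G w x - G w y| = expR (q w x y) * `|x - y|.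
Proof. by move=> xI yI xy; rewrite !G_id//; apply: logdq_eq => //; exact: gd_diffeo. Qed.

Lemma qE w x y : a <= x <= b -> a <= y <= b -> x != y ->
  q w x y = ln `|G w x - G w y| - ln `|x - y|.
Proof.
move=> xI yI xy; have xy0 : 0 < `|x - y| by rewrite normr_gt0 subr_eq0.
by rewrite q_G// lnM ?posrE ?expR_gt0// expRK addrK.
Qed.

(** Points tending to [clamp a b x] but distinct from it, always on the side of the farther
    endpoint. They exhibit the diagonal of [q] as a limit of measurable quotients. *)
Definition probe (n : nat) (x : R) : R :=
  let c := clamp a b x in
  c + n.+2%:R^-1 * ((if c <= (a + b) / 2 then b else a) - c).

Lemma probe_facts n x : [/\ a <= probe n x <= b, clamp a b x != probe n x &
  `|clamp a b x - probe n x| <= n.+2%:R^-1 * (b - a)].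
Proof.
have ab' := ab; have cI := clamp_itv ab x; rewrite /probe; set c := clamp a b x in cI *.
have t0 : (0 : R) < n.+2%:R^-1 by rewrite invr_gt0 ltr0n.
have t1 : n.+2%:R^-1 <= (1 : R) by rewrite invf_le1 ?ltr0n// ler1n.
set t : R := n.+2%:R^-1 in t0 t1 *; move: cI => /andP[ac cb].
have [cm|mc] := leP c ((a + b) / 2).
  have bc : 0 < b - c by lra.
  have h1 : 0 < t * (b - c) by exact: mulr_gt0.
  have h2 : t * (b - c) <= b - c by rewrite ler_piMl// ltW.
  have h3 : t * (b - c) <= t * (b - a) by rewrite ler_wpM2l ?(ltW t0)//; lra.
  split; first by apply/andP; split; lra.
    by rewrite -subr_eq0 opprD addNKr oppr_eq0 gt_eqF.
  by rewrite opprD addNKr normrN gtr0_norm.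
have ca : 0 < c - a by lra.
have h1 : 0 < t * (c - a) by exact: mulr_gt0.
have h2 : t * (c - a) <= c - a by rewrite ler_piMl// ltW.
have h3 : t * (c - a) <= t * (b - a) by rewrite ler_wpM2l ?(ltW t0)//; lra.
have -> : t * (a - c) = - (t * (c - a)) by ring.
split; first by apply/andP; split; lra.
  by rewrite -subr_eq0 opprB addrC subrK gt_eqF.
by rewrite opprB addrC subrK gtr0_norm.
Qed.

Lemma measurable_probe n : measurable_fun setT (probe n).
Proof.
apply: measurable_funD; first exact: measurable_clamp.
apply: measurable_funM; first exact: measurable_cst.
apply: measurable_funB; last exact: measurable_clamp.
apply: measurable_fun_ifT.
- by apply: measurable_fun_ler => //; exact: measurable_clamp.
- exact: measurable_cst.
- exact: measurable_cst.
Qed.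

Lemma q_probe_cvg w x :
  q w (clamp a b x) (probe n x) @[n --> \oo] --> q w (clamp a b x) (clamp a b x).
Proof.
apply/cvgrPdist_lt => e e0.
have [r r0 Hr] := logdq_diag ab (gd_diffeo w) e0.
near=> n; rewrite distrC; have [pI _ h] := probe_facts n x.
apply: Hr => //; first exact: clamp_itv.
apply: (le_lt_trans h); rewrite mulrC ltr_pdivrMr ?ltr0n// mulrC -ltr_pdivrMr//.
have : (b - a) / r < n%:R by near: n; exact: nbhs_infty_gtr.
by move/lt_trans; apply; rewrite ltr_nat.
Unshelve. all: by end_near. Qed.

Lemma measurable_q2 : measurable_fun setT
  (fun z : path_space T * measurableTypeR R => q z.1 (clamp a b z.2) (clamp a b z.2)).
Proof.
apply: (@measurable_fun_cvg _ _ _ _ (fun n (z : path_space T * measurableTypeR R) =>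
   q z.1 (clamp a b z.2) (probe n z.2))); last by move=> z _; exact: q_probe_cvg.
move=> n.
rewrite (_ : (fun z => _) = (fun z : path_space T * measurableTypeR R =>
   ln `|G z.1 (clamp a b z.2) - G z.1 (probe n z.2)|
      - ln `|clamp a b z.2 - probe n z.2|)); last first.
  apply/funext => z; have [pI ne _] := probe_facts n z.2.
  by rewrite qE// clamp_itv.
have mG (u : R -> R) : measurable_fun setT u -> measurable_fun setT
    (fun z : path_space T * measurableTypeR R => G z.1 (u z.2)).
  move=> mu; apply: (@measurableT_comp _ _ _ _ _ _
    (fun z : path_space T * measurableTypeR R => G z.1 z.2) _
    (fun z : path_space T * measurableTypeR R => (z.1, u z.2 : measurableTypeR R))).
    exact: measurable_G2.
  apply: measurable_fun_pair => //.
  by apply: (@measurableT_comp _ _ _ _ _ _ u).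
have mc : measurable_fun setT
    (fun z : path_space T * measurableTypeR R => clamp a b z.2).
  by apply: (@measurableT_comp _ _ _ _ _ _ (clamp a b)) => //; exact: measurable_clamp.
have mp : measurable_fun setT
    (fun z : path_space T * measurableTypeR R => probe n z.2).
  by apply: (@measurableT_comp _ _ _ _ _ _ (probe n)) => //; exact: measurable_probe.
have mln (u : path_space T * measurableTypeR R -> R) : measurable_fun setT u ->
    measurable_fun setT (fun z => ln `|u z|).
  move=> mu; apply: (@measurableT_comp _ _ _ _ _ _ (@ln R)); first exact: measurable_ln.
  exact: (@measurableT_comp _ _ _ _ _ _ (fun x : R => `|x|)).
apply: measurable_funB; apply: mln; apply: measurable_funB => //; apply: mG.
  exact: measurable_clamp.
exact: measurable_probe.
Qed.

Lemma measurable_q x y : a <= x <= b -> a <= y <= b ->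
  measurable_fun setT (fun w => q w x y).
Proof.
move=> xI yI; have [<-|xy] := eqVneq x y.
  rewrite (_ : (fun w => _) = (fun w => q w (clamp a b x) (clamp a b x))); last first.
    by apply/funext => w; rewrite clamp_id.
  apply: (@measurableT_comp _ _ _ _ _ _
    (fun z : path_space T * measurableTypeR R => q z.1 (clamp a b z.2) (clamp a b z.2)) _
    (fun w => (w, x : measurableTypeR R))).
    exact: measurable_q2.
  by apply: measurable_fun_pair.
rewrite (_ : (fun w => _) = (fun w => ln `|G w x - G w y| - ln `|x - y|)); last first.
  by apply/funext => w; rewrite qE.
apply: measurable_funB; last exact: measurable_cst.
apply: (@measurableT_comp _ _ _ _ _ _ (@ln R)); first exact: measurable_ln.
apply: (@measurableT_comp _ _ _ _ _ _ (fun x : R => `|x|)) => //.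
by apply: measurable_funB; exact: measurable_G.
Qed.

(** The clamped rationals, dense in the interval: suprema of continuous functions become countable.
    Codes of no rational fall back to 0. *)
Definition grid (n : nat) : R := clamp a b (ratr (odflt 0 (@unpickle rat n))).

Lemma grid_itv n : a <= grid n <= b. Proof. exact: clamp_itv. Qed.

Lemma grid_dense (u : R -> R) B : continuous (u \o clamp a b) ->
  (forall n, u (grid n) <= B) -> forall x, a <= x <= b -> u x <= B.
Proof.
move=> cu H x xI; rewrite leNgt; apply/negP => Bu.
have : nbhs x [set y | B < u (clamp a b y)].
  have h : nbhs (u (clamp a b x)) [set z | B < z].
    by apply: open_nbhs_nbhs; split; [exact: open_gt|rewrite /= clamp_id].
  exact: (cu x _ h).
rewrite nbhsE => -[V [openV Vx] VB].
have [r /= [Vr [k _ rk]]] := @dense_rat R V (ex_intro _ x Vx) openV.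
have := H (pickle k); rewrite /grid pickleK /= rk leNgt => /negP; apply.
exact: (VB r Vr).
Qed.

(** The supremum over the grid is measurable, and [logdq_mean] extends it to pairs. Being the least
    bound, it can be compared with the suprema in the statement; [psi] will be the absolute value or
    the identity. *)
Lemma q_sup_seq (psi : R -> R) : continuous psi -> exists S : path_space T -> R,
  [/\ measurable_fun setT S, (forall w x y, a <= x <= b -> a <= y <= b ->
      psi (q w x y) <= S w) &
    forall w B, (forall x, a <= x <= b -> psi (q w x x) <= B) -> S w <= B].
Proof.
move=> cpsi; pose X n w := psi (q w (grid n) (grid n)).
have mX n : measurable_fun setT (X n).
  apply: (@measurableT_comp _ _ _ _ _ _ psi); first exact: continuous_measurable_fun.
  by apply: measurable_q; exact: grid_itv.
have cq w : continuous ((fun x => psi (q w x x)) \o clamp a b).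
  move=> x; apply: (@continuous_comp _ _ _
    (fun x => q w (clamp a b x) (clamp a b x)) psi); last exact: cpsi.
  exact: (logdq_diag_cont ab (gd_diffeo w)).
have [w|S [mS XS SX]] := measurable_sup_seq mX.
  have [c _ cM] := EVT_max (ltW ab) (continuous_subspaceT (cq w)).
  exists (psi (q w (clamp a b c) (clamp a b c))) => n.
  have gI := grid_itv n; have := cM (grid n); rewrite in_itv /= => /(_ gI).
  by rewrite [clamp a b (grid n)]clamp_id.
exists S; split=> //.
- move=> w x y xI yI; have [c [cI _ E]] := logdq_mean (gd_diffeo w) xI yI.
  rewrite /q E.
  exact: (@grid_dense (fun x => psi (q w x x)) (S w) (cq w) (XS ^~ w) c cI).
- by move=> w B H; apply: SX => n; apply: H; exact: grid_itv.
Qed.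

Hypothesis f_int :
  (\int[P]_w sup_norm_on I (fun x => ln `|derivative_on I (f (w 0%N)) x|)%R < +oo)%E.

Lemma qxx w x : q w x x = ln `|derivative_on I (gd w) x|.
Proof. by rewrite /q /logdq eqxx. Qed.

Lemma sup_norm_le (A : set R) (u : R -> R) (S : R) : A !=set0 ->
  (forall B, (forall x, A x -> `|u x| <= B) -> S <= B) -> (S%:E <= sup_norm_on A u)%E.
Proof.
move=> [x0 Ax0] H; have le x : A x -> ((`|u x|)%:E <= sup_norm_on A u)%E.
  by move=> Ax; apply: ereal_sup_ubound; exists x.
case E : (sup_norm_on A u) le => [B| |] le.
- by rewrite lee_fin; apply: H => x /le; rewrite lee_fin.
- by rewrite leey.
- by have := le x0 Ax0; rewrite leeNy_eq.
Qed.

Lemma I0 : I !=set0.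
Proof. by exists a; rewrite /= in_itv /= lexx ltW. Qed.

Lemma q_dominated : exists S : path_space T -> R,
  (forall w x y, a <= x <= b -> a <= y <= b -> `|q w x y| <= S w) /\ intg P S.
Proof.
have [S [mS qS SB]] := q_sup_seq (@norm_continuous R R).
exists S; split=> //.
have aI : a <= a <= b by rewrite lexx ltW.
have S0 w : 0 <= S w by exact: le_trans (normr_ge0 _) (qS w a a aI aI).
apply/integrableP; split; first exact/measurable_EFinP.
(* The integrand of [f_int] is not known to be measurable; for lower integrals a pointwise
   comparison suffices. *)
apply: le_lt_trans f_int; apply: le_lower_integral => w; first exact: abse_ge0.
rewrite /= ger0_norm//; have [Nw|nN] := pselect (N w).
  apply: (@le_trans _ _ 0%E).
    rewrite lee_fin; apply: SB => x xI.
    rewrite qxx /gd; case: asboolP => // _.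
    by rewrite derivative_id// normr1 ln1 normr0.
  apply: sup_norm_le; first exact: I0.
  move=> B /(_ a) h; apply: le_trans (h _); first exact: normr_ge0.
  by rewrite /= in_itv.
apply: sup_norm_le; first exact: I0.
move=> B HB; apply: SB => x xI.
have := HB x; rewrite qxx /gd; case: asboolP => // _; apply.
by rewrite /= in_itv.
Qed.

Hypothesis f_noinv : ~ (exists x y, [/\ I x, I y &
  {ae P, forall w, f (w 0%N) @` [set x; y] = [set x; y]}]).

Lemma notN_ae : {ae P, forall w, ~ N w}.
Proof. by exists N; split => // w /contrapT. Qed.

Lemma G_drift : exists (h : R -> R) c, [/\ continuous h, 0 < c &
  forall x, a <= x <= b ->
  \int[P]_w q w x x + \int[P]_w h (G w x) - h x <= - c].
Proof.
have [S [qS iS]] := q_dominated.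
apply: (@drift _ _ _ P a b G (fun w => G w b < G w a)) iS => //.
- exact: measurable_G.
- exact: G_range.
- exact: G_cont.
- by apply: measurable_fun_ltr; exact: measurable_G.
- move=> w x y ax xy yb.
  have xI : a <= x <= b by rewrite ax (le_trans (ltW xy) yb).
  have yI : a <= y <= b by rewrite yb (le_trans ax (ltW xy)).
  rewrite !G_id ?lexx ?(ltW ab)//.
  exact: (diffeo_monotone ab (gd_diffeo w)).
- move=> [x [y [xI yI H]]]; apply: f_noinv; exists x, y.
  split; rewrite /= ?in_itv//.
  move: H notN_ae; apply: filterS2 => w + nN; rewrite !G_f// => H.
  rewrite image_setU !image_set1.
  by case: H => -[-> ->]; rewrite // setUC.
- by move=> w x y xI yI xy; apply: q_G.
- by move=> w e e0; exact: (logdq_diag ab (gd_diffeo w) e0).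
- by move=> w e e0; exact: (logdq_cont ab (gd_diffeo w) e0).
- by move=> x y xI yI; exact: measurable_q.
Qed.

(** * Lyapunov exponents *)

Lemma Lip_integral :
  (\int[P]_w maxe (lne (Lip I (f (w 0%N)))) 0 < +oo)%E.
Proof.
have [S [qS iS]] := q_dominated.
have aI : a <= a <= b by rewrite lexx ltW.
have S0 w : 0 <= S w by exact: le_trans (normr_ge0 _) (qS w a a aI aI).
have /integrableP[mS lS] := iS.
apply: le_lt_trans lS.
apply: (lower_integral_ae mN PN).
- by apply: measurableT_comp.
- by move=> w; rewrite le_max lexx orbT.
- by move=> w; exact: abse_ge0.
move=> w nN; rewrite /= ger0_norm// ge_max lee_fin S0 andbT.
have le1 : (Lip I (f (w 0%N)) <= (expR (S w))%:E)%E.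
  apply: Lip_le; first exact: expR_ge0.
  move=> x y; rewrite /= !in_itv /= => xI yI.
  have [->|xy] := eqVneq x y; first by rewrite !subrr normr0 mulr0.
  rewrite -!G_f// q_G// ler_wpM2r// ler_expR.
  by have := qS w x y xI yI; rewrite ler_norml => /andP[].
have h0 := Lip_ge0 I (f (w 0%N)).
have : (lne (Lip I (f (w 0%N))) <= lne (expR (S w))%:E)%E.
  by rewrite lee_lne// in_itv /= ?h0 ?leey// lee_fin expR_ge0.
by rewrite lne_EFin ?expR_gt0// expRK.
Qed.

Lemma measurable_shift : measurable_fun setT (@Defs.shift d T).
Proof.
apply: (@measurability _ _ (path_space T) (path_space T) setT (@Defs.shift d T) (@coord_sets d T)) => // _ [_ [i [A [mA ->]]] <-].
rewrite setTI; apply: sub_sigma_algebra; exists i.+1, A; split => //.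
Qed.

(** * The skew product under a stationary measure *)

Section Stationary.
Variable mu : probability (measurableTypeR R) R.
Hypothesis mu_stat : stationary P I f mu.
Let Z := (path_space T * measurableTypeR R)%type.
Let m : probability Z R := (P \x mu)%E.

Let mI : measurable (I : set (measurableTypeR R)).
Proof. exact: measurable_itv. Qed.

Let muI : mu I = 1%E. Proof. by have [] := mu_stat. Qed.

Let mX (A : set (path_space T)) (B : set (measurableTypeR R)) :
  measurable A -> measurable B -> m (A `*` B) = (P A * mu B)%E.
Proof. by move=> mA mB; exact: product_measure1E. Qed.

Definition skewG (z : Z) : Z := (Defs.shift z.1, G z.1 z.2).

Lemma measurable_skewG : measurable_fun setT skewG.
Proof.
apply: measurable_fun_pair; last exact: measurable_G2.
by apply: (@measurableT_comp _ _ _ _ _ _ (@Defs.shift d T)) => //; exact: measurable_shift.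
Qed.

Lemma muIC : mu (~` I) = 0%E.
Proof. by rewrite probability_setC// muI subee. Qed.

Let bad : set Z := (N `*` setT) `|` (setT `*` ~` I).

Lemma bad_null : measurable bad /\ m bad = 0%E.
Proof.
have m1 : measurable (N `*` setT : set Z) by exact: measurableX.
have m2 : measurable (setT `*` ~` I : set Z).
  by apply: measurableX => //; exact: measurableC.
split; first exact: measurableU.
apply: null_set_setU => //.
  by apply: (etrans (mX mN measurableT)); rewrite PN mul0e.
by apply: (etrans (mX measurableT (measurableC mI))); rewrite muIC mule0.
Qed.

(** Off the null set [bad] the modified map agrees with [skew_product f], whose invariance is the
    stationarity of [mu]. *)
Lemma skewG_preserving (B : set Z) : measurable B -> m (skewG @^-1` B) = m B.
Proof.
move=> mB; have [mbad bad0] := bad_null.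
have [_ st] := mu_stat; rewrite -[RHS](st B mB).
have mG' : measurable (skewG @^-1` B).
  by rewrite -[_ @^-1` _]setTI; exact: measurable_skewG.
have E : (setT `*` I) `&` skew_product f @^-1` B `\` bad = skewG @^-1` B `\` bad.
  apply/seteqP; split => -[w x] /=.
    move=> [[[_ xI] Bz] nb]; split => //.
    have nN : ~ N w by move=> Nw; apply: nb; left.
    by move: xI Bz; rewrite in_itv /= /skew_product /skewG /= => xI; rewrite G_f.
  move=> [Bz nb]; have nN : ~ N w by move=> Nw; apply: nb; left.
  have xI : I x by apply: contrapT => nx; apply: nb; right.
  split => //; split; first by split.
  by move: (xI) Bz; rewrite /= in_itv /= /skew_product /skewG /= => xI'; rewrite G_f.
have mS : measurable ((setT `*` I) `&` skew_product f @^-1` B).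
  have mD : measurable (setT `*` I : set Z) by exact: measurableX.
  pose S' (z : Z) : Z := (Defs.shift z.1, f (z.1 0%N) (clamp a b z.2)).
  have mS' : measurable_fun setT S'.
    apply: measurable_fun_pair; last exact: measurable_f2.
    by apply: (@measurableT_comp _ _ _ _ _ _ (@Defs.shift d T)) => //; exact: measurable_shift.
  have -> : (setT `*` I) `&` skew_product f @^-1` B = (setT `*` I) `&` S' @^-1` B.
    apply/seteqP; split => -[w x] [[_ xI]]; rewrite /S' /skew_product /=;
      by (rewrite clamp_id; last by move: xI; rewrite /= in_itv).
  by apply: measurableI => //; rewrite -[_ @^-1` _]setTI; exact: mS'.
have mD0 (A : set Z) : measurable A -> m A = m (A `\` bad).
  move=> mA; rewrite -{1}(setUIDK A bad) setUC measureU0//.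
  - exact: measurableD.
  - exact: measurableI.
  - by apply: (@subset_measure0 _ _ _ m _ bad) => //; exact: measurableI.
by rewrite (mD0 _ mS) (mD0 _ mG') E.
Qed.

Lemma skew_E (V : Z -> R) : intg m V ->
  intg m (V \o skewG) /\ \int[m]_z V (skewG z) = \int[m]_z V z.
Proof.
move=> iV; have mV := intg_meas iV; have mS := measurable_skewG.
have eqm (u : Z -> \bar R) : (\int[pushforward m skewG]_z u z = \int[m]_z u z)%E.
  by apply: eq_measure_integral => A mA _; exact: skewG_preserving.
have iVS : intg m (V \o skewG).
  apply/integrableP; split.
    by apply/measurable_EFinP; exact: measurableT_comp.
  have /integrableP[_] := iV; rewrite -eqm ge0_integral_pushforward//.
  by apply: measurableT_comp => //; exact/measurable_EFinP.
split=> //; rewrite /Rintegral; congr fine.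
rewrite -[RHS]eqm integral_pushforward//.
exact/measurable_EFinP.
Qed.

Let U (z : Z) : R := q z.1 (clamp a b z.2) (clamp a b z.2).

Lemma intg_fst (S : path_space T -> R) : intg P S -> intg m (fun z => S z.1).
Proof.
move=> iS; have mS := intg_meas iS.
have mS2 : measurable_fun setT (fun z : Z => S z.1).
  by apply: (@measurableT_comp _ _ _ _ _ _ S).
apply/(integrable12ltyP P mu).
  exact/measurable_EFinP.
have /integrableP[_] := iS; rewrite /=; congr (_ < _)%E.
apply: eq_integral => w _; rewrite integral_cst// [X in (_ * X)%E](@probability_setT _ _ _ mu) mule1.
by [].
Qed.

Lemma intg_U : intg m U.
Proof.
have [S [qS iS]] := q_dominated.
apply: (intg_dom measurable_q2 (intg_fst iS)) => z.
by apply: qS; exact: clamp_itv.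
Qed.

Lemma iter_skew_E k : intg m (fun z => U (iter k skewG z)) /\
  \int[m]_z U (iter k skewG z) = \int[m]_z U z.
Proof.
elim: k => [|k [iU IH]]; first by split; [exact: intg_U|].
have [h1 h2] := skew_E iU; split.
  by apply: (eq_integrable measurableT _ _ _ h1) => z _ /=; rewrite -iterSr.
by rewrite -IH -h2; apply: eq_Rintegral => z _; rewrite -iterSr.
Qed.

Definition Gn (n : nat) (w : path_space T) (x : R) : R := (iter n skewG (w, x)).2.
Definition shiftn (n : nat) (w : path_space T) : path_space T := iter n (@Defs.shift d T) w.

Lemma iter_skew1 n w x : (iter n skewG (w, x)).1 = shiftn n w.
Proof. by elim: n => //= n IH; rewrite IH. Qed.

Lemma shiftnE n w i : shiftn n w i = w (n + i)%N.
Proof.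
elim: n i => //= n IH i; rewrite /Defs.shift; have := IH i.+1.
by rewrite /shiftn /= addnS addSn.
Qed.

Lemma GnS n w x : Gn n.+1 w x = G (shiftn n w) (Gn n w x).
Proof. by rewrite /Gn /= iter_skew1. Qed.

Lemma Gn_itv n w x : a <= x <= b -> a <= Gn n w x <= b.
Proof. by case: n => // n xI; rewrite GnS; exact: G_range. Qed.

Lemma Gn_cont n w : continuous (Gn n w).
Proof.
elim: n => [|n IH] x; first exact: cvg_id.
rewrite (_ : Gn n.+1 w = G (shiftn n w) \o Gn n w); last by apply/funext => y; rewrite /= GnS.
by apply: continuous_comp; [exact: IH|exact: G_cont].
Qed.

Lemma cocycleE n w x : (forall k, ~ N (shiftn k w)) -> a <= x <= b ->
  cocycle f n w x = Gn n w x.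
Proof.
move=> nN xI; elim: n => //= n ->; rewrite GnS G_f//; last exact: Gn_itv.
by rewrite shiftnE addn0.
Qed.

(** The chain rule for logarithmic difference quotients along two orbits. *)
Definition Qn n w x y : R := \sum_(k < n) q (shiftn k w) (Gn k w x) (Gn k w y).

Lemma Gn_dist n w x y : a <= x <= b -> a <= y <= b -> x != y ->
  `|Gn n w x - Gn n w y| = expR (Qn n w x y) * `|x - y|.
Proof.
move=> xI yI xy; elim: n => [|n IH]; first by rewrite /Qn big_ord0 expR0 mul1r.
have ne : Gn n w x != Gn n w y.
  by rewrite -subr_eq0 -normr_eq0 IH mulf_neq0 ?gt_eqF ?expR_gt0// normr_gt0 subr_eq0.
rewrite !GnS q_G ?Gn_itv// IH mulrA -expRD /Qn big_ord_recr /=.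
by rewrite [X in expR X]addrC.
Qed.

Lemma Qn_diag n w z e : a <= z <= b -> 0 < e -> exists2 r : R, 0 < r &
  forall x y, a <= x <= b -> a <= y <= b -> `|z - x| < r -> `|z - y| < r ->
  `|Qn n w x y - Qn n w z z| < e.
Proof.
move=> zI; elim: n e => [|n IH] e e0.
  by exists 1 => // *; rewrite /Qn !big_ord0 subrr normr0.
have e2 : 0 < e / 2 by rewrite divr_gt0.
have e4 : 0 < e / 4 by rewrite divr_gt0.
have [r1 r10 H1] := IH _ e2.
have [r2 r20 H2] := logdq_diag ab (gd_diffeo (shiftn n w)) e4.
have [r3 r30 H3] := logdq_cont ab (gd_diffeo (shiftn n w)) e4.
have r23 : 0 < Num.min (r2 / 2) r3 by rewrite lt_min divr_gt0.
have /cvgrPdist_lt/(_ _ r23)[r4 /= r40 H4] := @Gn_cont n w z.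
exists (Num.min r1 r4) => [|x y xI yI]; first by rewrite lt_min r10.
rewrite !lt_min => /andP[x1 x4] /andP[y1 y4].
have := H4 x x4; have := H4 y y4; rewrite !lt_min => /andP[ky _] /andP[kx kx3].
have h1 := H1 x y xI yI x1 y1.
have h2 : `|q (shiftn n w) (Gn n w x) (Gn n w y) - q (shiftn n w) (Gn n w x) (Gn n w x)| < e / 4.
  apply: H2; try exact: Gn_itv.
  rewrite (_ : _ - _ = (Gn n w z - Gn n w y) - (Gn n w z - Gn n w x)); last by ring.
  by rewrite (le_lt_trans (ler_normB _ _))// [ltRHS]splitr ltrD.
have h3 : `|q (shiftn n w) (Gn n w z) (Gn n w z) - q (shiftn n w) (Gn n w x) (Gn n w x)| < e / 4.
  by apply: H3; try exact: Gn_itv.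
rewrite /Qn !big_ord_recr /= -/(Qn n w x y) -/(Qn n w z z).
move: h1 h2 h3; rewrite !ltr_norml => /andP[? ?] /andP[? ?] /andP[? ?].
by apply/andP; split; lra.
Qed.

(** Outside this set the orbit avoids [bad] at all times, so the original and the modified
    compositions agree for all n at once. *)
Let badT : set Z := \bigcup_k (iter k skewG) @^-1` bad.

Lemma badT_null : measurable badT /\ m badT = 0%E.
Proof.
have [mb b0] := bad_null.
have mk k : measurable ((iter k skewG) @^-1` bad) /\ m ((iter k skewG) @^-1` bad) = 0%E.
  elim: k => [//|k [mk k0]].
  have -> : iter k.+1 skewG @^-1` bad = skewG @^-1` (iter k skewG @^-1` bad).
    by apply/seteqP; split => z /=; rewrite -iterSr.
  split; last by rewrite skewG_preserving.
  by rewrite -[_ @^-1` _]setTI; exact: measurable_skewG.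
have mT : measurable badT by apply: bigcup_measurable => k _; exact: (mk k).1.
split=> //; apply/negligibleP => //; apply: negligible_bigcup => k.
by apply/negligibleP; [exact: (mk k).1|exact: (mk k).2].
Qed.

Lemma lyapunov_sum n :
  (\int[m]_(z in [set: path_space T] `*` I) lne (local_Lip I (cocycle f n z.1) z.2)
   = (n%:R * \int[m]_z U z)%:E)%E.
Proof.
have [mb b0] := badT_null; rewrite integral_mkcond.
have isum k : intg m (fun z => \sum_(i < k) U (iter i skewG z)) /\
    \int[m]_z (\sum_(i < k) U (iter i skewG z)) = k%:R * \int[m]_z U z.
  elim: k => [|k [i1 e1]].
    rewrite (_ : (fun z => _) = (fun=> 0)); last by apply/funext => z; rewrite big_ord0.
    split; first exact: intg_cst.
    by rewrite E_cst mul0r.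
  have [i2 e2] := iter_skew_E k.
  rewrite (_ : (fun z => _) =
      (fun z => \sum_(i < k) U (iter i skewG z) + U (iter k skewG z))); last first.
    by apply/funext => z; rewrite big_ord_recr.
  split; first exact: intgD.
  by rewrite E_D// e1 e2 -natr1 mulrDl mul1r.
have [i1 e1] := isum n.
rewrite (@integral_ae_eq_nonmeasurable _ _ _ m badT _
  (fun z => (\sum_(i < n) U (iter i skewG z))%:E) mb b0).
- by rewrite -e1 /Rintegral fineK//; exact: integrable_fin_num.
- by apply/measurable_EFinP; exact: (intg_meas i1).
move=> [w x] nb.
have nbk k : ~ bad (iter k skewG (w, x)) by move=> h; apply: nb; exists k.
have xI0 : I x by apply: contrapT => nx; apply: (nbk 0%N); right.
have xI : a <= x <= b by move: (xI0); rewrite /= in_itv.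
have nN k : ~ N (shiftn k w).
  by move=> Nk; apply: (nbk k); left; split => //=; rewrite iter_skew1.
rewrite patchE ifT; last by rewrite inE; split.
rewrite /= (@local_LipE _ a b ab _ (Qn n w) x xI).
- rewrite lne_EFin ?expR_gt0// expRK; congr EFin.
  apply: eq_bigr => k _; rewrite /U iter_skew1 -/(Gn k w x) clamp_id//.
  exact: Gn_itv.
- by move=> y y' yI yI' yy; rewrite !cocycleE//; exact: Gn_dist.
- by move=> e e0; exact: Qn_diag.
Qed.

Lemma lyapunov_eq : lyapunov_exponent P I f mu = (\int[m]_z U z)%:E.
Proof.
apply: cvg_lim => //; apply: cvg_near_cst; near=> n.
rewrite [X in (_ * X)%E](lyapunov_sum n) -EFinM mulrA mulVf ?mul1r//.
by rewrite pnatr_eq0 -lt0n; near: n; exists 1%N.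
Unshelve. all: by end_near. Qed.

(** The coboundary [V (skewG z) - V z] has mean zero and can be added to [U]. By Fubini the inner
    integral over [w] is then the drift expression. *)
Lemma lyapunov_le (h : R -> R) c : continuous h ->
  (forall x, a <= x <= b -> \int[P]_w q w x x + \int[P]_w h (G w x) - h x <= - c) ->
  (lyapunov_exponent P I f mu <= (- c)%:E)%E.
Proof.
move=> ch Hd; rewrite lyapunov_eq lee_fin.
pose V (z : Z) := h (clamp a b z.2).
have cV : continuous (h \o clamp a b).
  by move=> x; apply: continuous_comp; [exact: clamp_cont|exact: ch].
have [M HM] := cont_bnd ab ch.
have mV : measurable_fun setT V.
  by apply: (@measurableT_comp _ _ _ _ _ _ (h \o clamp a b)) => //;
     exact: continuous_measurable_fun.
have iV : intg m V.
  by apply: (intg_bnd m mV (c := M)) => z; apply: HM; exact: clamp_itv.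
have [iVS eV] := skew_E iV.
pose F z := U z + (V (skewG z) - V z).
have iF : intg m F by apply: intgD; [exact: intg_U|exact: intgB].
have EF : \int[m]_z F z = \int[m]_z U z.
  by rewrite E_D ?E_B ?eV ?subrr ?addr0//; [exact: intg_U|exact: intgB].
rewrite -EF -[leRHS](E_cst mu) /Rintegral.
have fub := integral21_prod_meas1 iF.
rewrite -[X in fine X <= _]fub.
have [S [qS iS]] := q_dominated.
have iFx x : intg P (fun w => F (w, x)) /\ \int[P]_w F (w, x) <= - c.
  have cI := clamp_itv ab x.
  have i1 : intg P (fun w => q w (clamp a b x) (clamp a b x)).
    by apply: (intg_dom (measurable_q cI cI) iS) => w; exact: qS.
  have i2 := intg_contG x ch.
  have i3 := intg_cst P (h (clamp a b x)).
  have FE w : F (w, x) = q w (clamp a b x) (clamp a b x)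
      + (h (G w x) - h (clamp a b x)).
    by rewrite /F /V /U /= (clamp_id (G_range w x)).
  rewrite (_ : (fun w => _) = (fun w => q w (clamp a b x) (clamp a b x)
      + (h (G w x) - h (clamp a b x)))); last by apply/funext.
  split; first by apply: intgD => //; exact: intgB.
  rewrite E_D//; last exact: intgB.
  have E' : \int[P]_w h (G w (clamp a b x)) = \int[P]_w h (G w x).
    by apply: eq_Rintegral => w _; rewrite /G (clamp_id cI).
  by rewrite E_B// E_cst addrA -E'; exact: Hd.
have inner : fubini_G P (EFin \o F) = (fun x => (\int[P]_w F (w, x))%:E).
  apply/funext => x; rewrite /fubini_G /Rintegral fineK//.
  by apply: integrable_fin_num => //; exact: (iFx x).1.
rewrite inner -/(Rintegral _ _ _); apply: E_le.
- apply: (intg_bnd mu (c := \int[P]_w (S w + (M + M)))).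
    apply/measurable_EFinP; have := measurable_fubini_G iF; rewrite inner.
    exact.
  move=> x; have [i1 _] := iFx x; apply: (le_trans (E_norm i1)); apply: E_le.
  - exact: intg_norm.
  - by apply: intgD => //; exact: intg_cst.
  - move=> w; rewrite /F (le_trans (ler_normD _ _))// lerD//.
      by apply: qS; exact: clamp_itv.
    rewrite (le_trans (ler_normB _ _))// lerD// /V; apply: HM; exact: clamp_itv.
- exact: intg_cst.
- by move=> x; have [] := iFx x.
Qed.

End Stationary.

Lemma mostly_contractingP : mostly_contracting P I f.
Proof.
split; first exact: Lip_integral.
have [h [c [ch c0 Hd]]] := G_drift.
apply: (@le_lt_trans _ _ (- c)%:E); last by rewrite lte_fin oppr_lt0.
apply: ge_ereal_sup => _ [mu mu_stat <-].
exact: (lyapunov_le mu_stat ch Hd).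
Qed.

(** * Quasi-compactness *)

Section Moment.
Variable beta : R.
Hypothesis beta0 : 0 < beta.
Hypothesis f_mom :
  (\int[P]_w (sup_norm_on I (derivative_on I (f (w 0%N)))) `^ beta < +oo)%E.

Lemma exp_moment : exists Tm : path_space T -> R,
  [/\ measurable_fun setT Tm,
      (forall w x y, a <= x <= b -> a <= y <= b -> q w x y <= Tm w) &
      intg P (fun w => expR (beta * Tm w))].
Proof.
have [Tm [mT qT TB]] := q_sup_seq (fun x => @cvg_id _ (nbhs x)).
exists Tm; split=> //.
pose u w := (expR (beta * Tm w))%:E.
have mexp : measurable_fun setT (fun w => expR (beta * Tm w)).
  apply: (@measurableT_comp _ _ _ _ _ _ expR) => //.
  by apply: measurable_funM => //; exact: measurable_cst.
have mu : measurable_fun setT u by exact/measurable_EFinP.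
(* On [N] the derivative of [f] says nothing about [Tm]; with 0 there, the comparison with the given
   moment is pointwise. *)
pose u' w := if `[< N w >] then 0%E else u w.
have mu' : measurable_fun setT u'.
  apply: measurable_fun_ifT => //.
  apply: (measurable_fun_bool true); rewrite setTI.
  by rewrite (_ : _ @^-1` _ = N)//; apply/seteqP; split => w /= /asboolP.
have u0 w : (0 <= u w)%E by rewrite lee_fin expR_ge0.
have u'0 w : (0 <= u' w)%E by rewrite /u'; case: ifP.
apply/integrableP; split => //.
have -> : (\int[P]_w `|(EFin \o (fun w => expR (beta * Tm w))) w| = \int[P]_w u w)%E.
  by apply: eq_integral => w _; rewrite /= ger0_norm ?expR_ge0.
apply: le_lt_trans (lower_integral_ae mN PN mu' u0 u'0 _) _.
  by move=> w nN; rewrite /u'; case: asboolP.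
apply: le_lt_trans f_mom; apply: le_lower_integral => // w.
rewrite /u'; case: asboolP => [_|nN]; first exact: poweR_ge0.
have aI : a <= a <= b by rewrite lexx ltW.
have le x : a <= x <= b -> ((`|derivative_on I (f (w 0%N)) x|)%:E <=
    sup_norm_on I (derivative_on I (f (w 0%N))))%E.
  by move=> xI; apply: ereal_sup_ubound; exists x => //; rewrite /= in_itv.
have D0 x : a <= x <= b -> 0 < `|derivative_on I (f (w 0%N)) x|.
  by move=> xI; rewrite normr_gt0; apply: diffeo_derivative_neq0 => //; exact: f_diffeo.
case E : (sup_norm_on I _) le => [B| |] le.
- have B0 : 0 < B by have := le a aI; rewrite lee_fin; apply: lt_le_trans; exact: D0.
  rewrite poweR_EFin lee_fin /powR gt_eqF// ler_expR ler_wpM2l ?(ltW beta0)//.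
  apply: TB => x xI; rewrite qxx /gd; case: asboolP => // _.
  by rewrite ler_ln ?posrE ?D0//; have := le x xI; rewrite lee_fin.
- by rewrite poweRyr ?leey// gt_eqF.
- by have := le a aI; rewrite leeNy_eq.
Qed.

(** Expand the exponential to first order in [al]. Near the diagonal the mean of the exponent is at
    most [- (c / 2)], and for small [al] the remainder costs at most [c / 4], uniformly in [x] and
    [y]; this leaves [c / 4]. *)
Lemma moment_contraction : exists (h : R -> R) (M c al0 r : R),
  [/\ continuous h, (forall x, a <= x <= b -> `|h x| <= M), 0 < c,
      [/\ 0 < al0, al0 <= 1, al0 * c <= 1 & 0 < r] &
      forall al x y, 0 < al -> al < al0 -> a <= x <= b -> a <= y <= b -> `|x - y| < r ->
      intg P (fun w => expR (al * (q w x y + (h (G w x) - h x)))) /\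
      \int[P]_w expR (al * (q w x y + (h (G w x) - h x))) <= 1 - al * c].
Proof.
have [h [c [ch c0 Hd]]] := G_drift.
have [Tm [mT qT iT]] := exp_moment.
have [S [qS iS]] := q_dominated; have mS := intg_meas iS.
have [M HM] := cont_bnd ab ch.
have aI : a <= a <= b by rewrite lexx ltW.
have M0 : 0 <= M by exact: le_trans (normr_ge0 _) (HM a aI).
have S0 w : 0 <= S w by exact: le_trans (normr_ge0 _) (qS w a a aI aI).
(* The two sides are bounded separately: an exponential moment is available only for large
   derivatives, while small ones have just an integrable logarithm. *)
pose sm w := S w + 2 * M; pose sp w := Num.max (Tm w) 0 + 2 * M.
have sm0 w : 0 <= sm w by rewrite addr_ge0// mulr_ge0.
have sp0 w : 0 <= sp w by rewrite addr_ge0 ?mulr_ge0// le_max lexx orbT.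
have msm : measurable_fun setT sm by apply: measurable_funD => //; exact: measurable_cst.
have msp : measurable_fun setT sp.
  apply: measurable_funD; last exact: measurable_cst.
  by apply: measurable_maxr => //; exact: measurable_cst.
have mexp (u : path_space T -> R) (k : R) : measurable_fun setT u ->
    measurable_fun setT (fun w => expR (k * u w)).
  move=> mu; apply: (@measurableT_comp _ _ _ _ _ _ expR) => //.
  by apply: measurable_funM => //; exact: measurable_cst.
have isp : intg P (fun w => expR (beta * sp w)).
  apply: (intg_dom (mexp _ _ msp) (intgZ (expR (beta * (2 * M))) (intgD (intg_cst P 1) iT))).
  move=> w; rewrite ger0_norm ?expR_ge0// /sp mulrDr expRD mulrC ler_wpM2l ?expR_ge0//.
  have [h1|h1] := leP (Tm w) 0; first by rewrite mulr0 expR0 lerDl expR_ge0.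
  by rewrite lerDr.
(* Staying below [beta / 2] reserves half of the exponential moment for the linear factor [sp w] of
   the remainder. *)
pose aln (n : nat) : R := beta / 2 * n.+1%:R^-1.
have aln0 n : 0 < aln n by rewrite mulr_gt0 ?divr_gt0// invr_gt0 ltr0n.
have alnb n : aln n <= beta / 2.
  by rewrite ler_piMr ?divr_ge0 ?(ltW beta0)// invf_le1 ?ltr0n// ler1n.
have aln_cvg : aln n @[n --> \oo] --> (0 : R).
  rewrite -(mulr0 (beta / 2)); apply: cvgMr; exact: cvg_harmonic.
pose u n w := sm w * (1 - expR (- aln n * sm w)) + sp w * (expR (aln n * sp w) - 1).
have u_meas n : measurable_fun setT (u n).
  apply: measurable_funD; apply: measurable_funM => //.
    by apply: measurable_funB; [exact: measurable_cst|exact: mexp].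
  by apply: measurable_funB; [exact: mexp|exact: measurable_cst].
have dom : intg P (fun w => sm w + (2 / beta) * expR (beta * sp w)).
  apply: intgD; last exact: intgZ.
  by apply: intgD => //; exact: intg_cst.
have u_dom n w : `|u n w| <= sm w + (2 / beta) * expR (beta * sp w).
  have e1 : 0 <= expR (- aln n * sm w) by exact: expR_ge0.
  have e2 : expR (- aln n * sm w) <= 1.
    by rewrite expR_le1 mulNr oppr_le0 mulr_ge0// ltW.
  have e3 : 1 <= expR (aln n * sp w) by rewrite expR_ge1 mulr_ge0// ltW.
  have p1 : 0 <= sm w * (1 - expR (- aln n * sm w)) by rewrite mulr_ge0// subr_ge0.
  have p2 : 0 <= sp w * (expR (aln n * sp w) - 1) by rewrite mulr_ge0// subr_ge0.
  rewrite ger0_norm ?addr_ge0//; apply: lerD; first by rewrite ler_piMr//; lra.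
  apply: (@le_trans _ _ (sp w * expR (beta / 2 * sp w))).
    rewrite ler_wpM2l// (@le_trans _ _ (expR (aln n * sp w)))//; first lra.
    by rewrite ler_expR ler_wpM2r.
  have k1 : beta / 2 * sp w <= expR (beta / 2 * sp w).
    by have := expR_ge1Dx (beta / 2 * sp w); lra.
  have k2 : sp w <= 2 / beta * expR (beta / 2 * sp w).
    by rewrite -ler_pdivrMl ?divr_gt0// invf_div.
  have -> : expR (beta * sp w) = expR (beta / 2 * sp w) * expR (beta / 2 * sp w).
    by rewrite -expRD -mulrDl -splitr.
  by rewrite mulrA ler_wpM2r ?expR_ge0.
have u_cvg w : u ^~ w @ \oo --> (0 : R).
  have c1 (k : R) : expR (k * aln n) @[n --> \oo] --> (1 : R).
    rewrite -expR0 -(mulr0 k); apply: (continuous_cvg _ (@continuous_expR R _)).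
    exact: cvgMr.
  have -> : u ^~ w = (fun n => sm w * (1 - expR (- sm w * aln n))
      + sp w * (expR (sp w * aln n) - 1)).
    by apply/funext => n; rewrite /u mulNr mulNr [aln n * sm w]mulrC [aln n * sp w]mulrC.
  rewrite (_ : 0 = sm w * (1 - 1) + sp w * (1 - 1)); last by rewrite subrr !mulr0 addr0.
  apply: cvgD; apply: cvgMr; apply: cvgB => //; exact: cvg_cst.
have iu n : intg P (u n) by exact: intg_dom (u_meas n) dom (u_dom n).
have [_] := E_cvg u_meas dom u_dom u_cvg; rewrite E_cst => Eu0.
have c40 : 0 < c / 4 by rewrite divr_gt0.
have [n [n1 n2 n3]] : exists n, [/\ \int[P]_w u n w <= c / 4, aln n <= 1 &
    aln n * (c / 4) <= 1].
  have /cvgrPdist_lt /(_ _ c40) e1 := Eu0.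
  have /cvgrPdist_lt /(_ _ ltr01) e2 := aln_cvg.
  have c4V : 0 < (c / 4)^-1 by rewrite invr_gt0.
  have /cvgrPdist_lt /(_ _ c4V) e3 := aln_cvg.
  have [n _ Hn] : \forall n \near \oo, [/\ `|0 - \int[P]_w u n w| < c / 4,
      `|0 - aln n| < 1 & `|0 - aln n| < (c / 4)^-1] by near=> n; split; near: n.
  have [] := Hn n (leqnn n); rewrite !sub0r !normrN => h1.
  rewrite (ger0_norm (ltW (aln0 n))) => h2 h3; exists n; split.
  - exact: le_trans (ler_norm _) (ltW h1).
  - exact: ltW.
  - by rewrite -ler_pdivlMr// div1r ltW.
have [r r0 Hr] := @q_near _ _ _ P a b q S (fun w e => logdq_diag ab (gd_diffeo w) (e := e))
  measurable_q qS iS _ (divr_gt0 c0 (ltr0n R 2)).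
exists h, M, (c / 4), (aln n), r; split=> //.
move=> al x y al0 aln_ xI yI xy.
pose Y w := q w x y + (h (G w x) - h x).
have ihG := intg_contG x ch.
have iq : intg P (fun w => q w x y).
  by apply: (intg_dom (measurable_q xI yI) iS) => w; exact: qS.
have iY : intg P Y by apply: intgD => //; apply: intgB => //; exact: intg_cst.
have EY : \int[P]_w Y w <= - (c / 2).
  rewrite E_D//; last by apply: intgB => //; exact: intg_cst.
  rewrite E_B//; last exact: intg_cst.
  rewrite E_cst; have := Hd x xI; have := ler_norm (\int[P]_w q w x y - \int[P]_w q w x x).
  have := Hr x y xI yI xy; lra.
have YM w : `|h (G w x) - h x| <= 2 * M.
  by rewrite (le_trans (ler_normB _ _))// mulr_natl mulr2n lerD// HM// G_range.
have Ys w : - sm w <= Y w.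
  have := YM w; have := qS w x y xI yI; rewrite !ler_norml /sm /Y => /andP[? _] /andP[? _]; lra.
have Yp w : Y w <= sp w.
  have := YM w; rewrite ler_norml /sp /Y => /andP[_ ?].
  by rewrite lerD// le_max qT.
have ieY : intg P (fun w => expR (al * Y w)).
  apply: (intg_dom (mexp _ _ (intg_meas iY)) isp) => w.
  rewrite ger0_norm ?expR_ge0// ler_expR.
  apply: (@le_trans _ _ (al * sp w)); first by rewrite ler_wpM2l// ltW.
  rewrite ler_wpM2r// (le_trans (ltW aln_))// (le_trans (alnb n))//.
  by rewrite ler_pdivrMr// ler_peMr// ?ltW//; lra.
split => //.
have iR : intg P (fun w => 1 + al * Y w + al * u n w).
  by apply: intgD; [apply: intgD; [exact: intg_cst|exact: intgZ]|exact: intgZ].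
apply: (@le_trans _ _ (\int[P]_w (1 + al * Y w + al * u n w))).
  apply: E_le => // w; apply: (le_trans (exp_quad _)); rewrite lerD2l -mulrA.
  rewrite ler_wpM2l ?(ltW al0)//.
  exact: exp_quad_bnd (ltW aln_) (Ys w) (Yp w) (sm0 w) (sp0 w).
rewrite E_D; [|by apply: intgD; [exact: intg_cst|exact: intgZ]|exact: intgZ].
rewrite E_D; [|exact: intg_cst|exact: intgZ].
rewrite E_cst !E_Z//.
have : al * (\int[P]_w Y w) <= al * - (c / 2) by rewrite ler_wpM2l// ltW.
have : al * (\int[P]_w u n w) <= al * (c / 4) by rewrite ler_wpM2l// ltW.
nra.
Unshelve. all: by end_near.
Qed.

End Moment.

(** * Lasota-Yorke inequality *)

Section LasotaYorke.
Variable alpha : R.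
Hypotheses (al0 : 0 < alpha) (al1 : alpha <= 1).
Implicit Types u v : R -> R.

Definition PR u x : R := \int[P]_w u (f (w 0%N) x).

Definition Bd u A := forall x, a <= x <= b -> `|u x| <= A.
Definition Hd u A := forall x y, a <= x <= b -> a <= y <= b ->
  `|u x - u y| <= A * `|x - y| `^ alpha.

Lemma Bd_ge0 u A : Bd u A -> 0 <= A.
Proof. by move=> H; apply: le_trans (H a _); rewrite ?normr_ge0// lexx ltW. Qed.

Lemma Hd_ge0 u A : Hd u A -> 0 <= A.
Proof.
move=> H; have := H a b; rewrite !lexx !(ltW ab) => /(_ isT isT).
move=> /(le_trans (normr_ge0 _)); rewrite pmulr_lge0// powR_gt0//.
by rewrite normr_gt0 subr_eq0 lt_eqF.
Qed.

Lemma Hd_cont u A : Hd u A -> continuous (u \o clamp a b).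
Proof.
move=> H x; apply/cvgrPdist_lt => e e0 /=.
have A0 := Hd_ge0 H; have A1 : 0 < A + 1 by lra.
pose s := (e / (A + 1)) `^ alpha^-1.
have eA : 0 < e / (A + 1) by rewrite divr_gt0.
have s0 : 0 < s by exact: powR_gt0.
have /cvgrPdist_lt /(_ _ s0) := clamp_cont (a := a) (b := b) (x := x).
apply: filterS => y xy; apply: (le_lt_trans (H _ _ (clamp_itv ab x) (clamp_itv ab y))).
have : `|clamp a b x - clamp a b y| `^ alpha < e / (A + 1).
  rewrite [ltRHS](_ : _ = s `^ alpha).
    by apply: gt0_ltr_powR; rewrite ?nnegrE// ltW.
  by rewrite -powRrM mulVf ?gt_eqF// powRr1// ltW.
rewrite ltr_pdivlMr// => h; apply: le_lt_trans h.
by rewrite mulrC ler_wpM2l ?powR_ge0//; lra.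
Qed.

Lemma Hd_Bd u A : Hd u A -> exists B, Bd u B.
Proof.
move=> H; exists (A * (b - a) `^ alpha + `|u a|) => x xI.
have aI : a <= a <= b by rewrite lexx ltW.
rewrite -[u x](subrK (u a)) (le_trans (ler_normD _ _))// lerD2r.
apply: (le_trans (H x a xI aI)); rewrite ler_wpM2l ?(Hd_ge0 H)//.
have /andP[ax xb] := xI; have ab' := ab.
by apply: (ge0_ler_powR (ltW al0)); rewrite ?nnegrE ?ger0_norm//; lra.
Qed.

Lemma intg_uf u A x : Hd u A -> a <= x <= b ->
  intg P (fun w => u (f (w 0%N) x)) /\ intg P (fun w => u (G w x)).
Proof.
move=> H xI; split; last first.
  apply: (eq_integrable measurableT _ _ _ (intg_contG x (Hd_cont H))) => w _.
  by rewrite /= clamp_id// G_range.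
have [B HB] := Hd_Bd H.
apply: (intg_bnd P (c := B)); last by move=> w; exact/HB/f_itv.
rewrite (_ : (fun w => _) =
    (fun w : path_space T => (u \o clamp a b) (f (w 0%N) (clamp a b x)))).
  apply: (@measurableT_comp _ _ _ _ _ _ (u \o clamp a b : measurableTypeR R -> R)).
    by apply: continuous_measurable_fun; exact: Hd_cont H.
  apply: (@measurableT_comp _ _ _ _ _ _
    (fun z : path_space T * measurableTypeR R => f (z.1 0%N) (clamp a b z.2)) _
    (fun w => (w, x : measurableTypeR R))); first exact: measurable_f2.
  by apply: measurable_fun_pair.
by apply/funext => w /=; rewrite !clamp_id ?f_itv.
Qed.

Lemma PRE u A x : Hd u A -> a <= x <= b -> PR u x = \int[P]_w u (G w x).
Proof.
move=> H xI; have [i1 i2] := intg_uf H xI.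
apply: E_ae_eq; [exact: intg_meas i1|exact: intg_meas i2|].
by apply: filterS notN_ae => w nN; rewrite G_f.
Qed.

Lemma PR_lin k v u A B x : Hd u A -> Hd v B -> a <= x <= b ->
  PR (fun y => k * u y + v y) x = k * PR u x + PR v x.
Proof.
move=> /intg_uf hu /intg_uf hv xI; have [iu _] := hu _ xI; have [iv _] := hv _ xI.
by rewrite /PR E_D ?E_Z//; exact: intgZ.
Qed.

Lemma PR_eq u v x : (forall y, a <= y <= b -> u y = v y) -> a <= x <= b -> PR u x = PR v x.
Proof. by move=> uv xI; rewrite /PR; congr Rintegral; apply/funext => w; rewrite uv// f_itv. Qed.

Lemma Bd_PR u A B : Hd u A -> Bd u B -> Bd (PR u) B.
Proof.
move=> H HB x xI; apply: E_bnd; first exact: (intg_uf H xI).1.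
by move=> w; apply/HB/f_itv.
Qed.

Lemma Hd_lin k u v A B : Hd u A -> Hd v B -> Hd (fun x => k * u x + v x) (`|k| * A + B).
Proof.
move=> hu hv x y xI yI; rewrite opprD addrACA -mulrBr.
rewrite (le_trans (ler_normD _ _))// mulrDl lerD//; last exact: hv.
by rewrite normrM -mulrA ler_wpM2l//; exact: hu.
Qed.

Section Weighted.
Variables (h : R -> R) (M c r : R).
Hypotheses (ch : continuous h) (hM : forall x, a <= x <= b -> `|h x| <= M).
Hypotheses (c0 : 0 < c) (alc : alpha * c <= 1) (r0 : 0 < r).
Hypothesis contr : forall x y, a <= x <= b -> a <= y <= b -> `|x - y| < r ->
  intg P (fun w => expR (alpha * (q w x y + (h (G w x) - h x)))) /\
  \int[P]_w expR (alpha * (q w x y + (h (G w x) - h x))) <= 1 - alpha * c.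

(** The Hoelder condition with a weight at the first point only, the one at which the drift is
    taken. It is equivalent to [Hd] because [h] is bounded. *)
Definition Hw u A := forall x y, a <= x <= b -> a <= y <= b ->
  `|u x - u y| <= A * (`|x - y| `^ alpha * expR (alpha * h x)).

Let rho := 1 - alpha * c.
(** For points at distance at least [r], [C] times the weighted distance is at least 2, so the sup
    bound alone controls the difference. *)
Let C := 2 / (r `^ alpha * expR (- (alpha * M))).

Lemma Hd_Hw u A : Hd u A -> Hw u (A * expR (alpha * M)).
Proof.
move=> H x y xI yI; apply: (le_trans (H x y xI yI)); rewrite -mulrA.
rewrite ler_wpM2l ?(Hd_ge0 H)// mulrCA ler_peMr ?powR_ge0// -expRD expR_ge1.
by rewrite -mulrDr mulr_ge0 ?(ltW al0)//; have := hM xI; rewrite ler_norml; lra.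
Qed.

Lemma Hw_ge0 u A : Hw u A -> 0 <= A.
Proof.
move=> H; have := H a b; rewrite !lexx !(ltW ab) => /(_ isT isT).
move=> /(le_trans (normr_ge0 _)); rewrite pmulr_lge0// mulr_gt0 ?expR_gt0// powR_gt0//.
by rewrite normr_gt0 subr_eq0 lt_eqF.
Qed.

Lemma Hw_Hd u A : Hw u A -> Hd u (A * expR (alpha * M)).
Proof.
move=> H x y xI yI; apply: (le_trans (H x y xI yI)); rewrite -mulrA.
rewrite ler_wpM2l ?(Hw_ge0 H)// mulrC ler_wpM2r ?powR_ge0// ler_expR ler_wpM2l ?(ltW al0)//.
by have := hM xI; rewrite ler_norml; lra.
Qed.

Lemma powR_expR (s : R) : expR s `^ alpha = expR (alpha * s).
Proof. by rewrite /powR gt_eqF ?expR_gt0// expRK. Qed.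

(** For close points, [Hw] at the two images multiplies the weighted distance by the exponential
    whose mean [contr] bounds by [rho]. *)
Lemma lasota_yorke u A B : Hw u A -> Bd u B -> Hw (PR u) (rho * A + C * B).
Proof.
move=> H HB x y xI yI; have Hd' := Hw_Hd H; have A0 := Hw_ge0 H; have B0 := Bd_ge0 HB.
have C0 : 0 <= C by rewrite divr_ge0// mulr_ge0 ?expR_ge0 ?powR_ge0.
have rho0 : 0 <= rho by rewrite /rho subr_ge0.
have W0 : 0 <= `|x - y| `^ alpha * expR (alpha * h x).
  by rewrite mulr_ge0 ?powR_ge0 ?expR_ge0.
have [<-|xy] := eqVneq x y.
  rewrite subrr normr0; apply: mulr_ge0; first by rewrite addr_ge0// mulr_ge0.
  by apply: mulr_ge0; [exact: powR_ge0|exact: expR_ge0].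
have [xyr|xyr] := ltP `|x - y| r; last first.
  apply: (@le_trans _ _ (2 * B)).
    have := Bd_PR Hd' HB xI; have := Bd_PR Hd' HB yI; have := ler_normB (PR u x) (PR u y); lra.
  rewrite [leRHS]mulrDl; apply: ler_wpDl; first by rewrite !mulr_ge0.
  have d0 : 0 < r `^ alpha * expR (- (alpha * M)) by rewrite mulr_gt0 ?expR_gt0 ?powR_gt0.
  have DW : r `^ alpha * expR (- (alpha * M)) <= `|x - y| `^ alpha * expR (alpha * h x).
    apply: ler_pM; rewrite ?powR_ge0 ?expR_ge0//.
      by apply: (ge0_ler_powR (ltW al0)); rewrite ?nnegrE// ltW.
    rewrite ler_expR -mulrN ler_wpM2l ?(ltW al0)//.
    by have := hM xI; rewrite ler_norml => /andP[].
  rewrite /C [2 / _ * B]mulrAC -[leRHS]mulrA [_^-1 * _]mulrC.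
  by rewrite ler_peMr ?mulr_ge0// ler_pdivlMr// mul1r.
have [ieY eY] := contr xI yI xyr.
rewrite (PRE Hd' xI) (PRE Hd' yI) -E_B; [|exact: (intg_uf Hd' xI).2|exact: (intg_uf Hd' yI).2].
have iD := intgB (intg_uf Hd' xI).2 (intg_uf Hd' yI).2.
apply: (le_trans (E_norm iD)).
apply: (@le_trans _ _ (\int[P]_w (A * (`|x - y| `^ alpha * expR (alpha * h x)) *
   expR (alpha * (q w x y + (h (G w x) - h x)))))).
  apply: E_le; [exact: intg_norm|exact: intgZ|] => w.
  apply: (le_trans (H _ _ (G_range w x) (G_range w y))).
  rewrite q_G// powRM ?expR_ge0// powR_expR -!mulrA ler_wpM2l// le_eqVlt; apply/orP; left.
  apply/eqP; rewrite mulrCA; congr (_ * _); rewrite -!expRD; congr expR; ring.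
rewrite E_Z//; apply: (le_trans (ler_wpM2l (mulr_ge0 A0 W0) eY)).
have := mulr_ge0 (mulr_ge0 C0 B0) W0.
rewrite /rho; set W := _ * expR (alpha * h x); lra.
Qed.

(** The constant [C / (alpha * c)] is the fixed point of [D = rho * D + C], since [1 - rho] is
    [alpha * c]. *)
Lemma PR_iter n u A B : Hw u A -> Bd u B ->
  Bd (iter n PR u) B /\ Hw (iter n PR u) (rho ^+ n * A + C / (alpha * c) * B).
Proof.
move=> H HB; have A0 := Hw_ge0 H; have B0 := Bd_ge0 HB.
have ac0 : 0 < alpha * c by rewrite mulr_gt0.
have C0 : 0 <= C by rewrite divr_ge0// mulr_ge0 ?expR_ge0 ?powR_ge0.
elim: n => [|n [IB IH]] /=.
  split => // x y xI yI; apply: (le_trans (H x y xI yI)); apply: ler_wpM2r.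
    by apply: mulr_ge0; [exact: powR_ge0|exact: expR_ge0].
  by rewrite expr0 mul1r lerDl mulr_ge0// divr_ge0// ltW.
split; first exact: Bd_PR (Hw_Hd IH) IB.
rewrite (_ : _ + _ = rho * (rho ^+ n * A + C / (alpha * c) * B) + C * B).
  exact: lasota_yorke.
rewrite exprS /rho; field.
by rewrite !gt_eqF.
Qed.

Lemma PR_iterHd : exists K, 0 <= K /\ forall n u A B, Hd u A -> Bd u B ->
  Bd (iter n PR u) B /\ Hd (iter n PR u) (K * (rho ^+ n * A + B)).
Proof.
have ac0 : 0 < alpha * c by rewrite mulr_gt0.
have C0 : 0 <= C by rewrite divr_ge0// mulr_ge0 ?expR_ge0 ?powR_ge0.
have rho0 : 0 <= rho by rewrite /rho subr_ge0.
pose E := expR (alpha * M); have E0 : 0 <= E by exact: expR_ge0.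
have D0 : 0 <= C / (alpha * c) by rewrite divr_ge0// ltW.
exists (E * (E + C / (alpha * c))); split; first by rewrite mulr_ge0// addr_ge0.
move=> n u A B H HB; have A0 := Hd_ge0 H; have B0 := Bd_ge0 HB.
have [IB IH] := PR_iter n (Hd_Hw H) HB; split => // x y xI yI.
apply: (le_trans (Hw_Hd IH xI yI)); rewrite ler_wpM2r ?powR_ge0// -/E.
rewrite [leLHS]mulrC -[leRHS]mulrA; apply: ler_wpM2l => //.
have := mulr_ge0 (mulr_ge0 D0 (exprn_ge0 n rho0)) A0; have := mulr_ge0 E0 B0.
move: (C / _) (rho ^+ n) => D t; nra.
Qed.

End Weighted.

(** * Complex Hoelder functions through real and imaginary parts *)

Definition cabs (z : R[i]) : R := complex.Re `|z|.

Lemma cabsE z : cabs z = Num.sqrt (complex.Re z ^+ 2 + complex.Im z ^+ 2).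
Proof. by rewrite /cabs normc_def. Qed.

Lemma cabs_ge0 z : 0 <= cabs z.
Proof. by rewrite cabsE sqrtr_ge0. Qed.

Lemma Re_le_cabs z : `|complex.Re z| <= cabs z.
Proof. by rewrite cabsE -sqrtr_sqr ler_wsqrtr// lerDl sqr_ge0. Qed.

Lemma Im_le_cabs z : `|complex.Im z| <= cabs z.
Proof. by rewrite cabsE -sqrtr_sqr ler_wsqrtr// lerDr sqr_ge0. Qed.

Lemma cabs_le z : cabs z <= `|complex.Re z| + `|complex.Im z|.
Proof.
have s0 : 0 <= `|complex.Re z| + `|complex.Im z| by rewrite addr_ge0.
rewrite cabsE -[leRHS]ger0_norm// -sqrtr_sqr ler_wsqrtr//.
rewrite sqrrD !real_normK ?num_real// -addrA lerD2l lerDr.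
by rewrite mulrn_wge0// mulr_ge0.
Qed.

Implicit Types phi psi : R -> R[i].
Let re phi x := complex.Re (phi x).
Let im phi x := complex.Im (phi x).

Lemma holder_norm_ge0 phi : (0 <= holder_norm I alpha phi)%E.
Proof.
have aI : I a by rewrite /= in_itv /= lexx ltW.
have bI : I b by rewrite /= in_itv /= lexx ltW.
apply: adde_ge0; apply: ereal_sup_ge; [exists (cabs (phi a))%:E|
  exists (cabs (phi a - phi b) / `|a - b| `^ alpha)%:E].
- by exists a.
- by rewrite lee_fin cabs_ge0.
- by exists (a, b) => //; split => //=; rewrite lt_eqF.
- by rewrite lee_fin divr_ge0 ?cabs_ge0 ?powR_ge0.
Qed.

Lemma holder_norm_le phi A B : Bd (re phi) A -> Bd (im phi) A ->
  Hd (re phi) B -> Hd (im phi) B -> (holder_norm I alpha phi <= (2 * (A + B))%:E)%E.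
Proof.
move=> r1 i1 r2 i2; rewrite mulrDr EFinD leeD//; apply: ge_ereal_sup => _ [x xI <-].
  move: xI; rewrite /= in_itv lee_fin => /= xI.
  by rewrite (le_trans (cabs_le _))// mulr_natl mulr2n lerD ?r1 ?i1.
case: x xI => x y [/= ]; rewrite !in_itv /= => xI yI xy; rewrite lee_fin.
have xy0 : 0 < `|x - y| `^ alpha by rewrite powR_gt0// normr_gt0 subr_eq0.
rewrite ler_pdivrMr// (le_trans (cabs_le _))// -mulrA mulr_natl mulr2n.
by rewrite lerD// raddfB ?r2 ?i2.
Qed.

Lemma holder_norm_bnd phi A : (holder_norm I alpha phi <= A%:E)%E ->
  [/\ Bd (re phi) A, Bd (im phi) A, Hd (re phi) A & Hd (im phi) A].
Proof.
have aI : I a by rewrite /= in_itv /= lexx ltW.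
have bI : I b by rewrite /= in_itv /= lexx ltW.
rewrite /holder_norm; set s1 := ereal_sup _; set s2 := ereal_sup _.
have s10 : (0 <= s1)%E.
  by apply: ereal_sup_ge; exists (cabs (phi a))%:E; [exists a|rewrite lee_fin cabs_ge0].
have s20 : (0 <= s2)%E.
  apply: ereal_sup_ge; exists (cabs (phi a - phi b) / `|a - b| `^ alpha)%:E.
    by exists (a, b) => //; split => //=; rewrite lt_eqF.
  by rewrite lee_fin divr_ge0 ?cabs_ge0 ?powR_ge0.
move=> sA; have s1A : (s1 <= A%:E)%E by apply: le_trans sA; rewrite leeDl.
have s2A : (s2 <= A%:E)%E by apply: le_trans sA; rewrite leeDr.
have h1 x : a <= x <= b -> cabs (phi x) <= A.
  move=> xI; rewrite -lee_fin; apply: le_trans s1A; apply: ereal_sup_ubound.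
  by exists x => //; rewrite /= in_itv.
have h2 x y : a <= x <= b -> a <= y <= b -> cabs (phi x - phi y) <= A * `|x - y| `^ alpha.
  move=> xI yI; have [->|xy] := eqVneq x y.
    rewrite !subrr normr0 powR0 ?gt_eqF// mulr0 /cabs normr0//.
  have xy0 : 0 < `|x - y| `^ alpha by rewrite powR_gt0// normr_gt0 subr_eq0.
  rewrite -ler_pdivrMr// -lee_fin; apply: le_trans s2A; apply: ereal_sup_ubound.
  by exists (x, y) => //; split => //=; rewrite in_itv.
split.
- by move=> x xI; exact: le_trans (Re_le_cabs _) (h1 x xI).
- by move=> x xI; exact: le_trans (Im_le_cabs _) (h1 x xI).
- by move=> x y xI yI; rewrite /re -raddfB (le_trans (Re_le_cabs _))// h2.
- by move=> x y xI yI; rewrite /im -raddfB (le_trans (Im_le_cabs _))// h2.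
Qed.

Lemma holder_bnd phi : holder I alpha phi -> exists A,
  [/\ Bd (re phi) A, Bd (im phi) A, Hd (re phi) A & Hd (im phi) A].
Proof.
rewrite /holder; have := holder_norm_ge0 phi.
case E : (holder_norm _ _ _) => [A| |] // _ _; exists A.
by apply: holder_norm_bnd; rewrite E.
Qed.

Lemma holder_of_bnd phi A B : Bd (re phi) A -> Bd (im phi) A ->
  Hd (re phi) B -> Hd (im phi) B -> holder I alpha phi.
Proof.
by move=> r1 i1 r2 i2; apply: le_lt_trans (holder_norm_le r1 i1 r2 i2) (ltry _).
Qed.

Definition cplx (L : (R -> R) -> R -> R) phi x : R[i] :=
  Complex (L (re phi) x) (L (im phi) x).

Lemma iter_cplx n L : iter n (cplx L) = cplx (iter n L).
Proof.
elim: n => [|n IH] /=.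
  by apply/funext => phi; apply/funext => x; rewrite /cplx /= /re /im; case: (phi x).
by apply/funext => phi /=; rewrite -[in LHS]/(cplx L (iter n (cplx L) phi)) IH.
Qed.

Definition Llin (L : (R -> R) -> R -> R) := forall k u v A B, Hd u A -> Hd v B ->
  forall x, a <= x <= b -> L (fun y => k * u y + v y) x = k * L u x + L v x.

Definition Lbnd (L : (R -> R) -> R -> R) (C : R) := forall u A B, Hd u A -> Bd u B ->
  Bd (L u) B /\ Hd (L u) (C * (A + B)).

Lemma cplx_linear L C : Llin L -> Lbnd L C -> holder_linear I alpha (cplx L).
Proof.
move=> ll lb; split=> [phi /holder_bnd[A [r1 i1 r2 i2]]|].
  have [r1' r2'] := lb _ _ _ r2 r1; have [i1' i2'] := lb _ _ _ i2 i1.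
  exact: (@holder_of_bnd (cplx L phi) A (C * (A + A))).
move=> c phi psi /holder_bnd[A [_ _ r2 i2]] /holder_bnd[B [_ _ s2 t2]] x.
rewrite /= in_itv /= => xI; case: c => c e; rewrite /cplx.
have -> : re (fun y => (c +i* e)%C * phi y + psi y) =
    (fun y => c * re phi y + (- e * im phi y + re psi y)).
  by apply/funext => y; rewrite /re /im; case: (phi y) (psi y) => ? ? [? ?] /=; ring.
have -> : im (fun y => (c +i* e)%C * phi y + psi y) =
    (fun y => c * im phi y + (e * re phi y + im psi y)).
  by apply/funext => y; rewrite /re /im; case: (phi y) (psi y) => ? ? [? ?] /=; ring.
rewrite (ll c _ _ _ _ r2 (Hd_lin (- e) i2 s2) x xI) (ll _ _ _ _ _ i2 s2 x xI).
rewrite (ll c _ _ _ _ i2 (Hd_lin e r2 t2) x xI) (ll _ _ _ _ _ r2 t2 x xI).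
apply/eqP; rewrite eq_complex /=; apply/andP; split; apply/eqP; ring.
Qed.

Lemma op_norm_le Q A :
  (forall phi, (holder_norm I alpha phi <= 1)%E -> (holder_norm I alpha (Q phi) <= A%:E)%E) ->
  (op_norm I alpha Q <= A%:E)%E.
Proof. by move=> H; apply: ge_ereal_sup => _ [phi /= h <-]; exact: H. Qed.

(** * Approximation by finite rank operators *)

Section QuasiCompact.
Variables (K rho : R).
Hypotheses (K0 : 0 <= K) (rho0 : 0 <= rho) (rho1 : rho < 1).
Hypothesis iterHd : forall n u A B, Hd u A -> Bd u B ->
  Bd (iter n PR u) B /\ Hd (iter n PR u) (K * (rho ^+ n * A + B)).

Lemma iterPR_bnd n : Lbnd (iter n PR) K.
Proof.
move=> u A B H HB; have [h1 h2] := iterHd n H HB; split => // x y xI yI.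
apply: (le_trans (h2 x y xI yI)); rewrite ler_wpM2r ?powR_ge0// ler_wpM2l// lerD2r.
by rewrite ler_piMl ?(Hd_ge0 H)// exprn_ile1// ltW.
Qed.

Lemma iterPR_lin n : Llin (iter n PR).
Proof.
elim: n => [//|n IH] k u v A B hu hv x xI /=.
have [Cu bu] := Hd_Bd hu; have [Cv bv] := Hd_Bd hv.
have [_ hu'] := iterPR_bnd n hu bu; have [_ hv'] := iterPR_bnd n hv bv.
by rewrite -(PR_lin k hu' hv' xI); apply: PR_eq => // y yI; exact: IH hu hv y yI.
Qed.

Lemma iterPR_diff n u v Au Av A B : Hd u Au -> Hd v Av ->
  Hd (fun x => - 1 * v x + u x) A -> Bd (fun x => - 1 * v x + u x) B ->
  Bd (fun x => iter n PR u x - iter n PR v x) B /\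
  Hd (fun x => iter n PR u x - iter n PR v x) (K * (rho ^+ n * A + B)).
Proof.
move=> hu hv h1 h2; have [b1 b2] := iterHd n h1 h2.
have E x : a <= x <= b ->
    iter n PR u x - iter n PR v x = iter n PR (fun x => - 1 * v x + u x) x.
  by move=> xI; rewrite (iterPR_lin n (- 1) hv hu xI) mulN1r addrC.
split=> [x xI|x y xI yI]; first by rewrite E// b1.
by rewrite !E// b2.
Qed.

Variable l : nat.

Let nd := node a b l.
Let itp := interp a b l.

Lemma interp_Hd u A : Hd u A -> Hd (itp (u \o nd)) (3 * A).
Proof.
move=> H x y xI yI; apply: interp_hold => //; first exact: Hd_ge0 H.
by move=> i j il jl; apply: H; exact: node_itv.
Qed.

Lemma interp_Bd u B : Bd u B -> Bd (itp (u \o nd)) B.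
Proof. by move=> H x xI; apply: interp_bnd => // i il; apply: H; exact: node_itv. Qed.

Definition finrank n := cplx (fun u => iter n PR (itp (u \o nd))).

Lemma finrank_linear n : holder_linear I alpha (finrank n).
Proof.
apply: (@cplx_linear _ (3 * K)).
  move=> k u v A B hu hv x xI.
  rewrite -(iterPR_lin n k (interp_Hd hu) (interp_Hd hv) xI); congr (iter n PR _ x).
  by apply/funext => y; rewrite /itp -interp_lin.
move=> u A B hu hB; have [h1 h2] := iterPR_bnd n (interp_Hd hu) (interp_Bd hB).
split => // x y xI yI; apply: (le_trans (h2 x y xI yI)).
rewrite ler_wpM2r ?powR_ge0// [3 * K]mulrC -mulrA ler_wpM2l// mulrDr lerD2l.
by have := Bd_ge0 hB; lra.
Qed.

(** The image of [u] depends only on its values at [l.+2] nodes. A subsequence makes these converge,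
    and by [interp_small] the interpolants then converge in the Hoelder norm. *)
Lemma finrank_compact n : compact_operator I alpha (finrank n).
Proof.
split=> [|u u1]; first exact: finrank_linear.
have ub k := holder_norm_bnd (u1 k).
have [s1 [c1 [hs1 cs1]]] := @bolzano_weierstrass_fin R l.+2
  (fun k i => re (u k) (nd i)) (fun k i il => let: And4 h _ _ _ := ub k in
     h _ (@node_itv R a b l ab i il)).
have [s2 [c2 [hs2 cs2]]] := @bolzano_weierstrass_fin R l.+2
  (fun k i => im (u (s1 k)) (nd i)) (fun k i il => let: And4 _ h _ _ := ub (s1 k) in
     h _ (@node_itv R a b l ab i il)).
pose s := s1 \o s2.
have {}cs1 i : (i < l.+2)%N -> re (u (s k)) (nd i) @[k --> \oo] --> c1 i.
  by move=> il; exact: (cvg_subseq hs2 (cs1 i il)).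
pose eps k := \sum_(i < l.+2) `|re (u (s k)) (nd i) - c1 i| +
  \sum_(i < l.+2) `|im (u (s k)) (nd i) - c2 i|.
have eps0 k : 0 <= eps k by rewrite addr_ge0// sumr_ge0.
have eps_cvg : eps @ \oo --> (0 : R).
  rewrite -[X in _ --> X](addr0 (0 : R)); apply: cvgD.
    exact: (@cvg_sum_dist _ _ (fun k i => re (u (s k)) (nd i)) _ cs1).
  exact: (@cvg_sum_dist _ _ (fun k i => im (u (s k)) (nd i)) _ cs2).
have le_sum (F : nat -> R) i : (forall j, 0 <= F j) -> (i <= l.+1)%N ->
    F i <= \sum_(j < l.+2) F j.
  by move=> F0 il; rewrite (bigD1 (Ordinal (il : (i < l.+2)%N)))//= lerDl sumr_ge0.
have eps1 k i : (i <= l.+1)%N -> `|re (u (s k)) (nd i) - c1 i| <= eps k.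
  move=> il; rewrite (le_trans (le_sum (fun i => `|re (u (s k)) (nd i) - c1 i|) i _ il))//.
  by rewrite lerDl sumr_ge0.
have eps2 k i : (i <= l.+1)%N -> `|im (u (s k)) (nd i) - c2 i| <= eps k.
  move=> il; rewrite (le_trans (le_sum (fun i => `|im (u (s k)) (nd i) - c2 i|) i _ il))//.
  by rewrite lerDr sumr_ge0.
pose m := mesh a b l `^ alpha.
have m0 : 0 < m by rewrite powR_gt0// mesh_gt0.
have cHd c : exists A, Hd (itp c) A.
  pose e := \sum_(i < l.+2) `|c i|.
  exists (6 * e / m); apply: interp_small => //; first exact: sumr_ge0.
  by move=> i il; apply: (le_sum (fun i => `|c i|)).
have [A1 hA1] := cHd c1; have [A2 hA2] := cHd c2.
pose psi x := Complex (iter n PR (itp c1) x) (iter n PR (itp c2) x).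
have diff v c e A A' : 0 <= e -> Hd v A -> Hd (itp c) A' ->
    (forall i, (i <= l.+1)%N -> `|v (nd i) - c i| <= e) ->
    Bd (fun x => iter n PR (itp (v \o nd)) x - iter n PR (itp c) x) e /\
    Hd (fun x => iter n PR (itp (v \o nd)) x - iter n PR (itp c) x)
      (K * (rho ^+ n * (6 * e / m) + e)).
  move=> e0 hv hc vc; apply: (iterPR_diff n (interp_Hd hv) hc).
    move=> x y xI yI; rewrite -!interp_lin; apply: interp_small => // i il.
    by rewrite mulN1r addrC; exact: vc.
  move=> x xI; rewrite -interp_lin; apply: interp_bnd => // i il.
  by rewrite mulN1r addrC; exact: vc.
exists s, psi; split.
- by move=> i j ij; apply: hs1; exact: hs2.
- have [B1 hB1] := Hd_Bd hA1; have [B2 hB2] := Hd_Bd hA2.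
  have [r1 r2] := iterPR_bnd n hA1 hB1; have [i1 i2] := iterPR_bnd n hA2 hB2.
  apply: (@holder_of_bnd psi (B1 + B2) (K * (A1 + B1) + K * (A2 + B2))).
  + by move=> x xI; rewrite (le_trans (r1 x xI))// lerDl (Bd_ge0 hB2).
  + by move=> x xI; rewrite (le_trans (i1 x xI))// lerDr (Bd_ge0 hB1).
  + move=> x y xI yI; rewrite (le_trans (r2 x y xI yI))// ler_wpM2r ?powR_ge0// lerDl.
    by rewrite mulr_ge0// addr_ge0 ?(Bd_ge0 hB2) ?(Hd_ge0 hA2).
  + move=> x y xI yI; rewrite (le_trans (i2 x y xI yI))// ler_wpM2r ?powR_ge0// lerDr.
    by rewrite mulr_ge0// addr_ge0 ?(Bd_ge0 hB1) ?(Hd_ge0 hA1).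
pose C := 2 * (1 + K * (rho ^+ n * (6 / m) + 1)).
apply: (@squeeze_cvge _ _ _ _ (cst 0%E) _ (fun k => (C * eps k)%:E)).
- apply: nearW => k; rewrite holder_norm_ge0 /=.
  have [r1 i1 r2 i2] := ub (s k).
  have [d1 d2] := diff _ _ _ _ _ (eps0 k) r2 hA1 (eps1 k).
  have [d3 d4] := diff _ _ _ _ _ (eps0 k) i2 hA2 (eps2 k).
  rewrite (_ : C * eps k = 2 * (eps k + K * (rho ^+ n * (6 * eps k / m) + eps k))).
    by apply: holder_norm_le.
  by rewrite /C; ring.
- exact: cvg_cst.
- by apply: cvg_EFin; [exact: nearW|rewrite -(mulr0 C); exact: cvgMr].
Qed.

(** Interpolation triples the Hoelder constant, so the error has constant at most [3 + 1]; this part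
    is damped by [rho ^+ n]. Its sup part is not damped, but is small with the mesh. *)
Lemma finrank_near n phi : (holder_norm I alpha phi <= 1)%E ->
  (holder_norm I alpha (fun x => (iter n (koopman P f) phi x - finrank n phi x)%R) <=
   (2 * (mesh a b l `^ alpha + K * (rho ^+ n * 4 + mesh a b l `^ alpha)))%:E)%E.
Proof.
move=> /holder_norm_bnd[r1 i1 r2 i2].
have D u : Hd u 1 -> Hd (fun x => - 1 * itp (u \o nd) x + u x) 4 /\
    Bd (fun x => - 1 * itp (u \o nd) x + u x) (mesh a b l `^ alpha).
  move=> hu; split.
    rewrite (_ : 4 = `|- 1 : R| * (3 * 1) + 1); last by rewrite normrN1; ring.
    by apply: Hd_lin => //; exact: interp_Hd.
  move=> x xI; rewrite mulN1r addrC -[leRHS]mul1r; exact: interp_err.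
have -> : iter n (koopman P f) = cplx (iter n PR) by rewrite -iter_cplx.
have [a1 a2] := D _ r2; have [a3 a4] := D _ i2.
have [d1 d2] := iterPR_diff n r2 (interp_Hd r2) a1 a2.
have [d3 d4] := iterPR_diff n i2 (interp_Hd i2) a3 a4.
exact: holder_norm_le.
Qed.

End QuasiCompact.

Lemma koopman_quasi_compact K rho : 0 <= K -> 0 <= rho -> rho < 1 ->
  (forall n u A B, Hd u A -> Bd u B ->
    Bd (iter n PR u) B /\ Hd (iter n PR u) (K * (rho ^+ n * A + B))) ->
  quasi_compact I alpha (koopman P f).
Proof.
move=> K0 rho0 rho1 H.
have lb := iterPR_bnd K0 rho0 rho1 H 1; have ll := iterPR_lin K0 rho0 rho1 H 1.
split; first exact: (cplx_linear ll lb).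
- apply: (@le_lt_trans _ _ (2 * (1 + K * (1 + 1)))%:E); last exact: ltry.
  apply: op_norm_le => phi /holder_norm_bnd[r1 i1 r2 i2].
  have [? ?] := lb _ _ _ r2 r1; have [? ?] := lb _ _ _ i2 i1.
  exact: (@holder_norm_le (cplx PR phi)).
have K1 : 0 < K + 1 by lra.
(* With 1/32 here and 1/8 for the mesh below, the bound of [finrank_near] is at most
   [2 * (1/8 + 1/8)]. *)
have [n nK] : exists n, rho ^+ n.+1 < (K + 1)^-1 / 32.
  have : rho ^+ n @[n --> \oo] --> (0 : R) by apply: cvg_expr; rewrite ger0_norm.
  have e0 : 0 < (K + 1)^-1 / 32 by rewrite divr_gt0 ?invr_gt0.
  move=> /cvgrPdist_lt /(_ _ e0) [n _ Hn]; exists n.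
  have := Hn n.+1 (leqnSn n); rewrite /= sub0r normrN; apply: le_lt_trans; exact: ler_norm.
have [l lm] : exists l, mesh a b l `^ alpha <= (K + 1)^-1 / 8.
  pose e := (K + 1)^-1 / 8; have e0 : 0 < e by rewrite divr_gt0 ?invr_gt0.
  have s0 : 0 < e `^ alpha^-1 by exact: powR_gt0.
  exists (Num.truncn ((b - a) / e `^ alpha^-1)).
  rewrite -/e [leRHS](_ : _ = (e `^ alpha^-1) `^ alpha); last first.
    by rewrite -powRrM mulVf ?gt_eqF// powRr1// ltW.
  apply: (ge0_ler_powR (ltW al0)); rewrite ?nnegrE ?(ltW s0) ?(ltW (mesh_gt0 _ ab))//.
  rewrite /mesh ler_pdivrMr ?ltr0n// mulrC -ler_pdivrMr//.
  have t0 : 0 <= (b - a) / e `^ alpha^-1 by rewrite divr_ge0 ?subr_ge0// ltW.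
  by have /andP[_ /ltW] := Num.Theory.truncn_itv t0.
exists n.+1, (finrank l n.+1); split => //.
  exact: (finrank_compact K0 rho0 rho1 H).
apply: (@le_lt_trans _ _ (1 / 2)%:E); last by rewrite lte_fin; lra.
apply: op_norm_le => phi h; apply: (le_trans (finrank_near K0 rho0 rho1 H l n.+1 h)).
rewrite lee_fin; set m := mesh a b l `^ alpha in lm *.
have h1 : (K + 1) * rho ^+ n.+1 <= 1 / 32.
  by rewrite mulrC -ler_pdivlMr// mulrAC mul1r ltW.
have h2 : (K + 1) * m <= 1 / 8.
  by rewrite mulrC -ler_pdivlMr// mulrAC mul1r.
have h3 : 0 <= rho ^+ n.+1 by exact: exprn_ge0.
nra.
Qed.

End LasotaYorke.

Lemma holder_quasi_compact (beta : R) : 0 < beta ->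
  (\int[P]_w (sup_norm_on I (derivative_on I (f (w 0%N)))) `^ beta < +oo)%E ->
  exists2 alpha0 : R, 0 < alpha0 & forall alpha, 0 < alpha < alpha0 ->
    alpha <= 1 /\ quasi_compact I alpha (koopman P f).
Proof.
move=> beta0 f_mom.
have [h [M [c [al0 [r [ch hM c0 [a0 a1 ac r0] H]]]]]] := moment_contraction beta0 f_mom.
exists al0 => // alpha /andP[alpha0 alpha_lt].
have alpha1 : alpha <= 1 by rewrite (le_trans (ltW alpha_lt)).
have alc : alpha * c <= 1 by rewrite (le_trans _ ac)// ler_wpM2r ?ltW.
split=> //.
have [K [K0 HK]] := PR_iterHd alpha0 hM c0 alc r0
  (fun x y xI yI xy => H alpha x y alpha0 alpha_lt xI yI xy).
apply: (koopman_quasi_compact alpha0 alpha1 K0 _ _ HK); first by rewrite subr_ge0.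
by rewrite ltrBlDr ltrDl mulr_gt0.
Qed.

(** * Spectral gap *)

Section SpectralGap.
Variable alpha : R.
Hypothesis al0 : 0 < alpha.
Implicit Types u v : R -> R.

Lemma ae_ex (Q : path_space T -> Prop) : {ae P, forall w : path_space T, Q w} -> exists w, Q w.
Proof.
move=> [Z [mZ PZ QZ]]; apply: contrapT => /forallNP nQ.
have ZT : Z = setT by apply/seteqP; split => // w _; apply: QZ; exact: nQ.
by move: PZ; rewrite ZT probability_setT => /eqP; rewrite onee_eq0.
Qed.

Lemma ae_max g A m x : Hd alpha g A -> (forall y, a <= y <= b -> g y <= m) ->
  a <= x <= b -> PR g x = m -> {ae P, forall w : path_space T, g (f (w 0%N) x) = m}.
Proof.
move=> hg gm xI Em; have [ig _] := intg_uf al0 hg xI.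
have : {ae P, forall w : path_space T, m - g (f (w 0%N) x) = 0}.
  apply: E_eq0_ae; first by apply: intgB => //; exact: intg_cst.
    by move=> w; rewrite subr_ge0 gm// f_itv.
  by rewrite E_B ?E_cst//; [rewrite -[X in _ - X]/(PR g x) Em subrr|exact: intg_cst].
by apply: filterS => w /eqP; rewrite subr_eq0 => /eqP.
Qed.

Lemma grid_near x e : a <= x <= b -> 0 < e -> exists n, `|x - grid n| < e.
Proof.
move=> xI e0; apply: contrapT => /forallNP H.
have cu : continuous ((fun y => - `|x - y|) \o clamp a b).
  move=> y; apply: cvgN; apply: cvg_norm; apply: cvgB; first exact: cvg_cst.
  exact: clamp_cont.
have := grid_dense (B := - e) cu _ xI; rewrite subrr normr0 oppr0 => h.
have : 0 <= - e by apply: h => n; rewrite lerN2 leNgt; apply/negP; exact: H.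
lra.
Qed.

(** The exceptional set in the hypothesis depends on [x], and [E] may be uncountable. One null set
    serves a countable dense subset of [E], and continuity does the rest. *)
Lemma ae_uniform u v A B (E : set R) : Hd alpha u A -> Hd alpha v B ->
  (forall x, E x -> a <= x <= b) ->
  (forall x, E x -> {ae P, forall w : path_space T, u (f (w 0%N) x) = v x}) ->
  {ae P, forall w : path_space T, forall x, E x -> u (f (w 0%N) x) = v x}.
Proof.
move=> hu hv EI H.
pose near n k := [set x | E x /\ `|x - grid n| < k.+1%:R^-1].
(* If [E] has no point near [grid n], the default [a] appears; the guard [E (pt n k)] below covers
   that case. *)
pose pt n k := xget a (near n k).
have : {ae P, forall (w : path_space T) n k, E (pt n k) -> u (f (w 0%N) (pt n k)) = v (pt n k)}.
  have Hp n k : {ae P, forall w : path_space T, E (pt n k) -> u (f (w 0%N) (pt n k)) = v (pt n k)}.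
    have [Ep|nE] := pselect (E (pt n k)); last by apply: aeW => w.
    by have := H _ Ep; apply: filterS => w h _; exact: h.
  by apply: ae_foralln => n; apply: ae_foralln => k; exact: Hp.
apply: filterS2 notN_ae => w nN Hw x Ex; have xI := EI x Ex.
pose F y := (u \o clamp a b) (G w y) - (v \o clamp a b) y.
have cF : continuous F.
  move=> y; apply: cvgB; last exact: (Hd_cont al0 hv).
  by apply: (continuous_comp (G_cont (w := w) (x := y))); exact: (Hd_cont al0 hu).
have FE y : a <= y <= b -> F y = u (f (w 0%N) y) - v y.
  by move=> yI; rewrite /F /= !clamp_id ?G_range// G_f.
apply/eqP; rewrite -subr_eq0 -FE//; apply/negP => /negP Fx0.
have e0 : 0 < `|F x| by rewrite normr_gt0.
have /cvgrPdist_lt /(_ _ e0) := cF x.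
move=> /nbhs_ballP[r /= r0 Hr].
have r20 : 0 < r / 2 by rewrite divr_gt0.
have [k kr] : exists k, k.+1%:R^-1 < r / 2 :> R.
  exists (Num.truncn (r / 2)^-1); rewrite invf_plt ?posrE ?ltr0n//.
  have ri : 0 <= (r / 2)^-1 by rewrite invr_ge0 ltW.
  by have /andP[_] := Num.Theory.truncn_itv ri.
have k0 : 0 < k.+1%:R^-1 :> R by rewrite invr_gt0 ltr0n.
have [n nx] := grid_near xI k0.
have [Ep pn] : near n k (pt n k) by apply: (xgetI a (x := x)); split.
suff xr : `|x - pt n k| < r.
  by have := Hr (pt n k) xr; rewrite /= (FE (pt n k)) ?EI// Hw// subrr subr0 ltxx.
rewrite -(subrK (grid n) x) -addrA (le_lt_trans (ler_normD _ _))//.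
by rewrite [ltRHS](splitr r) ltrD// ?(lt_trans nx)// distrC (lt_trans pn).
Qed.

Lemma Hd_cst m : Hd alpha (fun=> m) 0.
Proof. by move=> x y _ _; rewrite subrr normr0 mul0r. Qed.

Lemma harmonic_max_ae u A m : Hd alpha u A ->
  (forall x, a <= x <= b -> PR u x = u x) -> (forall x, a <= x <= b -> u x <= m) ->
  {ae P, forall w : path_space T, forall x, a <= x <= b -> u x = m -> u (f (w 0%N) x) = m}.
Proof.
move=> hu Eu um.
have := @ae_uniform u (fun=> m) A 0 [set x | a <= x <= b /\ u x = m] hu (Hd_cst m).
move=> /(_ (fun x h => h.1)) H; have {}H := H (fun x h => ae_max hu um h.1 (etrans (Eu x h.1) h.2)).
by apply: filterS H => w Hw x xI ux; exact: Hw.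
Qed.

(** * Eigenfunctions on their set of maximal modulus *)

Section Eigenfunction.
Variables (u v : R -> R) (A l1 l2 m : R).
Hypotheses (hu : Hd alpha u A) (hv : Hd alpha v A).
Hypothesis unit_l : l1 ^+ 2 + l2 ^+ 2 = 1.
Hypothesis eig_u : forall x, a <= x <= b -> PR u x = l1 * u x - l2 * v x.
Hypothesis eig_v : forall x, a <= x <= b -> PR v x = l1 * v x + l2 * u x.
Hypothesis max_m : forall x, a <= x <= b -> u x ^+ 2 + v x ^+ 2 <= m.

Definition top : set R := [set x | a <= x <= b /\ u x ^+ 2 + v x ^+ 2 = m].

Definition rotates (t : T) := forall x, top x ->
  [/\ top (f t x), u (f t x) = l1 * u x - l2 * v x & v (f t x) = l1 * v x + l2 * u x].

(** The linear function [s * u + t * v] is at most [m] everywhere, and the eigenvalue equation gives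
    it mean [m] at the images of [x]. So it equals [m] a.s., and equality forces [(u, v)] to be
    [(s, t)] there. The summands 0 only give it the shape of [Hd_lin]. *)
Lemma top_ae x : top x -> {ae P, forall w : path_space T,
  u (f (w 0%N) x) = l1 * u x - l2 * v x /\ v (f (w 0%N) x) = l1 * v x + l2 * u x}.
Proof.
move=> [xI xm]; pose s := l1 * u x - l2 * v x; pose t := l1 * v x + l2 * u x.
have st : s ^+ 2 + t ^+ 2 = m.
  rewrite -xm -[RHS]mul1r -unit_l /s /t; ring.
have hg := Hd_lin s hu (Hd_lin t hv (Hd_cst 0)).
have gm y : a <= y <= b -> s * u y + (t * v y + 0) <= m.
  move=> yI; have := max_m yI; have := sqr_ge0 (s - u y); have := sqr_ge0 (t - v y).
  by rewrite !sqrrB; nra.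
have [iu _] := intg_uf al0 hu xI; have [iv _] := intg_uf al0 hv xI.
have Em : PR (fun y => s * u y + (t * v y + 0)) x = m.
  rewrite (PR_lin al0 _ hu (Hd_lin t hv (Hd_cst 0)) xI).
  rewrite (PR_lin al0 _ hv (Hd_cst 0) xI) eig_u// eig_v// /PR E_cst -/s -/t.
  by rewrite addr0 -!expr2.
have := ae_max hg gm xI Em; apply: filterS => w /= h.
apply: (cauchy_schwarz_eq st (max_m (f_itv (w 0%N) xI))).
by rewrite addr0 in h.
Qed.

Lemma rotates_ae : {ae P, forall w : path_space T, rotates (w 0%N)}.
Proof.
have H1 := @ae_uniform u (fun x => l1 * u x + (- l2 * v x + 0)) _ _ top hu
  (Hd_lin l1 hu (Hd_lin (- l2) hv (Hd_cst 0))) (fun x h => h.1).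
have H2 := @ae_uniform v (fun x => l1 * v x + (l2 * u x + 0)) _ _ top hv
  (Hd_lin l1 hv (Hd_lin l2 hu (Hd_cst 0))) (fun x h => h.1).
have {}H1 : {ae P, forall w : path_space T, forall x, top x ->
    u (f (w 0%N) x) = l1 * u x + (- l2 * v x + 0)}.
  by apply: H1 => x /top_ae; apply: filterS => w []; rewrite addr0 mulNr.
have {}H2 : {ae P, forall w : path_space T, forall x, top x ->
    v (f (w 0%N) x) = l1 * v x + (l2 * u x + 0)}.
  by apply: H2 => x /top_ae; apply: filterS => w []; rewrite addr0.
apply: filterS2 H1 H2 => w h1 h2 x tx; have := h1 x tx; have := h2 x tx.
rewrite !addr0 mulNr => e2 e1; split => //; split; first by apply: f_itv; case: tx.
by rewrite e1 e2; have [_ <-] := tx; rewrite -[RHS]mul1r -unit_l; ring.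
Qed.

Lemma rotation_trivial x : top x -> 0 < m ->
  u x = l1 * u x - l2 * v x -> v x = l1 * v x + l2 * u x -> l1 = 1 /\ l2 = 0.
Proof.
move=> [_ xm] m0 e1 e2; have : (1 - l1) * m = 0.
  have : u x * (u x - (l1 * u x - l2 * v x)) + v x * (v x - (l1 * v x + l2 * u x)) = 0.
    by rewrite -e1 -e2 !subrr !mulr0 addr0.
  by move=> <-; rewrite -xm; ring.
move=> /eqP; rewrite mulf_eq0 (gt_eqF m0) orbF subr_eq0 => /eqP l11.
split=> //; move: unit_l; rewrite -l11 expr1n => /eqP.
by rewrite -subr_eq0 addrAC subrr add0r sqrf_eq0 => /eqP.
Qed.

End Eigenfunction.

Lemma closed_level (F : R -> R) c : continuous F ->
  closed [set x | a <= x <= b /\ F x = c].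
Proof.
move=> cF; rewrite (_ : mkset _ = I `&` F @^-1` [set x | x = c]).
  apply: closedI; first exact: interval_closed.
  by apply: (continuous_closedP F).1; [exact: cF|exact: closed_eq].
by apply/seteqP; split => x; rewrite /= in_itv.
Qed.

Lemma clampC_cont u A c : Hd alpha u A -> continuous (fun x => (u (clamp a b x) - c) ^+ 2).
Proof.
move=> hu x; rewrite /= (_ : (fun x => _) = (fun x => (u (clamp a b x) - c) * (u (clamp a b x) - c))).
  have h : u (clamp a b y) - c @[y --> x] --> u (clamp a b x) - c.
    by apply: cvgB; [exact: (Hd_cont al0 hu)|exact: cvg_cst].
  exact: (cvgM h h).
by apply/funext => y; rewrite expr2.
Qed.

Lemma closed_level2 u v A B c1 c2 m : Hd alpha u A -> Hd alpha v B ->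
  closed [set x | a <= x <= b /\ (u x - c1) ^+ 2 + (v x - c2) ^+ 2 = m].
Proof.
move=> hu hv; rewrite (_ : mkset _ = [set x | a <= x <= b /\
  (u (clamp a b x) - c1) ^+ 2 + (v (clamp a b x) - c2) ^+ 2 = m]).
  have h1 := clampC_cont hu (c := c1); have h2 := clampC_cont hv (c := c2).
  by apply: closed_level => x; exact: (cvgD (h1 x) (h2 x)).
by apply/seteqP; split => x /= [xI]; rewrite clamp_id.
Qed.

Lemma fixed_point w : exists2 c, a <= c <= b & G w c = c.
Proof.
have cF : {within `[a, b], continuous (fun x => G w x - x)}.
  apply: continuous_subspaceT => x; apply: cvgB; last exact: cvg_id.
  exact: G_cont.
have [|c] := IVT (ltW ab) cF (v := 0).
  have /andP[h1 _] := G_range w a; have /andP[_ h2] := G_range w b.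
  by rewrite ge_min le_max !subr_le0 !subr_ge0 h1 h2 !orbT.
by rewrite in_itv /= => cI /eqP; rewrite subr_eq0 => /eqP; exists c.
Qed.

Lemma limn_einf0_small (s : nat -> R) e : limn_einf (fun n => (s n)%:E) = 0%E ->
  0 < e -> exists n, s n < e.
Proof.
move=> s0 e0; apply: contrapT => /forallNP H.
have : (e%:E <= limn_einf (fun n => (s n)%:E))%E.
  rewrite limn_einf_lim; apply: lime_ge; first exact: is_cvg_einfs.
  apply: nearW => n; apply: le_ereal_inf_tmp => _ [k _ <-].
  by rewrite lee_fin leNgt; apply/negP; exact: H.
by rewrite s0 lee_fin leNgt e0.
Qed.

Lemma cocycle_itv n w x : a <= x <= b -> a <= cocycle f n w x <= b.
Proof.
by move=> xI; elim: n => [//|n IH] /=; exact: f_itv.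
Qed.

Section Proximal.
Variable p : probability T R.
Hypotheses (pP : is_product_measure p P) (prox : proximal p I f).

(** Proximality in a form fit for invariants: a lower bound on the difference of the Hoelder
    functions that persists along the whole orbit cannot be positive. Every symbol of [w] can be
    taken good, because bad symbols are [p]-negligible. *)
Lemma proximal_close (Good : T -> Prop) u v A B x y :
  {ae P, forall w : path_space T, Good (w 0%N)} -> Hd alpha u A -> Hd alpha v B ->
  a <= x <= b -> a <= y <= b -> exists2 w : path_space T, (forall i, Good (w i)) &
  forall k, (forall n, k <= `|u (cocycle f n w x) - u (cocycle f n w y)|
    + `|v (cocycle f n w x) - v (cocycle f n w y)|) -> k <= 0.
Proof.
move=> Gae hu hv xI yI.
have nB : p.-negligible [set t | ~ Good t] by exact: (negligible_coord0 pP Gae).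
have xI' : I x by rewrite /= in_itv.
have yI' : I y by rewrite /= in_itv.
have [w wG w0] := prox xI' yI' nB; exists w; first by move=> i; apply: contrapT; exact: wG.
move=> k Hk; rewrite leNgt; apply/negP => k0.
have A0 := Hd_ge0 hu; have B0 := Hd_ge0 hv; have A1 : 0 < A + B + 1 by lra.
have e0 : 0 < (k / (A + B + 1)) `^ alpha^-1 by rewrite powR_gt0// divr_gt0.
have [n nk] := limn_einf0_small w0 e0.
have hun := hu _ _ (cocycle_itv n w xI) (cocycle_itv n w yI).
have hvn := hv _ _ (cocycle_itv n w xI) (cocycle_itv n w yI).
have h2 : `|cocycle f n w x - cocycle f n w y| `^ alpha < k / (A + B + 1).
  rewrite [ltRHS](_ : _ = ((k / (A + B + 1)) `^ alpha^-1) `^ alpha).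
    by apply: gt0_ltr_powR => //; rewrite nnegrE// ltW.
  by rewrite -powRrM mulVf ?gt_eqF// powRr1// ltW// divr_gt0.
rewrite ltr_pdivlMr// in h2.
have := powR_ge0 `|cocycle f n w x - cocycle f n w y| alpha.
have := Hk n; move: hun hvn h2; move: (_ `^ alpha) => t; lra.
Qed.

(** The sets where [u] is maximal and minimal are both preserved. Orbits started in them keep their
    two values while coming close, so maximum and minimum agree. *)
Lemma proximal_harmonic u A x y : Hd alpha u A ->
  (forall z, a <= z <= b -> PR u z = u z) -> a <= x <= b -> a <= y <= b -> u x <= u y.
Proof.
move=> hu Eu xI yI.
have within (g : R -> R) : continuous (g \o clamp a b) -> {within `[a, b], continuous (g \o clamp a b)}.
  by move=> cg; exact: continuous_subspaceT.
have [z1] := EVT_max (ltW ab) (within u (Hd_cont al0 hu)).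
rewrite in_itv => /= z1I Hz1.
have hNu := Hd_lin (- 1) hu (Hd_cst 0).
have [z2] := EVT_max (ltW ab) (within _ (Hd_cont al0 hNu)).
rewrite in_itv => /= z2I Hz2.
have um z : a <= z <= b -> u z <= u z1.
  by move=> zI; have := Hz1 z; rewrite in_itv => /(_ zI); rewrite !clamp_id.
have ul z : a <= z <= b -> - 1 * u z + 0 <= - 1 * u z2 + 0.
  by move=> zI; have := Hz2 z; rewrite in_itv => /(_ zI); rewrite !clamp_id.
have ENu z : a <= z <= b -> PR (fun y => - 1 * u y + 0) z = - 1 * u z + 0.
  by move=> zI; rewrite (PR_lin al0 _ hu (Hd_cst 0) zI) Eu// /PR E_cst.
have H1 := harmonic_max_ae hu Eu um; have H2 := harmonic_max_ae hNu ENu ul.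
pose Good (t : T) := (forall x, a <= x <= b -> u x = u z1 -> u (f t x) = u z1) /\
  (forall x, a <= x <= b -> u x = u z2 -> u (f t x) = u z2).
have Gae : {ae P, forall w : path_space T, Good (w 0%N)}.
  apply: filterS2 H1 H2 => w h1 h2; split => // z zI uz.
  by have := h2 z zI; rewrite uz => /(_ erefl); lra.
have [w wG H] := proximal_close (Good := Good) Gae hu (Hd_cst 0) z1I z2I.
have c1 n : u (cocycle f n w z1) = u z1.
  by elim: n => [//|n IH] /=; apply: (wG n).1 => //; exact: cocycle_itv.
have c2 n : u (cocycle f n w z2) = u z2.
  by elim: n => [//|n IH] /=; apply: (wG n).2 => //; exact: cocycle_itv.
have : u z1 - u z2 <= 0 by apply: H => n; rewrite c1 c2 subrr normr0 addr0 ler_norm.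
have := um x xI; have := ul y yI; lra.
Qed.

End Proximal.

Lemma quasi_symmetric_absurd : quasi_symmetric P I f -> False.
Proof.
move=> [S [[Sh _ _] Sae _ _]]; apply: f_noinv; exists a, b.
have aI : a <= a <= b by rewrite lexx ltW.
have bI : a <= b <= b by rewrite lexx ltW.
split; [by rewrite /= in_itv|by rewrite /= in_itv|].
apply: filterS2 notN_ae Sae => w nN /Sh[g [_ _ hI gK]].
have gd' := f_diffeo nN.
have gI x : a <= x <= b -> a <= g x <= b.
  by move=> xI; have := hI x; rewrite /= !in_itv /= => /(_ xI)[].
have fg x : a <= x <= b -> f (w 0%N) (g x) = x.
  by move=> xI; have := gK x; rewrite /= in_itv /= => /(_ xI)[].
have mono x y : a <= x -> x < y -> y <= b -> _ := diffeo_monotone ab gd'.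
have /andP[fa1 fa2] := f_itv (w 0%N) aI; have /andP[fb1 fb2] := f_itv (w 0%N) bI.
have /andP[ga1 ga2] := gI a aI; have /andP[gb1 gb2] := gI b bI.
have [lt|le] := ltP (f (w 0%N) b) (f (w 0%N) a).
  have fb : f (w 0%N) b = a.
    have [E|ne] := eqVneq (g a) b; first by rewrite -E fg.
    have : g a < b by rewrite lt_neqAle ne.
    by move=> h; have := mono _ _ ga1 h (lexx b); rewrite lt fg// ltNge fb1.
  have fa : f (w 0%N) a = b.
    have [E|ne] := eqVneq (g b) a; first by rewrite -E fg.
    have : a < g b by rewrite lt_neqAle eq_sym ne.
    by move=> h; have := mono _ _ (lexx a) h gb2; rewrite lt fg// ltNge fa2.
  apply/seteqP; split=> [_ [z [->|->] <-]|z [->|->]].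
  - by right; rewrite fa.
  - by left; rewrite fb.
  - by exists b; [right|].
  - by exists a; [left|].
have nlt : (f (w 0%N) b < f (w 0%N) a) = false by rewrite ltNge le.
have fa : f (w 0%N) a = a.
  have [E|ne] := eqVneq (g a) a; first by rewrite -{1}E fg.
  have : a < g a by rewrite lt_neqAle eq_sym ne.
  by move=> h; have := mono _ _ (lexx a) h ga2; rewrite nlt fg// ltNge fa1.
have fb : f (w 0%N) b = b.
  have [E|ne] := eqVneq (g b) b; first by rewrite -{1}E fg.
  have : g b < b by rewrite lt_neqAle ne.
  by move=> h; have := mono _ _ gb1 h (lexx b); rewrite nlt fg// ltNge fb2.
apply/seteqP; split=> [_ [z [->|->] <-]|z [->|->]].
- by left; rewrite fa.
- by right; rewrite fb.
- by exists a; [left|].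
- by exists b; [right|].
Qed.

Lemma top_closed u v A B m : Hd alpha u A -> Hd alpha v B -> closed (top u v m).
Proof.
move=> hu hv; rewrite (_ : top u v m =
    [set x | a <= x <= b /\ (u x - 0) ^+ 2 + (v x - 0) ^+ 2 = m]).
  exact: closed_level2 hu hv.
by apply/seteqP; split => x; rewrite /top /= !subr0.
Qed.

(** * Eigenvalues of modulus one *)

Section Eigenvalue.
Variables (u v : R -> R) (A l1 l2 m : R).
Hypotheses (hu : Hd alpha u A) (hv : Hd alpha v A).
Hypothesis unit_l : l1 ^+ 2 + l2 ^+ 2 = 1.
Hypothesis eig_u : forall x, a <= x <= b -> PR u x = l1 * u x - l2 * v x.
Hypothesis eig_v : forall x, a <= x <= b -> PR v x = l1 * v x + l2 * u x.
Hypothesis max_m : forall x, a <= x <= b -> u x ^+ 2 + v x ^+ 2 <= m.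
Hypothesis m0 : 0 < m.
Hypothesis top0 : top u v m !=set0.

Let rot := rotates_ae hu hv unit_l eig_u eig_v max_m.

Lemma minimal_eigenvalue : minimal P I f ->
  [/\ l1 = 1, l2 = 0 & forall x y, a <= x <= b -> a <= y <= b -> u x = u y /\ v x = v y].
Proof.
move=> fmin.
have topI : top u v m = I.
  apply: fmin => //; first exact: top_closed hu hv.
    by move=> x [xI _]; rewrite /= in_itv.
  by apply: filterS rot => w wr _ [x /wr[fx _ _] <-].
have inI x : a <= x <= b -> top u v m x by move=> xI; rewrite topI /= in_itv.
have [w [nN wr]] : exists w : path_space T, ~ N w /\ rotates u v l1 l2 m (w 0%N).
  by apply: ae_ex; apply: filterS2 notN_ae rot.
have [c cI Gc] := fixed_point w; rewrite (G_f nN cI) in Gc.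
have [_ e1 e2] := wr c (inI c cI); rewrite !Gc in e1 e2.
have [-> l20] := rotation_trivial unit_l (inI c cI) m0 e1 e2; rewrite l20.
have ll : l1 = 1 by have [] := rotation_trivial unit_l (inI c cI) m0 e1 e2.
(* With eigenvalue 1 every level set of the eigenfunction is preserved, so by minimality the one
   through [a] is the whole interval. *)
pose Y := [set x | a <= x <= b /\ (u x - u a) ^+ 2 + (v x - v a) ^+ 2 = 0].
have aI : a <= a <= b by rewrite lexx ltW.
have YI : Y = I.
  apply: fmin; first exact: closed_level2 hu hv.
  - by exists a; split => //; rewrite !subrr expr0n addr0.
  - by move=> x [xI _]; rewrite /= in_itv.
  - apply: filterS rot => w' wr' _ [x [xI Yx] <-]; have [_ u' v'] := wr' x (inI x xI).
    split; first exact: f_itv.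
    by rewrite u' v' ll l20 !mul1r !mul0r subr0 addr0.
have Ya x : a <= x <= b -> u x = u a /\ v x = v a.
  move=> xI; have : Y x by rewrite YI /= in_itv.
  move=> [_ /eqP]; rewrite paddr_eq0 ?sqr_ge0// !sqrf_eq0 !subr_eq0.
  by move=> /andP[/eqP ? /eqP ?].
by split=> // x y xI yI; have [-> ->] := Ya x xI; have [-> ->] := Ya y yI.
Qed.

(** Two orbits in the top set have their values rotated together, so the distance [D n] of the
    values is constant, hence zero. A point and its image then have the same value, which forces the
    eigenvalue to be 1; outside the top set constancy comes from [proximal_harmonic]. *)
Lemma proximal_eigenvalue (p : probability T R) : is_product_measure p P ->
  proximal p I f ->
  [/\ l1 = 1, l2 = 0 & forall x y, a <= x <= b -> a <= y <= b -> u x = u y /\ v x = v y].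
Proof.
move=> pP prox.
have const x y : top u v m x -> top u v m y -> u x = u y /\ v x = v y.
  move=> tx ty; have [xI _] := tx; have [yI _] := ty.
  have [w wr H] := proximal_close pP prox rot hu hv xI yI.
  pose D n := (u (cocycle f n w x) - u (cocycle f n w y)) ^+ 2 +
    (v (cocycle f n w x) - v (cocycle f n w y)) ^+ 2.
  have inv n : [/\ top u v m (cocycle f n w x), top u v m (cocycle f n w y) & D n = D 0%N].
    elim: n => [//|n [t1 t2 E]] /=.
    have [t1' e1 e2] := wr n _ t1; have [t2' e3 e4] := wr n _ t2; split => //.
    rewrite -E /D /= e1 e2 e3 e4 -[RHS]mul1r -unit_l; ring.
  have : Num.sqrt (D 0%N) <= 0.
    apply: H => n; have [_ _ <-] := inv n.
    have := cabs_le (Complex (u (cocycle f n w x) - u (cocycle f n w y))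
      (v (cocycle f n w x) - v (cocycle f n w y))).
    by rewrite cabsE.
  rewrite -sqrtr0 ler_sqrt// => D0.
  have /eqP : D 0%N = 0 by apply/eqP; rewrite eq_le D0 addr_ge0 ?sqr_ge0.
  rewrite /D /= paddr_eq0 ?sqr_ge0// !sqrf_eq0 !subr_eq0.
  by move=> /andP[/eqP ? /eqP ?].
have [x0 tx0] := top0; have [w wr] := ae_ex rot.
have [ty e1 e2] := wr x0 tx0; have [c1 c2] := const _ _ tx0 ty.
rewrite -c1 in e1; rewrite -c2 in e2.
have [ll l20] := rotation_trivial unit_l tx0 m0 e1 e2.
split => // x y xI yI.
have Eu z : a <= z <= b -> PR u z = u z by move=> zI; rewrite eig_u// ll l20 mul1r mul0r subr0.
have Ev z : a <= z <= b -> PR v z = v z by move=> zI; rewrite eig_v// ll l20 mul1r mul0r addr0.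
have h := proximal_harmonic pP prox.
by split; apply/eqP; rewrite eq_le; apply/andP; split; [exact: h hu Eu _ _|exact: h hu Eu _ _
  |exact: h hv Ev _ _|exact: h hv Ev _ _].
Qed.

End Eigenvalue.

Lemma koopman_spectral_gap (p : probability T R) : is_product_measure p P ->
  quasi_compact I alpha (koopman P f) ->
  proximal p I f \/ minimal P I f \/ quasi_symmetric P I f ->
  spectral_gap I alpha (koopman P f).
Proof.
move=> pP qc H; split=> // lambda phi /(holder_bnd al0)[A [_ _ hu hv]] [x0 x0I phi0] l1 Qphi.
set u := fun x => complex.Re (phi x) in hu; set v := fun x => complex.Im (phi x) in hv.
have unit_l : complex.Re lambda ^+ 2 + complex.Im lambda ^+ 2 = 1.
  have := add_Re2_Im2 lambda; rewrite l1 expr1n => /(congr1 (@complex.Re R)).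
  by [].
have eig x : a <= x <= b ->
    PR u x = complex.Re lambda * u x - complex.Im lambda * v x /\
    PR v x = complex.Re lambda * v x + complex.Im lambda * u x.
  move=> xI; have xI' : I x by rewrite /= in_itv.
  have := Qphi x xI'; rewrite /koopman -/(PR u x) -/(PR v x) /u /v.
  by case: (lambda) (phi x) => r1 i1 [r2 i2] /= [-> ->].
pose F := fun y => u (clamp a b y) ^+ 2 + v (clamp a b y) ^+ 2.
have cF : continuous F.
  have h1 := clampC_cont hu (c := 0); have h2 := clampC_cont hv (c := 0).
  rewrite (_ : F = fun y => (u (clamp a b y) - 0) ^+ 2 + (v (clamp a b y) - 0) ^+ 2).
    by move=> y; exact: (cvgD (h1 y) (h2 y)).
  by apply/funext => y; rewrite !subr0.
have [z] := EVT_max (ltW ab) (@continuous_subspaceT _ _ _ F cF).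
rewrite in_itv /= => zI Hz; pose m := u z ^+ 2 + v z ^+ 2.
have max_m x : a <= x <= b -> u x ^+ 2 + v x ^+ 2 <= m.
  by move=> xI; have := Hz x; rewrite in_itv => /(_ xI); rewrite /F !clamp_id.
have m0 : 0 < m.
  have xI : a <= x0 <= b by move: x0I; rewrite /= in_itv.
  apply: lt_le_trans (max_m x0 xI); rewrite lt_neqAle addr_ge0 ?sqr_ge0// andbT eq_sym.
  rewrite paddr_eq0 ?sqr_ge0// !sqrf_eq0; apply: contra phi0 => /andP[/eqP ru /eqP iv].
  by rewrite eq_complex /= -/(u x0) -/(v x0) ru iv eqxx.
have top0 : top u v m !=set0 by exists z; split.
have eu x xI := (eig x xI).1; have ev x xI := (eig x xI).2.
suff [e1 e2 e3] : [/\ complex.Re lambda = 1, complex.Im lambda = 0 &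
    forall x y, a <= x <= b -> a <= y <= b -> u x = u y /\ v x = v y].
  split; first by apply/eqP; rewrite eq_complex e1 e2 /= !eqxx.
  exists (phi a) => x; rewrite /= in_itv /= => xI.
  have [|ux vx] := e3 x a xI; first by rewrite lexx ltW.
  by apply/eqP; rewrite eq_complex; apply/andP; split; apply/eqP.
case: H => [prox|[fmin|qs]].
- exact: (proximal_eigenvalue hu hv unit_l eu ev max_m m0 top0 pP prox).
- exact: (minimal_eigenvalue hu hv unit_l eu ev max_m m0 top0 fmin).
- by case: (quasi_symmetric_absurd qs).
Qed.

End SpectralGap.

End Setting.

Theorem proposition16 (R : realType) (d : measure_display)
    (T : measurableType d) (p : probability T R)
    (P : probability (path_space T) R) (a b : R) (f : T -> R -> R) :
  let I : set R := [set` `[a, b]] in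
  is_product_measure p P ->
  a < b ->
  random_map I f ->
  {ae P, forall w, C1_diffeo_onto_image I (f (w 0%N))} ->
  (\int[P]_w sup_norm_on I (fun x => ln `|derivative_on I (f (w 0%N)) x|)%R
     < +oo)%E ->
  ~ (exists x y, [/\ I x, I y &
       {ae P, forall w, f (w 0%N) @` [set x; y] = [set x; y]}]) ->
  mostly_contracting P I f /\
  ((exists2 beta : R, 0 < beta &
      (\int[P]_w (sup_norm_on I (derivative_on I (f (w 0%N)))) `^ beta
         < +oo)%E) ->
   exists2 alpha0 : R, 0 < alpha0 &
     forall alpha : R, 0 < alpha < alpha0 ->
       quasi_compact I alpha (koopman P f) /\
       (proximal p I f \/ minimal P I f \/ quasi_symmetric P I f ->
        spectral_gap I alpha (koopman P f))).
Proof.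
move=> I pP ab f_random [N [mN PN subN]] f_int f_noinv.
have f_diffeo w : ~ N w -> C1_diffeo_onto_image I (f (w 0%N)).
  by move=> nN; apply: contrapT => nd; apply: nN; exact: subN.
split; first exact: (mostly_contractingP ab f_random mN PN f_diffeo f_int f_noinv).
move=> [beta beta0 f_mom].
have [alpha0 alpha00 H] :=
  holder_quasi_compact ab f_random mN PN f_diffeo f_int f_noinv beta0 f_mom.
exists alpha0 => // alpha /[dup] /H[alpha1 qc] /andP[al0 _]; split => //.
exact: (koopman_spectral_gap ab f_random mN PN f_diffeo f_noinv al0 pP qc).
Qed.
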